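(* Let $(M,g)$ be a connected strongly spin pseudo-Riemannian manifold of signature $(p,p)$, let $(S,\gamma^S,\mathscr{B})$ be an irreducible paired spinor bundle of positive adjoint type on $(M,g)$, and let $\xi\in\Gamma(S^\mu)$ be a nowhere vanishing irreducible real pure spinor of chirality $\mu\in\{\pm1\}$. Let $\alpha\in\Omega^p(M)$ be the signed square of $\xi$ and let $A\in\Gamma(T^*M\otimes\mathfrak{so}(M,g))$ be a metric contorsion tensor. Then $\nabla^{S,A}\xi=0$ if and only if $$\nabla^g_X\alpha=A_X\triangle_1\alpha\qquad\text{for all }X\in\Gamma(TM).$$ Moreover, in this case the rank-$p$ vector bundle $\mathcal{U}=\{\theta\in T^*M:\theta\wedge\alpha=0\}\subset T^*M$ is preserved by $\nabla^{g,A}$.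
   Context: $(M,g)$ is oriented; it is strongly spin if its orthonormal frame bundle reduces to $\mathrm{SO}_0(p,p)$ and this reduction lifts to $\mathrm{Spin}_0(p,p)$. $\nu$ is the volume form, $\nabla^g$ the Levi-Civita connection. $\mathrm{Cl}(M,g)$ is the bundle of real Clifford algebras of $(T^*M,g^* )$ with $\theta^2=g^*(\theta,\theta)$, identified via the Chevalley-Riesz isomorphism $\Psi$ (identity on $T^*M$) with $\Lambda T^*M$ with the associative geometric product determined by $\theta\diamond\beta=\theta\wedge\beta+\iota_{\theta^\sharp}\beta$. A bundle of irreducible real Clifford modules $(S,\gamma^S)$ is a real vector bundle with a morphism of unital algebra bundles $\gamma^S:\mathrm{Cl}(M,g)\to\mathrm{End}(S)$, irreducible on fibers ($\mathrm{rk}\,S=2^p$). It is paired of positive adjoint type if equipped with a smooth non-degenerate fiberwise bilinear pairing $\mathscr{B}$, symmetric or skew-symmetric, with $\mathscr{B}(\gamma^S(x)\xi_1,\xi_2)=\mathscr{B}(\xi_1,\gamma^S(\tau(x))\xi_2)$, $\tau$ the reversion. Such an $S$ is associated to a strong spin structure through the representation of $\mathrm{Spin}_0(p,p)$; $\nabla^S$ denotes the lift of $\nabla^g$ to $S$. $S^\mu=\{\xi:\gamma^S(\nu)\xi=\mu\xi\}$; $\Psi_\gamma=\gamma^S\circ\Psi$; $\beta\cdot\xi=\Psi_\gamma(\beta)\xi$. The signed square of $\xi\in\Gamma(S)$ is $\alpha=\Psi_\gamma^{-1}(\kappa\,\xi\otimes\mathscr{B}(-,\xi))$ for some $\kappa\in\{\pm1\}$.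 A nowhere vanishing $\xi$ is pure if at each point $m$ the space $\{\theta\in T_m^*M:\gamma^S(\theta)\xi_m=0\}$ has maximal possible dimension $p$; its signed square is then a nowhere vanishing, locally decomposable $p$-form. $\mathfrak{so}(M,g)$ is the bundle of $g$-skew-symmetric endomorphisms of $TM$. For $A\in\Gamma(T^*M\otimes\mathfrak{so}(M,g))$, $\nabla^{g,A}_XY=\nabla^g_XY+A(X,Y)$ is a metric connection on $TM$ (inducing one on $T^*M$). $A_X=A(X,-)$ is identified with a two-form using $g$, by $A_X(Y,Z)=g(Y,A(X,Z))$. The lift of $\nabla^{g,A}$ to $S$ is $\nabla^{S,A}_X\xi=\nabla^S_X\xi+\frac12A_X\cdot\xi$. For a local frame $\{e_i\}$ with inverse metric matrix $g^{ij}$, $\beta\triangle_1\delta=g^{ij}(\iota_{e_i}\beta)\wedge(\iota_{e_j}\delta)$. A subbundle $\mathcal{U}\subset T^*M$ is preserved by $\nabla^{g,A}$ if $\nabla^{g,A}_X\theta\in\Gamma(\mathcal{U})$ for all $X\in\Gamma(TM)$, $\theta\in\Gamma(\mathcal{U})$.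
   Formalization: The pairing B is additionally assumed to be induced by a fixed bilinear form in the frames of the strong spin structure (so parallel for the lifted connection); otherwise rescaling B by a nonconstant function rescales the signed square and the equivalence fails. *)

(* Defs.v *)
From HB Require Import structures.
From mathcomp Require Import all_boot all_order all_algebra.
From mathcomp Require Import all_classical all_reals all_analysis.
From mathcomp Require Import ring.

Set Implicit Arguments.
Unset Strict Implicit.
Unset Printing Implicit Defensive.

Import Order.TTheory GRing.Theory Num.Theory.
Import numFieldNormedType.Exports.

Local Open Scope classical_set_scope.
Local Open Scope ring_scope.

Fixpoint is_Ck (R : realType) (n : nat) (k : nat) (U : set 'rV[R]_n)
    (f : 'rV[R]_n -> R) : Prop :=
  if k is k'.+1 then
    (forall x, U x -> differentiable f x) /\
    (forall v, is_Ck k' U (fun x => 'D_v f x))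
  else forall x, U x -> {for x, continuous f}.

(* C^oo on a neighbourhood of x *)
Definition smooth_near (R : realType) (n : nat) (f : 'rV[R]_n -> R)
    (x : 'rV[R]_n) : Prop :=
  exists U, [/\ open U, U x & forall k, is_Ck k U f].

Record chart (R : realType) (n : nat) (M : topologicalType) := Chart {
  cdom : set M;
  cmap : M -> 'rV[R]_n;
  cinv : 'rV[R]_n -> M;
  cdom_open : open cdom;
  cimg_open : open (cmap @` cdom);
  cmapK : forall m, cdom m -> cinv (cmap m) = m;
  cmap_continuous : forall m, cdom m -> {for m, continuous cmap};
  cinv_continuous : forall m, cdom m -> {for cmap m, continuous cinv} }.

(* [chart_at m] is a chosen chart of the atlas around [m]; it is used to
   present the tangent space at [m] as R^n, see below. *)
Record manifold (R : realType) (n : nat) := Manifold {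
  mcar :> topologicalType;
  mhausdorff : hausdorff_space mcar;
  msecond_countable : @second_countable mcar;
  atlas : set (chart R n mcar);
  chart_at : mcar -> chart R n mcar;
  chart_at_atlas : forall m, atlas (chart_at m);
  chart_at_dom : forall m, cdom (chart_at m) m;
  atlas_compat : forall c c' m, atlas c -> atlas c' -> cdom c m -> cdom c' m ->
    forall i, smooth_near (fun x => cmap c' (cinv c x) 0 i) (cmap c m) }.

Section Manifolds.
Context (R : realType) (n : nat) (M : manifold R n).

Definition smooth_fun (f : M -> R) (m : M) : Prop :=
  smooth_near (f \o cinv (chart_at m)) (cmap (chart_at m) m).

(* The tangent space at [m] is presented as R^n through the components in
   [chart_at m] (so the identification with R^n is not continuous in [m]);
   the cotangent space is its dual, also presented as row vectors. *)
Definition vfield := M -> 'rV[R]_n.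

Definition dird (m : M) (v : 'rV[R]_n) (f : M -> R) : R :=
  'D_v (f \o cinv (chart_at m)) (cmap (chart_at m) m).

(* components, in the chart c, of the vector v tangent at m *)
Definition chart_comp (c : chart R n M) (m : M) (v : 'rV[R]_n) : 'rV[R]_n :=
  \row_i dird m v (fun m' => cmap c m' 0 i).

Definition smooth_vfield (X : vfield) (m : M) : Prop :=
  forall i, smooth_fun (fun m' => chart_comp (chart_at m) m' (X m') 0 i) m.

(* the i-th coordinate vector field of chart_at m, defined near m *)
Definition coordf (m : M) (i : 'I_n) : vfield := fun m' =>
  'D_(delta_mx 0 i) (cmap (chart_at m') \o cinv (chart_at m))
     (cmap (chart_at m) m').

(* Covariant derivatives on a bundle with fibres [F] and (germs of) smooth
   sections [sm].  The operator acts on sections that need only be smooth near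
   the point of differentiation; the Leibniz rule, applied to indicator
   functions of neighbourhoods of m, makes it local. *)
Record connection (F : M -> lmodType R)
    (sm : (forall m, F m) -> M -> Prop)
    (nab : forall m : M, 'rV[R]_n -> (forall m, F m) -> F m) : Prop :=
  Connection {
  conn_linear : forall m s, sm s m -> forall a v w,
    nab m (a *: v + w) s = a *: nab m v s + nab m w s;
  conn_add : forall m v s t, sm s m -> sm t m ->
    nab m v (fun m' => s m' + t m') = nab m v s + nab m v t;
  conn_leibniz : forall m v f s, smooth_fun f m -> sm s m ->
    nab m v (fun m' => f m' *: s m') = dird m v f *: s m + f m *: nab m v s;
  conn_smooth : forall m X s, smooth_vfield X m -> sm s m ->
    sm (fun m' => nab m' (X m') s) m }.

Definition tconn := M -> 'rV[R]_n -> vfield -> 'rV[R]_n.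

Definition tangent_connection (nab : tconn) : Prop :=
  @connection (fun _ => 'rV[R]_n) smooth_vfield nab.

End Manifolds.

(* [a I] is the coefficient of dx^{i_1} /\ ... /\ dx^{i_k}, where
   I = {i_1 < ... < i_k}. *)
Definition ext (R : realType) (n : nat) : lmodType R :=
  {ffun {set 'I_n} -> R^o}.

Section Exterior.
Context (R : realType) (n : nat).
Implicit Types (a b : ext R n) (v : 'rV[R]_n).

Definition ext1 : ext R n := [ffun I => (I == finset.set0)%:R].

Definition covec (theta : 'rV[R]_n) : ext R n :=
  \sum_i theta 0 i *: ([ffun I => (I == [set i]%SET)%:R] : ext R n).

Definition homogeneous (k : nat) a : Prop :=
  forall I : {set 'I_n}, #|I| != k -> a I = 0.

Definition inversions (I J : {set 'I_n}) : nat :=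
  #|[set ij : 'I_n * 'I_n | [&& ij.1 \in I, ij.2 \in J & (ij.2 < ij.1)%N]]%SET|.

Definition wedge a b : ext R n :=
  [ffun K : {set 'I_n} => \sum_(I : {set 'I_n} | I \subset K)
     (-1) ^+ inversions I (K :\: I) * (a I * b (K :\: I))].

Definition iprod v a : ext R n :=
  [ffun J : {set 'I_n} => \sum_(i | i \notin J)
     (-1) ^+ inversions [set i]%SET J * (v 0 i * a (i |: J)%SET)].

(* contraction from the right: (-1)^(deg a - 1) iota_v a *)
Definition rprod v a : ext R n :=
  [ffun J : {set 'I_n} => (-1) ^+ #|J| * iprod v a J].

(* a(v_1, ..., v_k) *)
Definition ext_eval a (vs : seq 'rV[R]_n) : R :=
  foldl (fun a' v => iprod v a') a vs finset.set0.

Definition reversion a : ext R n :=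
  [ffun I : {set 'I_n} => (-1) ^+ 'C(#|I|, 2) * a I].

(* iterated contraction of the right end of a with the left end of b *)
Fixpoint contract (gi : 'M[R]_n) (k : nat) a b : ext R n :=
  if k is k'.+1 then
    \sum_i \sum_j gi i j *:
      contract gi k' (rprod (delta_mx 0 i) a) (iprod (delta_mx 0 j) b)
  else wedge a b.

(* The geometric product for the inverse metric gi, in closed form.  It is the
   associative unital product satisfying [gprod_covec] below. *)
Definition gprod (gi : 'M[R]_n) a b : ext R n :=
  \sum_(k < n.+1) (k`!%:R)^-1 *: contract gi k a b.

Definition triangle1 (gi : 'M[R]_n) a b : ext R n :=
  \sum_i \sum_j gi i j *:
    wedge (iprod (delta_mx 0 i) a) (iprod (delta_mx 0 j) b).

(* the two-form with components w i j = - w j i *)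
Definition twoform (w : 'I_n -> 'I_n -> R) : ext R n :=
  2^-1 *: \sum_i \sum_j w i j *:
    wedge (covec (delta_mx 0 i)) (covec (delta_mx 0 j)).


Lemma rprod_covec (i : 'I_n) (theta : 'rV[R]_n) :
  rprod (delta_mx 0 i) (covec theta) = theta 0 i *: ext1.
Proof.
have iv0 (k : 'I_n) : inversions [set k]%SET finset.set0 = 0%N.
  by apply: eq_card0 => -[x y]; rewrite !inE andbF.
apply/ffunP => J; rewrite !ffunE.
have [->|J0] := eqVneq J finset.set0.
  rewrite cards0 expr0 mul1r (bigD1 i) ?inE //= iv0 expr0 mul1r mxE !eqxx mul1r.
  rewrite big1 ?addr0 => [|k /andP[_ ki]]; last first.
    by rewrite mxE (negbTE ki) andbF mul0r mulr0.
  rewrite finset.setU0 /covec sum_ffunE (bigD1 i) //= big1 ?addr0 => [|k ki].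
    by rewrite !ffunE eqxx.
  by rewrite !ffunE (inj_eq set1_inj) eq_sym (negbTE ki) scaler0.
rewrite scaler0 big1 ?mulr0 // => k kJ.
rewrite /covec sum_ffunE big1 ?mulr0 // => l _; rewrite !ffunE.
case: eqP => [E|_]; last by rewrite scaler0.
case/set0Pn: J0 => x xJ.
have : x \in [set l]%SET by rewrite -E !inE xJ orbT.
have : k \in [set l]%SET by rewrite -E !inE eqxx.
by rewrite !inE => /eqP kl /eqP xl; move: kJ; rewrite kl -xl xJ.
Qed.

Lemma wedge_ext1 b : wedge (ext1) b = b.
Proof.
apply/ffunP => K; rewrite ffunE (bigD1 finset.set0) ?finset.sub0set //=.
rewrite big1 ?addr0 => [|I /andP[_ I0]]; last first.
  by rewrite ffunE (negbTE I0) mul0r mulr0.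
rewrite finset.setD0 ffunE eqxx mul1r.
rewrite [inversions _ _]eq_card0 ?expr0 ?mul1r // => -[x y].
by rewrite !inE.
Qed.

Lemma wedgeZl c a b : wedge (c *: a) b = c *: wedge a b.
Proof.
apply/ffunP => K; rewrite !ffunE scaler_sumr; apply: eq_bigr => I _.
by rewrite !ffunE /GRing.scale /=; ring.
Qed.

Lemma rprod_ext1 c v : rprod v (c *: ext1) = 0.
Proof.
apply/ffunP => J; rewrite !ffunE big1 ?mulr0 // => i _.
rewrite !ffunE; case: eqP => [E|_]; last by rewrite scaler0 !mulr0.
by have := setU11 i J; rewrite E inE.
Qed.

Lemma contract0 gi k b : contract gi k 0 b = 0.
Proof.
elim: k b => [|k IHk] b /=.
  by rewrite -[0 in LHS](scale0r 0) wedgeZl scale0r.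
apply: big1 => i _; apply: big1 => j _.
by rewrite -[in rprod _ _](scale0r (ext1)) rprod_ext1 IHk scaler0.
Qed.

Lemma sum_inv_fact (F : nat -> ext R n) :
  (n = 0%N -> F 1%N = 0) -> (forall k, F k.+2 = 0) ->
  \sum_(k < n.+1) (k`!%:R)^-1 *: F k = F 0%N + F 1%N.
Proof.
move=> F1 F2; rewrite big_ord_recl fact0 invr1 scale1r; congr (_ + _).
have [n0|n_gt0] := posnP n.
  by rewrite F1 // big1 // => -[i lt_i]; exfalso; rewrite n0 in lt_i.
rewrite (bigD1 (Ordinal n_gt0)) //= big1 ?addr0 => [|[[|i] lt_i] //= _].
  by rewrite /bump /= invr1 scale1r.
by rewrite /bump /= F2 scaler0.
Qed.

Lemma gprod_covec gi (theta : 'rV[R]_n) b :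
  gprod gi (covec theta) b =
  wedge (covec theta) b + iprod (theta *m gi) b.
Proof.
have c2 k : contract gi k.+2 (covec theta) b = 0.
  rewrite /=; apply: big1 => i _; apply: big1 => j _.
  rewrite big1 ?scaler0 // => i' _; apply: big1 => j' _.
  by rewrite rprod_covec rprod_ext1 contract0 scaler0.
have c1 : contract gi 1 (covec theta) b = iprod (theta *m gi) b.
  apply/ffunP => J; rewrite /= sum_ffunE [RHS]ffunE.
  transitivity (\sum_(i < n) \sum_(j | j \notin J)
     theta 0 i * gi i j * ((-1) ^+ inversions [set j]%SET J * b (j |: J)%SET)).
    apply: eq_bigr => i _; rewrite sum_ffunE [RHS]big_mkcond /=.
    apply: eq_bigr => j _; rewrite rprod_covec wedgeZl wedge_ext1 !ffunE.
    rewrite /GRing.scale /=; case: ifPn => jJ.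
      rewrite (bigD1 j) //= big1 ?addr0 => [|k /andP[_ kj]].
        by rewrite mxE !eqxx /=; ring.
      by rewrite mxE (negbTE kj) andbF mul0r mulr0.
    rewrite big1 ?mulr0 // => k kJ; rewrite mxE.
    case: (eqVneq k j) => [E|_]; first by rewrite E (negbTE jJ) in kJ.
    by rewrite andbF mul0r mulr0.
  rewrite exchange_big /=; apply: eq_bigr => j _.
  by rewrite mxE mulr_suml mulr_sumr; apply: eq_bigr => i _; ring.
rewrite -c1; apply: (sum_inv_fact (F := fun k => contract gi k _ b)) => // n0.
by rewrite /= !big1 // => -[i lt_i]; exfalso; rewrite n0 in lt_i.
Qed.

End Exterior.

Section Forms.
Context (R : realType) (n : nat) (M : manifold R n).

Definition smooth_form (alpha : M -> ext R n) (m : M) : Prop :=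
  forall I : {set 'I_n},
    smooth_fun (fun m' => ext_eval (alpha m') [seq coordf m i m' | i <- enum I]) m.

(* Omega^k(M) *)
Definition is_form (k : nat) (alpha : M -> ext R n) : Prop :=
  forall m, homogeneous k (alpha m) /\ smooth_form alpha m.

Definition smooth_covector (theta : M -> 'rV[R]_n) (m : M) : Prop :=
  smooth_form (fun m' => covec (theta m')) m.

(* The induced derivative of forms,
     (nabla_v alpha)(Y_1, ..., Y_k) = v (alpha(Y_1, ..., Y_k))
       - \sum_l alpha(Y_1, ..., nabla_v Y_l, ..., Y_k),
   evaluated on the coordinate fields of [chart_at m], which form at m the
   standard basis of R^n = T_m M. *)
Definition nabla_form (nab : tconn M) (alpha : M -> ext R n) (m : M)
    (v : 'rV[R]_n) : ext R n :=
  [ffun I : {set 'I_n} =>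
     dird m v (fun m' => ext_eval (alpha m') [seq coordf m i m' | i <- enum I])
     - \sum_(l <- enum I)
         ext_eval (alpha m)
           [seq (if i == l then nab m v (coordf m l) else coordf m i m)
              | i <- enum I]].

Definition nabla_covector (nab : tconn M) (theta : M -> 'rV[R]_n) (m : M)
    (v : 'rV[R]_n) : 'rV[R]_n :=
  \row_i (dird m v (fun m' => \sum_j theta m' 0 j * coordf m i m' 0 j)
          - \sum_j theta m 0 j * nab m v (coordf m i) 0 j).

Definition is_subbundle (k : nat) (U : M -> set 'rV[R]_n) : Prop :=
  forall m0, exists W : set M, exists theta : 'I_k -> M -> 'rV[R]_n,
    [/\ open W, W m0 &
      forall m, W m ->
        [/\ forall l, smooth_covector (theta l) m,
            free [seq theta l m | l <- enum 'I_k] &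
            forall omega, U m omega <->
              omega \in <<[seq theta l m | l <- enum 'I_k]>>%VS]].

(* nabla_v theta is smooth whenever theta is and v ranges over a smooth vector
   field, so membership in Gamma(U) reduces to pointwise membership in U. *)
Definition preserved (nab : tconn M) (U : M -> set 'rV[R]_n) : Prop :=
  forall theta, (forall m, smooth_covector theta m) ->
    (forall m, U m (theta m)) ->
    forall m v, U m (nabla_covector nab theta m v).

End Forms.

Section Metric.
Context (R : realType).

Definition eta (p : nat) (a : 'I_(p + p)) : R := if (a < p)%N then 1 else -1.

Definition dot (n : nat) (g : 'M[R]_n) (v w : 'rV[R]_n) : R :=
  (v *m g *m w^T) 0 0.

Definition orthonormal (p : nat) (g : 'M[R]_(p + p))
    (e : 'I_(p + p) -> 'rV[R]_(p + p)) : Prop :=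
  forall a b, dot g (e a) (e b) = if a == b then eta a else 0.

Record split_metric (p : nat) (M : manifold R (p + p)) := SplitMetric {
  gmx :> M -> 'M[R]_(p + p);
  gmx_sym : forall m, (gmx m)^T = gmx m;
  gmx_signature : forall m, exists e, orthonormal (gmx m) e;
  gmx_smooth : forall m X Y, smooth_vfield X m -> smooth_vfield Y m ->
    smooth_fun (fun m' => dot (gmx m') (X m') (Y m')) m }.

Context (p : nat) (M : manifold R (p + p)) (g : split_metric M).
Local Notation n := (p + p)%N.

Definition ginv (m : M) : 'M[R]_n := invmx (g m).

Definition flat (m : M) (v : 'rV[R]_n) : 'rV[R]_n := v *m g m.

(* An orientation, given by its volume form e^1 /\ ... /\ e^n, where e is a
   positively oriented orthonormal frame, the first p vectors being positive.
   With |nu(e_1, ..., e_n)| = 1 for one such frame, the same holds for all. *)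
Record volume_form (nu : M -> ext R n) : Prop := VolumeForm {
  vol_form : is_form n nu;
  vol_unit : forall m, exists2 e, orthonormal (g m) e &
    ext_eval (nu m) [seq e a | a <- enum 'I_n] = 1 }.

Record levi_civita (nab : tconn M) : Prop := LeviCivita {
  lc_connection : tangent_connection nab;
  lc_metric : forall m v Y Z, smooth_vfield Y m -> smooth_vfield Z m ->
    dird m v (fun m' => dot (g m') (Y m') (Z m')) =
      dot (g m) (nab m v Y) (Z m) + dot (g m) (Y m) (nab m v Z);
  lc_torsion_free : forall m X Y f,
    smooth_vfield X m -> smooth_vfield Y m -> smooth_fun f m ->
    dird m (nab m (X m) Y - nab m (Y m) X) f =
      dird m (X m) (fun m' => dird m' (Y m') f) -
      dird m (Y m) (fun m' => dird m' (X m') f) }.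

(* sections of T*M (x) so(M, g) *)
Record contorsion (A : M -> 'rV[R]_n -> 'rV[R]_n -> 'rV[R]_n) : Prop :=
  Contorsion {
  cont_linearl : forall m a v w Y,
    A m (a *: v + w) Y = a *: A m v Y + A m w Y;
  cont_linearr : forall m v a Y Z,
    A m v (a *: Y + Z) = a *: A m v Y + A m v Z;
  cont_skew : forall m v Y Z,
    dot (g m) (A m v Y) Z = - dot (g m) Y (A m v Z);
  cont_smooth : forall m X Y, smooth_vfield X m -> smooth_vfield Y m ->
    smooth_vfield (fun m' => A m' (X m') (Y m')) m }.

(* A_v(Y, Z) = g(Y, A(v, Z)) *)
Definition cont_form (A : M -> 'rV[R]_n -> 'rV[R]_n -> 'rV[R]_n) (m : M)
    (v : 'rV[R]_n) : ext R n :=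
  twoform (fun i j => dot (g m) (delta_mx 0 i) (A m v (delta_mx 0 j))).

Definition add_contorsion (nab : tconn M)
    (A : M -> 'rV[R]_n -> 'rV[R]_n -> 'rV[R]_n) : tconn M :=
  fun m v Y => nab m v Y + A m v (Y m).

End Metric.

Section Spin.
Context (R : realType) (p : nat).
Local Notation n := (p + p)%N.
Local Notation N := (2 ^ p)%N.

(* An irreducible real representation of Cl(p,p), given by the images of the
   standard orthonormal basis.  As Cl(p,p) is isomorphic to M_N(R), any
   representation of dimension N is irreducible and faithful. *)
Record clifford_model := CliffordModel {
  gam0 :> 'I_n -> 'M[R]_N;
  gam0_rel : forall a b, gam0 a *m gam0 b + gam0 b *m gam0 a =
    (2 * (if a == b then eta R a else 0))%:M }.

Variable G : clifford_model.

Definition gam0v (u : 'rV[R]_n) : 'M[R]_N := \sum_a u 0 a *: G a.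

Definition sqn (u : 'rV[R]_n) : R := \sum_a eta R a * u 0 a ^+ 2.

(* Spin_0(p,p): products of unit vectors, with an even number of vectors of
   square 1 and an even number of square -1.  This is the preimage of SO_0(p,p)
   under the double cover Spin(p,p) -> SO(p,p). *)
Definition spin0 : set 'M[R]_N := [set x | exists us : seq 'rV[R]_n,
  [/\ all (fun u => (sqn u == 1) || (sqn u == -1)) us,
      ~~ odd (count (fun u => sqn u == 1) us),
      ~~ odd (count (fun u => sqn u == -1) us) &
      x = \big[mulmx/1%:M]_(u <- us) gam0v u]].

Context (M : manifold R n) (g : split_metric M).

(* The principal bundle is given by a trivializing cover with Spin_0(p,p)
   valued transition functions [sp_h i j], which lift under the double cover
   the transition functions of the oriented orthonormal frames [sp_e i].  The
   latter transition functions are then in SO_0(p,p), so that these frames also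
   determine the reduction of the frame bundle. *)
Record strong_spin_structure (nu : M -> ext R n) := StrongSpinStructure {
  sp_index : Type;
  sp_dom : sp_index -> set M;
  sp_e : sp_index -> 'I_n -> vfield M;
  sp_h : sp_index -> sp_index -> M -> 'M[R]_N;
  sp_open : forall i, open (sp_dom i);
  sp_cover : forall m, exists i, sp_dom i m;
  sp_e_smooth : forall i a m, sp_dom i m -> smooth_vfield (sp_e i a) m;
  sp_e_orthonormal : forall i m, sp_dom i m ->
    orthonormal (g m) (fun a => sp_e i a m);
  sp_e_oriented : forall i m, sp_dom i m ->
    ext_eval (nu m) [seq sp_e i a m | a <- enum 'I_n] = 1;
  sp_h_smooth : forall i j m, sp_dom i m -> sp_dom j m -> forall k l,
    smooth_fun (fun m' => sp_h i j m' k l) m;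
  sp_h_spin0 : forall i j m, sp_dom i m -> sp_dom j m -> spin0 (sp_h i j m);
  sp_h_cocycle : forall i j k m, sp_dom i m -> sp_dom j m -> sp_dom k m ->
    sp_h i j m *m sp_h j k m = sp_h i k m;
  sp_h_lift : forall i j m, sp_dom i m -> sp_dom j m ->
    exists L : 'M[R]_n,
      (forall b, sp_e j b m = \sum_a L a b *: sp_e i a m) /\
      (forall b, sp_h i j m *m G b = (\sum_a L a b *: G a) *m sp_h i j m) }.

End Spin.

(* A smooth vector bundle of rank r, with a chosen local frame around each
   point. *)
Record vbundle (R : realType) (n : nat) (M : manifold R n) (r : nat) :=
  VBundle {
  vfib :> M -> vectType R;
  vframe_dom : M -> set M;
  vframe : M -> 'I_r -> forall m, vfib m;
  vframe_open : forall m0, open (vframe_dom m0);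
  vframe_mem : forall m0, vframe_dom m0 m0;
  vframe_basis : forall m0 m, vframe_dom m0 m ->
    basis_of fullv [tuple vframe m0 i m | i < r];
  vframe_compat : forall m0 m1 m, vframe_dom m0 m -> vframe_dom m1 m ->
    forall i j, smooth_fun (fun m' =>
      coord [tuple vframe m0 k m' | k < r] i (vframe m1 j m')) m }.

Definition section R n (M : manifold R n) r (S : vbundle M r) : Type :=
  forall m, S m.

Definition smooth_section R n (M : manifold R n) r (S : vbundle M r)
    (s : section S) (m : M) : Prop :=
  forall i, smooth_fun (fun m' =>
    coord [tuple vframe S m k m' | k < r] i (s m')) m.

Section Spinors.
Context (R : realType) (p : nat) (M : manifold R (p + p)).
Context (g : split_metric M).
Local Notation n := (p + p)%N.
Local Notation N := (2 ^ p)%N.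

(* [gam] is the composition of the Clifford action with the Chevalley-Riesz
   isomorphism, i.e. the action of forms on spinors. *)
Record clifford_module (S : vbundle M N)
    (gam : forall m, ext R n -> 'End(S m)) : Prop := CliffordModule {
  gam_linear : forall m a x y, gam m (a *: x + y) = a *: gam m x + gam m y;
  gam_unit : forall m, gam m (ext1 R n) = \1%VF;
  gam_mul : forall m x y,
    gam m (gprod (ginv g m) x y) = (gam m x \o gam m y)%VF;
  gam_smooth : forall m alpha s, smooth_form alpha m -> smooth_section s m ->
    smooth_section (fun m' => gam m' (alpha m') (s m') : S m') m;
  gam_irreducible : forall m (W : {vspace S m}),
    (forall x, (gam m x @: W <= W)%VS) -> W = 0%VS \/ W = fullv }.

Record pairing (S : vbundle M N) (gam : forall m, ext R n -> 'End(S m))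
    (B : forall m, S m -> S m -> R) : Prop := Pairing {
  pair_linearl : forall m a s t u, B m (a *: s + t) u = a * B m s u + B m t u;
  pair_linearr : forall m a s t u, B m u (a *: s + t) = a * B m u s + B m u t;
  pair_nondegenerate : forall m s, (forall t, B m s t = 0) -> s = 0;
  pair_symmetry : (forall m s t, B m s t = B m t s) \/
                  (forall m s t, B m s t = - B m t s);
  pair_smooth : forall m (s t : section S),
    smooth_section s m -> smooth_section t m ->
    smooth_fun (fun m' => B m' (s m') (t m')) m;
  pair_adjoint : forall m x s t,
    B m (gam m x s) t = B m s (gam m (reversion x) t) }.

Context (G : clifford_model R p) (nu : M -> ext R n).
Context (Q : strong_spin_structure G g nu).

(* (S, gam, B) is associated to Q through the representation G of Spin_0(p,p)
   on R^N; [f i] is the frame of S induced by the local section i of Q.  The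
   pairing comes from a bilinear form B0 on R^N: a pairing that is only
   compatible with gam would be determined up to a nowhere vanishing function,
   and would not be parallel for the lifted connection. *)
Record associated (S : vbundle M N) (gam : forall m, ext R n -> 'End(S m))
    (B : forall m, S m -> S m -> R)
    (f : sp_index Q -> 'I_N -> section S) : Prop := Associated {
  as_smooth : forall i k m, sp_dom i m -> smooth_section (f i k) m;
  as_basis : forall i m, sp_dom i m ->
    basis_of fullv [tuple f i k m | k < N];
  as_transition : forall i j m, sp_dom i m -> sp_dom j m -> forall l,
    f j l m = \sum_k sp_h i j m k l *: f i k m;
  as_gam : forall i m, sp_dom i m -> forall a l,
    gam m (covec (flat g m (sp_e i a m))) (f i l m) =
      \sum_k G a k l *: f i k m;
  as_pairing : exists B0 : 'M[R]_N, forall i m, sp_dom i m -> forall k l,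
    B m (f i k m) (f i l m) = B0 k l }.

(* The connection on S lifting nab: a local section of Q with induced frames e
   and f pulls back the connection form to the so(p,p)-valued matrix
   w_ab = g(e_a, nab e_b), which acts on f through the isomorphism of so(p,p)
   with spin(p,p), i.e. as 1/2 times the two-form w. *)
Record spin_lift (S : vbundle M N) (gam : forall m, ext R n -> 'End(S m))
    (f : sp_index Q -> 'I_N -> section S) (nab : tconn M)
    (nabS : forall m, 'rV[R]_n -> section S -> S m) : Prop := SpinLift {
  lift_connection :
    @connection R n M (fun m => S m) (@smooth_section R n M N S) nabS;
  lift_frame : forall i m v k, sp_dom i m ->
    nabS m v (f i k) =
      2^-1 *: gam m (2^-1 *: \sum_a \sum_b
        dot (g m) (sp_e i a m) (nab m v (sp_e i b)) *:
          wedge (covec (eta R a *: flat g m (sp_e i a m)))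
                (covec (eta R b *: flat g m (sp_e i b m)))) (f i k m) }.

Definition lift_contorsion (S : vbundle M N)
    (gam : forall m, ext R n -> 'End(S m))
    (nabS : forall m, 'rV[R]_n -> section S -> S m)
    (A : M -> 'rV[R]_n -> 'rV[R]_n -> 'rV[R]_n) :
    forall m, 'rV[R]_n -> section S -> S m :=
  fun m v s => nabS m v s + 2^-1 *: gam m (cont_form g A m v) (s m).

(* smooth section of S^mu *)
Definition chiral (S : vbundle M N) (gam : forall m, ext R n -> 'End(S m))
    (mu : R) (xi : section S) : Prop :=
  (forall m, smooth_section xi m) /\
  (forall m, gam m (nu m) (xi m) = mu *: xi m).

Definition pure (S : vbundle M N) (gam : forall m, ext R n -> 'End(S m))
    (xi : section S) : Prop :=
  forall m, exists2 V : {vspace 'rV[R]_n},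
    forall theta, theta \in V <-> gam m (covec theta) (xi m) = 0 &
    \dim V = p.

(* alpha = gam^-1 (kappa xi (x) B(-, xi)); gam is fibrewise bijective because
   Cl(p,p) is isomorphic to M_N(R) *)
Definition signed_square (S : vbundle M N)
    (gam : forall m, ext R n -> 'End(S m)) (B : forall m, S m -> S m -> R)
    (xi : section S) (alpha : M -> ext R n) : Prop :=
  exists2 kappa : R, kappa = 1 \/ kappa = -1 &
    forall m s, gam m (alpha m) s = (kappa * B m s (xi m)) *: xi m.

Definition annihilator (alpha : M -> ext R n) (m : M) : set 'rV[R]_n :=
  [set theta | wedge (covec theta) (alpha m) = 0].

End Spinors.

(* Main.v *)
Require Import Defs.
From HB Require Import structures.
From mathcomp Require Import all_boot all_order all_algebra.
From mathcomp Require Import all_classical all_reals all_analysis.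
From mathcomp Require Import ring.

Set Implicit Arguments.
Unset Strict Implicit.
Unset Printing Implicit Defensive.

Import Order.TTheory GRing.Theory Num.Theory.
Import numFieldNormedType.Exports.

Local Open Scope classical_set_scope.
Local Open Scope ring_scope.

(** At a point, forms act on spinors through a representation of the Clifford
    algebra of signature (p,p), which is faithful because that algebra is simple.
    The Clifford action and the pairing are parallel for the lifted connection:
      nabla (beta . s) = (nabla beta) . s + beta . nabla s
    and v (B(s, t)) = B(nabla s, t) + B(s, nabla t).  The signed square is
    defined by alpha . s = kappa B(s, xi) xi, and differentiating this equation
    gives
      (nabla_v alpha) . s = kappa (B(s, nabla_v xi) xi + B(s, xi) nabla_v xi)
    ([gam_nabla_square]).  The two-form A_v acts on spinors by an operator that
    is skew for B, and [A_v / 2, alpha] = - A_v triangle_1 alpha in the Clifford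
    algebra ([cont_op_comm], [cont_triangle1]).  Hence the same computation with
    A_v / 2 in place of nabla_v can be added, and with
    eta = nabla^{S,A}_v xi one gets ([gam_nabla_contorsion])
      (nabla_v alpha - A_v triangle_1 alpha) . s
        = kappa (B(s, eta) xi + B(s, xi) eta).
    The right-hand side vanishes for all s only if eta = 0 ([rank_two_eq0]), and
    the left-hand side vanishes for all s only if the form does ([gam_inj]).
    This is the equivalence.

    For the second part, theta /\ alpha = 0 is equivalent to theta . xi = 0
    ([signed_square_annihilator]; chirality excludes that xi is an eigenvector of
    theta).  Differentiating theta . xi = 0 along a parallel xi shows that the
    derivative of theta still annihilates xi ([parallel_preserved]).  The space
    of such theta is isotropic of dimension p, so it is a graph over the negative half of an
    orthonormal coframe with values in the positive half; Cramer's rule writes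
    this graph with smooth coefficients, which gives a local frame of the
    bundle ([kernel_covector_span]).

    Compatibility of the lifted connection with the Clifford action is the
    passage from the frames of the spin structure, in which the lift is given, to
    the coordinate frames, in which the derivative of a form is given.  In an
    orthonormal frame the Clifford action has constant coefficients
    ([gam_components]); the components of a form in the moving frame differentiate
    as in [dext_pullback_frame]; and the commutator with the spin connection form
    accounts for the derivative of the frame ([spin_op_comm]).

    The algebra rests on the anticommutation relations of contractions and
    exterior multiplications ([iprodC], [ewedgeC], [iprod_ewedge]) and on
    induction over Clifford products of covectors ([clifford_ind]): an identity
    between derivations or representations has to be checked on covectors only. *)

(** * Exterior algebra: the canonical anticommutation relations *)

Section ExteriorAlgebra.
Context (R : realType) (n : nat).
Implicit Types (a b : ext R n) (v w theta phi : 'rV[R]_n) (I J K : {set 'I_n}).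

Lemma extP a b : (forall I, a I = b I) -> a = b.
Proof. by move=> ab; apply/ffunP. Qed.

Lemma ext0E I : (0 : ext R n) I = 0. Proof. by rewrite ffunE. Qed.
Lemma extDE a b I : (a + b) I = a I + b I. Proof. by rewrite ffunE. Qed.
Lemma extNE a I : (- a) I = - a I. Proof. by rewrite ffunE. Qed.
Lemma extZE c a I : (c *: a) I = c * a I. Proof. by rewrite ffunE. Qed.
Lemma ext_sumE (T : Type) (r : seq T) (P : pred T) (F : T -> ext R n) I :
  (\sum_(i <- r | P i) F i) I = \sum_(i <- r | P i) F i I.
Proof. by rewrite sum_ffunE. Qed.
Definition extE := (ext0E, extDE, extNE, extZE, ext_sumE).

Lemma iprod_is_linear v : linear (iprod v : ext R n -> ext R n).
Proof.
move=> c a b; apply: extP => J; rewrite !extE !ffunE mulr_sumr -big_split /=.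
by apply: eq_bigr => i _; rewrite !extE; ring.
Qed.
HB.instance Definition _ v := GRing.isLinear.Build R (ext R n) (ext R n) *:%R
  (iprod v) (iprod_is_linear v).

Lemma wedge_is_linear a : linear (wedge a : ext R n -> ext R n).
Proof.
move=> c b b'; apply: extP => J; rewrite !extE !ffunE mulr_sumr -big_split /=.
by apply: eq_bigr => i _; rewrite !extE; ring.
Qed.
HB.instance Definition _ a := GRing.isLinear.Build R (ext R n) (ext R n) *:%R
  (wedge a) (wedge_is_linear a).

Lemma iprod_linl c v w a : iprod (c *: v + w) a = c *: iprod v a + iprod w a.
Proof.
apply: extP => J; rewrite !extE !ffunE mulr_sumr -big_split /=.
by apply: eq_bigr => i _; rewrite !mxE; ring.
Qed.

Lemma iprodDl v w a : iprod (v + w) a = iprod v a + iprod w a.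
Proof. by rewrite -{1}[v]scale1r iprod_linl scale1r. Qed.
Lemma iprod0l a : iprod 0 a = 0.
Proof. by apply: (addrI (iprod 0 a)); rewrite -iprodDl !addr0. Qed.
Lemma iprodZl c v a : iprod (c *: v) a = c *: iprod v a.
Proof. by rewrite -[c *: v]addr0 iprod_linl iprod0l addr0. Qed.
Lemma iprodNl v a : iprod (- v) a = - iprod v a.
Proof. by rewrite -[- v]scaleN1r iprodZl scaleN1r. Qed.
Lemma iprod_suml (T : Type) (r : seq T) (P : pred T) (F : T -> 'rV[R]_n) a :
  iprod (\sum_(i <- r | P i) F i) a = \sum_(i <- r | P i) iprod (F i) a.
Proof.
by elim/big_rec2: _ => [|i x y _ <-]; rewrite ?iprod0l // iprodDl.
Qed.

Lemma wedge_linl c a a' b :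
  wedge (c *: a + a') b = c *: wedge a b + wedge a' b.
Proof.
apply: extP => J; rewrite !extE !ffunE mulr_sumr -big_split /=.
by apply: eq_bigr => i _; rewrite !extE; ring.
Qed.

Lemma covec_is_linear : linear (@covec R n).
Proof.
move=> c v w; apply: extP => J; rewrite !extE mulr_sumr -big_split /=.
by apply: eq_bigr => i _; rewrite !extE !mxE; ring.
Qed.
HB.instance Definition _ := GRing.isLinear.Build R 'rV[R]_n (ext R n) *:%R
  (@covec R n) covec_is_linear.

Definition ewedge theta b : ext R n := wedge (covec theta) b.
HB.instance Definition _ theta := GRing.isLinear.Build R (ext R n) (ext R n) *:%R
  (ewedge theta) (wedge_is_linear (covec theta)).

Lemma ewedge_linl c v w a : ewedge (c *: v + w) a = c *: ewedge v a + ewedge w a.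
Proof. by rewrite /ewedge linearP wedge_linl. Qed.
Lemma ewedgeDl v w a : ewedge (v + w) a = ewedge v a + ewedge w a.
Proof. by rewrite -{1}[v]scale1r ewedge_linl scale1r. Qed.
Lemma ewedge0l a : ewedge 0 a = 0.
Proof. by apply: (addrI (ewedge 0 a)); rewrite -ewedgeDl !addr0. Qed.
Lemma ewedgeZl c v a : ewedge (c *: v) a = c *: ewedge v a.
Proof. by rewrite -[c *: v]addr0 ewedge_linl ewedge0l addr0. Qed.
Lemma ewedge_suml (T : Type) (r : seq T) (P : pred T) (F : T -> 'rV[R]_n) a :
  ewedge (\sum_(i <- r | P i) F i) a = \sum_(i <- r | P i) ewedge (F i) a.
Proof.
by elim/big_rec2: _ => [|i x y _ <-]; rewrite ?ewedge0l // ewedgeDl.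
Qed.

(** The sign that sorts [i] into [J] in a wedge product of basis covectors. *)
Definition isign (i : 'I_n) J : R := (-1) ^+ inversions [set i]%SET J.

Lemma isignE i J : isign i J = (-1) ^+ #|[set j in J | (j < i)%N]%SET|.
Proof.
rewrite /isign /inversions; congr (_ ^+ _).
have -> : [set ij : 'I_n * 'I_n | [&& ij.1 \in [set i]%SET, ij.2 \in J
   & (ij.2 < ij.1)%N]]%SET = [set (i, j) | j in [set j in J | (j < i)%N]%SET]%SET.
  apply/setP => -[x y]; rewrite !inE /=; apply/and3P/imsetP.
    by move=> [/eqP-> yJ yi]; exists y; rewrite ?inE ?yJ.
  by move=> [z]; rewrite inE => /andP[zJ zi] [-> ->].
by rewrite card_imset // => x y [].
Qed.

Lemma isignK i J : isign i J * isign i J = 1.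
Proof. by rewrite /isign -expr2 sqrr_sign. Qed.

Lemma isignU i j J : j \notin J ->
  isign i (j |: J)%SET = (-1) ^+ (j < i)%N * isign i J.
Proof.
move=> jJ; rewrite !isignE -exprD; congr (_ ^+ _).
case: (ltnP j i) => ji; last first.
  rewrite add0n; apply: eq_card => k; rewrite !inE.
  by case: eqP => [->|//]; rewrite (leq_gtF ji) !andbF.
rewrite (_ : finset _ = j |: [set k in J | (k < i)%N])%SET; last first.
  by apply/setP => k; rewrite !inE; case: eqP => [->|//]; rewrite ji.
by rewrite cardsU1 inE (negbTE jJ).
Qed.

Lemma isign_swap i j J : i != j -> i \notin J -> j \notin J ->
  isign i J * isign j (i |: J)%SET = - (isign j J * isign i (j |: J)%SET).
Proof.
move=> ij iJ jJ; rewrite !isignU //.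
have [l|l|/val_inj E] := ltngtP i j; last by rewrite E eqxx in ij.
all: by rewrite /= ?expr0 ?expr1; ring.
Qed.

Lemma ewedgeE theta a K :
  ewedge theta a K = \sum_(i in K) isign i (K :\ i)%SET * (theta 0 i * a (K :\ i)%SET).
Proof.
rewrite /ewedge ffunE.
pose h (i : 'I_n) : {set 'I_n} := [set i]%SET.
transitivity (\sum_(I in [set h i | i in K]%SET)
   (-1) ^+ inversions I (K :\: I) * (covec theta I * a (K :\: I)%SET)).
  apply/esym; rewrite [RHS](bigID (fun I => I \in [set h i | i in K]%SET)) /=.
  rewrite [X in _ + X]big1 ?addr0.
    apply: eq_bigl => I; case: (boolP (I \in _)) => [/imsetP[i iK ->]|_].
      by rewrite finset.sub1set iK.
    by rewrite andbF.
  move=> I /andP[IK nI]; suff -> : covec theta I = 0 by rewrite mul0r mulr0.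
  rewrite /covec extE big1 // => i _; rewrite extE ffunE.
  case: eqP => [E|_]; last by rewrite mulr0.
  case/negP: nI; rewrite E; apply/imsetP; exists i => //.
  by move: IK; rewrite E finset.sub1set.
rewrite big_imset /=; last by move=> i j _ _ /finset.set1_inj.
apply: eq_bigr => i iK; rewrite -/(isign i (K :\ i)%SET); congr (_ * (_ * _)).
rewrite /covec extE (bigD1 i) //= big1 ?addr0 => [|j ji].
  by rewrite extE ffunE eqxx mulr1.
by rewrite extE ffunE (inj_eq finset.set1_inj) eq_sym (negbTE ji) mulr0.
Qed.

Lemma iprodE v a J :
  iprod v a J = \sum_(i | i \notin J) isign i J * (v 0 i * a (i |: J)%SET).
Proof. by rewrite ffunE. Qed.

Lemma iprodC v w a : iprod v (iprod w a) = - iprod w (iprod v a).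
Proof.
pose F J (x y : 'rV[R]_n) i j := isign i J * isign j (i |: J)%SET
    * (x 0 i * y 0 j : R) * a (j |: (i |: J))%SET.
have E x y J : iprod x (iprod y a) J =
   \sum_(i | i \notin J) \sum_(j | (j \notin J) && (j != i)) F J x y i j.
  rewrite iprodE; apply: eq_bigr => i iJ; rewrite iprodE !mulr_sumr.
  apply: eq_big => [j|j _]; last by rewrite /F; ring.
  by rewrite !inE negb_or andbC.
apply: extP => J; rewrite extE !E.
rewrite (exchange_big_dep (fun j => j \notin J)) /=; last by move=> i j _ /andP[].
rewrite -sumrN; apply: eq_bigr => j jJ.
rewrite -sumrN; apply: eq_big => [i|i /andP[iJ /andP[_ ji]]].
  by rewrite jJ eq_sym.
by rewrite /F isign_swap 1?eq_sym // finset.setUCA; ring.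
Qed.

Lemma iprod_iprod v a : iprod v (iprod v a) = 0.
Proof.
have /eqP := iprodC v v a; rewrite -addr_eq0 -mulr2n -scaler_nat.
by rewrite scaler_eq0 pnatr_eq0 => /eqP.
Qed.

(** Together with [iprodC] and [ewedgeC], these are the canonical anticommutation
    relations, from which the algebra below is derived with little use of components. *)
Lemma iprod_ewedge v theta a :
  iprod v (ewedge theta a) = (theta *m v^T) 0 0 *: a - ewedge theta (iprod v a).
Proof.
apply: extP => J; rewrite !extE iprodE ewedgeE.
transitivity (\sum_(i | i \notin J) (theta 0 i * v 0 i * a J +
   \sum_(k in J) isign i J * isign k (i |: (J :\ k))%SET * v 0 i * theta 0 k
      * a (i |: (J :\ k))%SET)).
  apply: eq_bigr => i iJ; rewrite ewedgeE big_setU1 //= mulrDr mulrDr.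
  congr (_ + _); first by rewrite finset.setU1K // -[RHS]mul1r -(isignK i J); ring.
  rewrite !mulr_sumr; apply: eq_bigr => k kJ.
  have -> : ((i |: J) :\ k = i |: (J :\ k))%SET.
    by rewrite finset.setDUl; congr (_ :|: _)%SET; apply/setP => x; rewrite !inE;
      case: (x =P i) => [->|]; rewrite ?andbT ?andbF //; apply: contraNneq iJ => ->.
  by ring.
transitivity (\sum_i theta 0 i * v 0 i * a J - \sum_(k in J)
  (\sum_(i | i \notin J) isign k (J :\ k)%SET * isign i (J :\ k)%SET *
      v 0 i * theta 0 k * a (i |: (J :\ k))%SET + theta 0 k * v 0 k * a J)).
  have -> : \sum_i theta 0 i * v 0 i * a J =
      \sum_(i | i \notin J) theta 0 i * v 0 i * a J +
      \sum_(k in J) theta 0 k * v 0 k * a J.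
    by rewrite (bigID (fun i => i \in J)) /= addrC.
  rewrite big_split /= [X in _ = _ - X]big_split /= opprD.
  rewrite [X in _ = _ + X]addrC addrA addrK; congr (_ + _).
  rewrite exchange_big /= -sumrN; apply: eq_bigr => k kJ; rewrite -sumrN.
  apply: eq_bigr => i iJ.
  have ik : i != k by apply: contraNneq iJ => ->.
  have iJk : i \notin (J :\ k)%SET by rewrite !inE ik.
  have kJk : k \notin (J :\ k)%SET by rewrite !inE eqxx.
  rewrite -{1}(finset.setD1K kJ) isignU // isignU //.
  have [l|l|/val_inj E] := ltngtP i k; last by rewrite E eqxx in ik.
    by rewrite /= expr0 expr1; ring.
  by rewrite /= expr0 expr1; ring.
congr (_ - _); first by rewrite mxE mulr_suml; apply: eq_bigr => i _; rewrite mxE.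
apply: eq_bigr => k kJ; rewrite iprodE.
rewrite [in RHS](bigD1 k) /=; last by rewrite !inE eqxx.
rewrite finset.setD1K // 2!mulrDr [LHS]addrC; congr (_ + _).
  by rewrite -[LHS]mul1r -(isignK k (J :\ k)%SET); ring.
rewrite !mulr_sumr; apply: eq_big => [i|i _]; last by ring.
rewrite !inE; case: (i =P k) => [->|]; first by rewrite kJ.
by rewrite /= andbT.
Qed.

End ExteriorAlgebra.

(** * Clifford induction, grading, and evaluation of forms *)

Section ExteriorInduction.
Context (R : realType) (n : nat).
Implicit Types (a b : ext R n) (v w theta phi : 'rV[R]_n) (I J K : {set 'I_n}).
Local Notation delta := (delta_mx (0 : 'I_1)).

Lemma ewedgeC theta phi a :
  ewedge theta (ewedge phi a) = - ewedge phi (ewedge theta a).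
Proof.
pose F J (x y : 'rV[R]_n) i j := isign R i (J :\ i)%SET
    * isign R j ((J :\ i) :\ j)%SET
    * (x 0 i * y 0 j : R) * a ((J :\ i) :\ j)%SET.
have E x y J : ewedge x (ewedge y a) J =
   \sum_(i in J) \sum_(j | (j \in J) && (j != i)) F J x y i j.
  rewrite ewedgeE; apply: eq_bigr => i iJ; rewrite ewedgeE !mulr_sumr.
  apply: eq_big => [j|j _]; last by rewrite /F; ring.
  by rewrite !inE andbC.
apply: extP => J; rewrite !extE !E.
rewrite (exchange_big_dep (fun j => j \in J)) /=; last by move=> i j _ /andP[].
rewrite -sumrN; apply: eq_bigr => j jJ.
rewrite -sumrN; apply: eq_big => [i|i /andP[iJ /andP[_ ji]]].
  by rewrite jJ eq_sym.
rewrite /F; set L := ((J :\ i) :\ j)%SET.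
have EL : ((J :\ j) :\ i)%SET = L by apply/setP => x; rewrite !inE andbCA.
have iL : i \notin L by rewrite !inE eqxx andbF.
have jL : j \notin L by rewrite !inE eqxx.
have Ei : (J :\ i = j |: L)%SET by rewrite finset.setD1K // !inE ji jJ.
have Ej : (J :\ j = i |: L)%SET by rewrite -EL finset.setD1K // !inE eq_sym ji iJ.
rewrite Ei Ej -Ei -/L -Ej EL Ei Ej.
have := isign_swap R ji jL iL; rewrite mulrC => ->.
by rewrite [isign R i _ * isign R j _]mulrC; ring.
Qed.

Lemma wedge_ext1r a : wedge a (ext1 R n) = a.
Proof.
apply/ffunP => K; rewrite ffunE (bigD1 K) ?subxx //= big1 ?addr0; last first.
  move=> I /andP[IK nIK]; rewrite ffunE.
  case: eqP => [/eqP|_]; last by rewrite !mulr0.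
  rewrite finset.setD_eq0 => KI; case/negP: nIK.
  by rewrite finset.eqEsubset IK.
rewrite finset.setDv ffunE eqxx mulr1 /inversions eq_card0 ?mul1r // => -[x y].
by rewrite !inE andbF.
Qed.

Lemma ewedge_ext1 theta : ewedge theta (ext1 R n) = covec theta.
Proof. exact: wedge_ext1r. Qed.

Lemma iprod_ext1 v : iprod v (ext1 R n) = 0.
Proof.
apply: extP => J; rewrite iprodE big1 ?extE // => i iJ; rewrite ffunE.
case: eqP => [E|_]; last by rewrite !mulr0.
by have := setU11 i J; rewrite E inE.
Qed.

Lemma iprod_covec v theta : iprod v (covec theta) = (theta *m v^T) 0 0 *: ext1 R n.
Proof. by rewrite -ewedge_ext1 iprod_ewedge iprod_ext1 linear0 subr0. Qed.

Lemma ewedge_set0 theta a : ewedge theta a finset.set0 = 0.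
Proof. by rewrite ewedgeE big_pred0 // => i; rewrite inE. Qed.

Lemma iprod_deltaE i a J :
  iprod (delta i) a J = if i \in J then 0 else isign R i J * a (i |: J)%SET.
Proof.
rewrite iprodE; case: ifPn => iJ.
  rewrite big1 // => k kJ; rewrite mxE /=.
  by case: eqP => [E|_]; [rewrite E iJ in kJ | rewrite mul0r mulr0].
rewrite (bigD1 i) //= big1 ?addr0 => [|k /andP[_ ki]].
  by rewrite mxE !eqxx mul1r.
by rewrite mxE (negbTE ki) mul0r mulr0.
Qed.

Lemma ewedge_deltaE i a J :
  ewedge (delta i) a J =
  if i \in J then isign R i (J :\ i)%SET * a (J :\ i)%SET else 0.
Proof.
rewrite ewedgeE; case: ifPn => iJ; last first.
  rewrite big1 // => k kJ; rewrite mxE /=.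
  by case: eqP => [E|_]; [rewrite E (negbTE iJ) in kJ | rewrite mul0r mulr0].
rewrite (bigD1 i) //= big1 ?addr0 => [|k /andP[_ ki]].
  by rewrite mxE !eqxx mul1r.
by rewrite mxE (negbTE ki) mul0r mulr0.
Qed.

Definition blade J : ext R n := [ffun I => (I == J)%:R].

Lemma bladeE J I : blade J I = (I == J)%:R :> R.
Proof. by rewrite ffunE. Qed.

Lemma blade_sum a : a = \sum_J a J *: blade J.
Proof.
apply: extP => I; rewrite extE (bigD1 I) //= big1 ?addr0 => [|J JI].
  by rewrite extE bladeE eqxx mulr1.
by rewrite extE bladeE eq_sym (negbTE JI) mulr0.
Qed.

Lemma ewedge_blade i J : i \notin J ->
  ewedge (delta i) (blade J) = isign R i J *: blade (i |: J)%SET.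
Proof.
move=> iJ; apply: extP => I; rewrite ewedge_deltaE extE !bladeE.
case: ifPn => iI; last first.
  case: eqP => [E|_]; last by rewrite mulr0.
  by rewrite E setU11 in iI.
case: (I =P (i |: J)%SET) => [->|nI]; first by rewrite finset.setU1K ?eqxx.
case: eqP => [E|_]; last by rewrite !mulr0.
by case: nI; rewrite -E finset.setD1K.
Qed.

(** The Clifford product of a covector with [a] is its wedge product with [a] up to
    a contraction, which has lower degree.  By induction on the degree, a class
    of forms closed under Clifford multiplication by covectors contains every
    basis element as soon as it contains 1. *)
Lemma clifford_ind (gi : 'M[R]_n) (P : ext R n -> Prop) :
  (forall c a b, P a -> P b -> P (c *: a + b)) -> P (ext1 R n) ->
  (forall theta a, P a -> P (ewedge theta a + iprod (theta *m gi) a)) ->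
  forall a, P a.
Proof.
move=> Plin P1 PM.
have P0 : P 0 by rewrite -[0](addNr (ext1 R n)) -scaleN1r; apply: Plin.
have PZ c a : P a -> P (c *: a) by rewrite -[c *: a]addr0 => Pa; apply: Plin.
have Psum a : (forall J, a J != 0 -> P (blade J)) -> P a.
  move=> aP; rewrite [a]blade_sum; elim/big_ind: _ => // [x y Px Py|J _].
    by rewrite -[x]scale1r; apply: Plin.
  have [->|aJ] := eqVneq (a J) 0; first by rewrite scale0r.
  by apply: PZ; apply: aP.
suff PB m J : (#|J| <= m)%N -> P (blade J).
  by move=> a; apply: Psum => J _; apply: (PB #|J|).
elim: m J => [|m IHm] J.
  rewrite leqn0 cards_eq0 => /eqP->; rewrite (_ : blade _ = ext1 R n) //.
have [->|/set0Pn[i iJ] Jm] := eqVneq J finset.set0.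
  by move=> _; apply: IHm; rewrite cards0.
have iJ' : i \notin (J :\ i)%SET by rewrite !inE eqxx.
have Jm' : (#|J :\ i| <= m)%N by rewrite (cardsD1 i) iJ in Jm.
have := ewedge_blade iJ'; rewrite finset.setD1K //.
move/(congr1 (fun x => isign R i (J :\ i)%SET *: x)).
rewrite scalerA isignK scale1r => <-; apply: (PZ).
rewrite -[ewedge _ _](addrK (iprod (delta i *m gi) (blade (J :\ i)%SET))).
rewrite addrC -scaleN1r; apply: Plin; last by apply: PM; apply: IHm.
apply: Psum => K; rewrite iprodE => nz; apply: IHm.
apply: contraNT nz; rewrite -ltnNge => mK; apply/eqP; apply: big1 => k kK.
rewrite bladeE; case: eqP => [E|_]; last by rewrite !mulr0.
by move: Jm'; rewrite -E cardsU1 kK add1n ltnNge (ltnW mK).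
Qed.

(** The grading involution, which is the sign rule for multiplication on the right. *)
Definition grading a : ext R n := [ffun I : {set 'I_n} => (-1) ^+ #|I| * a I].

Lemma gradingE a I : grading a I = (-1) ^+ #|I| * a I :> R.
Proof. by rewrite ffunE. Qed.

Lemma grading_is_linear : linear grading.
Proof. by move=> c a b; apply: extP => I; rewrite !(extE, gradingE); ring. Qed.
HB.instance Definition _ := GRing.isLinear.Build R (ext R n) (ext R n) *:%R
  grading grading_is_linear.

Lemma grading_homogeneous k a : homogeneous k a -> grading a = (-1) ^+ k *: a.
Proof.
move=> ha; apply: extP => I; rewrite gradingE extE.
by have [->|/ha->] := eqVneq #|I| k; rewrite ?mulr0.
Qed.

Lemma grading_ewedge theta a : grading (ewedge theta a) = - ewedge theta (grading a).
Proof.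
apply: extP => I; rewrite gradingE extE !ewedgeE mulr_sumr -sumrN.
apply: eq_bigr => i iI; rewrite gradingE (cardsD1 i I) iI exprD expr1; ring.
Qed.

Lemma grading_iprod v a : grading (iprod v a) = - iprod v (grading a).
Proof.
apply: extP => I; rewrite gradingE extE !iprodE mulr_sumr -sumrN.
apply: eq_bigr => i iI; rewrite gradingE cardsU1 iI exprD expr1; ring.
Qed.

Lemma ext_eval_linear (vs : seq 'rV[R]_n) c a b :
  ext_eval (c *: a + b) vs = c * ext_eval a vs + ext_eval b vs.
Proof.
rewrite /ext_eval; elim: vs a b => [|v vs IH] a b /=; first by rewrite !extE.
by rewrite linearP IH.
Qed.

Lemma ext_eval0 (vs : seq 'rV[R]_n) : ext_eval 0 vs = 0.
Proof.
have := ext_eval_linear vs (-1) 0 0.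
by rewrite scaler0 addr0 mulN1r addNr.
Qed.

Lemma ext_evalD (vs : seq 'rV[R]_n) a b :
  ext_eval (a + b) vs = ext_eval a vs + ext_eval b vs.
Proof. by rewrite -[a]scale1r ext_eval_linear mul1r scale1r. Qed.

Lemma ext_eval_sum (vs : seq 'rV[R]_n) (T : Type) (r : seq T) (P : pred T)
    (F : T -> ext R n) :
  ext_eval (\sum_(i <- r | P i) F i) vs = \sum_(i <- r | P i) ext_eval (F i) vs.
Proof.
apply: (big_rec2 (fun x y => ext_eval x vs = y)) => [|i x y _ <-].
  exact: ext_eval0.
exact: ext_evalD.
Qed.

Lemma ext_evalZ (vs : seq 'rV[R]_n) c a : ext_eval (c *: a) vs = c * ext_eval a vs.
Proof. by rewrite -[c *: a]addr0 ext_eval_linear ext_eval0 addr0. Qed.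

Lemma ext_eval_cons a v vs : ext_eval a (v :: vs) = ext_eval (iprod v a) vs.
Proof. by []. Qed.

Lemma foldl_iprod v a (vs : seq 'rV[R]_n) :
  foldl (fun a' v => iprod v a') (iprod v a) vs =
  (-1) ^+ size vs *: iprod v (foldl (fun a' v => iprod v a') a vs).
Proof.
elim: vs a => [|w vs IH] a /=; first by rewrite expr0 scale1r.
rewrite iprodC -[- _]scaleN1r.
have L c b : foldl (fun a' v => iprod v a') (c *: b) vs =
    c *: foldl (fun a' v => iprod v a') b vs.
  by elim: vs {IH} b => //= x vs IH b; rewrite linearZ IH.
by rewrite L IH scalerA exprS.
Qed.

(** The repeated vector can be moved next to the first one, up to sign. *)
Lemma ext_eval_mem v a (vs : seq 'rV[R]_n) :
  v \in vs -> ext_eval a (v :: vs) = 0.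
Proof.
rewrite ext_eval_cons /ext_eval => /path.splitPr[vs1 vs2].
rewrite foldl_cat /= [foldl _ _ vs1]foldl_iprod linearZ /= iprod_iprod scaler0.
exact: (ext_eval0 vs2).
Qed.

(** The arguments of a form are listed by increasing index, so inserting [i] among
    the indices [J] means moving past those smaller than [i]; their number is the
    exponent in [isign]. *)
Lemma enum_insert i J : i \notin J -> exists s1 s2,
  [/\ enum J = s1 ++ s2, enum (i |: J)%SET = s1 ++ i :: s2 &
      size s1 = #|[set j in J | (j < i)%N]%SET| ].
Proof.
move=> iJ.
have [r1 [r2 [E l1 l2]]] : exists r1 r2, [/\ enum 'I_n = r1 ++ i :: r2,
   all (fun j : 'I_n => (j < i)%N) r1 & all (fun j : 'I_n => (i < j)%N) r2].
  have : sorted ltn (map val (enum 'I_n)) by rewrite val_enum_ord iota_ltn_sorted.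
  have : i \in enum 'I_n by rewrite mem_enum.
  move: (enum 'I_n) => s /path.splitPr[r1 r2]; rewrite map_cat /= (sorted_pairwise ltn_trans).
  rewrite pairwise_cat allrel_consr /= !all_map => /and3P[/andP[l1 _] _ /andP[l2 _]].
  by exists r1, r2.
have iJ1 s : all (fun j : 'I_n => j != i) s ->
    seq.filter [in (i |: J)%SET] s = seq.filter [in J] s.
  move=> /allP si; apply: eq_in_filter => j js.
  by rewrite !inE (negbTE (si j js)).
have i1 : all (fun j : 'I_n => j != i) r1.
  by apply: sub_all l1 => j ji; apply: contraTneq ji => ->; rewrite ltnn.
have i2 : all (fun j : 'I_n => j != i) r2.
  by apply: sub_all l2 => j ji; apply: contraTneq ji => ->; rewrite ltnn.
have enumE (A : {set 'I_n}) : enum A = seq.filter [in A] (enum 'I_n).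
  by rewrite {1}/(enum _) enumT.
exists (seq.filter [in J] r1), (seq.filter [in J] r2); split.
- by rewrite enumE E filter_cat /= (negbTE iJ).
- by rewrite enumE E filter_cat /= setU11 !iJ1.
rewrite cardE enumE E filter_cat size_cat /= !inE ltnn andbF.
rewrite -[LHS]addn0; congr (_ + _)%N; last first.
  apply/esym/eqP; rewrite size_eq0 -[_ == _]negbK -has_filter -all_predC.
  by apply: sub_all l2 => j ij /=; rewrite !inE (leq_gtF (ltnW ij)) andbF.
congr size; apply: eq_in_filter => j /(allP l1) ji.
by rewrite !inE ji andbT.
Qed.

End ExteriorInduction.

(** * Pullbacks and derivations *)

Section Pullback.
Context (R : realType) (n : nat).
Implicit Types (a b : ext R n) (v w theta phi : 'rV[R]_n) (I J K : {set 'I_n}).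
Local Notation delta := (delta_mx (0 : 'I_1)).

Lemma ext_eval_insert (T : 'I_n -> 'rV[R]_n) a i J : i \notin J ->
  ext_eval a [seq T k | k <- enum (i |: J)%SET] =
  isign R i J * ext_eval (iprod (T i) a) [seq T k | k <- enum J].
Proof.
move=> iJ; have [s1 [s2 [-> -> s1J]]] := enum_insert iJ.
rewrite isignE -s1J !map_cat /= /ext_eval !foldl_cat /=.
rewrite [foldl _ (iprod _ a) _]foldl_iprod size_map.
have L c b vs : foldl (fun a' v => iprod v a') (c *: b) vs =
    c *: foldl (fun a' v => iprod v a') b vs.
  by elim: vs b => //= x vs IH b; rewrite linearZ IH.
by rewrite L extE mulrA -expr2 sqrr_sign mul1r.
Qed.

Lemma ext_eval_delta a I : ext_eval a [seq delta i | i <- enum I] = a I.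
Proof.
elim: {I}#|I| {-2}I (erefl #|I|) a => [|m IHm] I.
  by move/eqP; rewrite cards_eq0 => /eqP-> a; rewrite enum_set0.
have [->|/set0Pn[i iI] Im a] := eqVneq I finset.set0; first by rewrite cards0.
have iI' : i \notin (I :\ i)%SET by rewrite !inE eqxx.
rewrite -(finset.setD1K iI) ext_eval_insert // IHm; last first.
  by move: Im; rewrite (cardsD1 i) iI => -[].
by rewrite iprod_deltaE (negbTE iI') mulrA isignK mul1r.
Qed.

(** Pullback of forms along the linear map whose matrix, acting on row vectors
    from the right, is [T]. *)
Definition pullback (T : 'M[R]_n) a : ext R n :=
  [ffun I : {set 'I_n} => ext_eval a [seq row i T | i <- enum I]].

Lemma pullbackE T a I :
  pullback T a I = ext_eval a [seq row i T | i <- enum I].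
Proof. by rewrite ffunE. Qed.

Lemma pullback_is_linear T : linear (pullback T).
Proof.
by move=> c a b; apply: extP => I; rewrite !(extE, pullbackE) ext_eval_linear.
Qed.
HB.instance Definition _ T := GRing.isLinear.Build R (ext R n) (ext R n) *:%R
  (pullback T) (pullback_is_linear T).

(** For an index outside [J] this is the sign of an insertion; for an index in [J]
    the right-hand side repeats an argument and the left-hand side has no term. *)
Lemma iprod_pullback v T a :
  iprod v (pullback T a) = pullback T (iprod (v *m T) a).
Proof.
apply: extP => J; rewrite iprodE pullbackE mulmx_sum_row iprod_suml ext_eval_sum.
rewrite [RHS](bigID (fun i => i \in J)) /= [X in _ = X + _]big1 ?add0r => [|i iJ].
  apply: eq_bigr => i iJ.
  rewrite iprodZl ext_evalZ pullbackE (ext_eval_insert (fun i => row i T)) //.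
  by rewrite mulrCA; congr (_ * _); rewrite mulrA isignK mul1r.
rewrite iprodZl ext_evalZ -ext_eval_cons ext_eval_mem ?mulr0 //.
by apply: (map_f (fun i => row i T)); rewrite mem_enum.
Qed.

Lemma pullback_set0 T a : pullback T a finset.set0 = a finset.set0.
Proof. by rewrite pullbackE enum_set0. Qed.

Lemma ext_eval_pullback T a vs :
  ext_eval (pullback T a) vs = ext_eval a [seq v *m T | v <- vs].
Proof.
elim: vs a => [|v vs IH] a; first exact: pullback_set0.
by rewrite map_cons !ext_eval_cons iprod_pullback IH.
Qed.

Lemma pullback_comp S T a : pullback S (pullback T a) = pullback (S *m T) a.
Proof.
apply: extP => I; rewrite !pullbackE ext_eval_pullback -map_comp.
by congr ext_eval; apply: eq_map => i /=; rewrite row_mul.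
Qed.

Lemma pullback1 a : pullback 1%:M a = a.
Proof.
apply: extP => I; rewrite pullbackE -[RHS]ext_eval_delta.
by congr ext_eval; apply: eq_map => i; rewrite row1.
Qed.

(** The difference [y] of the two sides satisfies i_v (y a) = - y (i_(v T) a), so each
    of its evaluations is, up to sign, the value of some [y b] in degree 0, where
    both sides vanish. *)
Lemma pullback_ewedge T theta a :
  pullback T (ewedge theta a) = ewedge (theta *m T^T) (pullback T a).
Proof.
apply/eqP; rewrite -subr_eq0; apply/eqP.
pose y a := pullback T (ewedge theta a) - ewedge (theta *m T^T) (pullback T a).
have yI v b : iprod v (y b) = - y (iprod (v *m T) b).
  rewrite /y linearB /= iprod_pullback !iprod_ewedge linearB linearZ /=.
  rewrite trmx_mul mulmxA iprod_pullback opprB.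
  by rewrite opprB addrC addrA subrK.
suff y0 vs : ext_eval (y a) vs = 0.
  by apply: extP => I; rewrite -/(y a) -[LHS]ext_eval_delta y0 ffunE.
elim: vs a => [|v vs IH] a.
  by rewrite /ext_eval /= !extE pullback_set0 !ewedge_set0 subr0.
by rewrite ext_eval_cons yI -scaleN1r ext_evalZ IH mulr0.
Qed.

Lemma pullback_ext1 T : pullback T (ext1 R n) = ext1 R n.
Proof.
apply: extP => I; rewrite pullbackE ffunE; have [->|] := eqVneq I finset.set0.
  by rewrite enum_set0 /ext_eval /= ffunE eqxx.
rewrite -cards_eq0 cardE; case: (enum I) => //= i s _.
by rewrite ext_eval_cons iprod_ext1 ext_eval0.
Qed.

(** The derivation of degree 0 that sums, over the arguments [v] of a form, the
    results of replacing [v] by [v *m N]. *)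
Definition deriv_ext (N : 'M[R]_n) a : ext R n :=
  \sum_i ewedge (delta i) (iprod (row i N) a).

Lemma deriv_ext_is_linear N : linear (deriv_ext N).
Proof.
move=> c a b; rewrite /deriv_ext scaler_sumr -big_split /=.
by apply: eq_bigr => i _; rewrite !linearP.
Qed.
HB.instance Definition _ N := GRing.isLinear.Build R (ext R n) (ext R n) *:%R
  (deriv_ext N) (deriv_ext_is_linear N).

Lemma deriv_extDl N N' a : deriv_ext (N + N') a = deriv_ext N a + deriv_ext N' a.
Proof.
rewrite /deriv_ext -big_split /=; apply: eq_bigr => i _.
by rewrite linearD /= iprodDl linearD.
Qed.

Lemma mulmx_delta v i : (delta i *m v^T) 0 0 = v 0 i.
Proof. by rewrite -rowE !mxE. Qed.

Lemma iprod_deriv_ext v N a :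
  iprod v (deriv_ext N a) = deriv_ext N (iprod v a) + iprod (v *m N) a.
Proof.
rewrite /deriv_ext linear_sum /= mulmx_sum_row iprod_suml -big_split /=.
apply: eq_bigr => i _; rewrite iprod_ewedge mulmx_delta iprodZl iprodC.
by rewrite linearN opprK addrC.
Qed.

Lemma deriv_ext_set0 N a : deriv_ext N a finset.set0 = 0.
Proof. by rewrite /deriv_ext extE big1 // => i _; rewrite ewedge_set0. Qed.

Lemma deriv_ext1 N : deriv_ext N (ext1 R n) = 0.
Proof. by rewrite /deriv_ext big1 // => i _; rewrite iprod_ext1 linear0. Qed.

(** Moving a contraction through [deriv_ext N] yields exactly the term in which this
    argument is replaced, so the sum builds up one argument at a time.  The
    family [X] is separate from [T] so that it can be a family of derivatives. *)
Lemma ext_eval_deriv_ext (k : eqType) (T X : k -> 'rV[R]_n) N a (s : seq k) :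
  (forall i, X i = T i *m N) -> uniq s ->
  ext_eval (deriv_ext N a) [seq T i | i <- s] =
  \sum_(l <- s) ext_eval a [seq (if i == l then X i else T i) | i <- s].
Proof.
move=> XT; elim: s a => [|i s IH] a /=.
  by rewrite big_nil /ext_eval /= deriv_ext_set0.
move=> /andP[sNi us]; rewrite ext_eval_cons iprod_deriv_ext ext_evalD IH //.
rewrite big_cons eqxx addrC XT; congr (_ + _).
  congr ext_eval; apply/eq_in_map => j js.
  by case: eqP => // E; rewrite -E js in sNi.
apply: eq_big_seq => l ls; rewrite ext_eval_cons.
by case: eqP => // E; rewrite E ls in sNi.
Qed.

(** On covectors the derivation is the transpose of [N], since it acts on arguments. *)
Lemma deriv_ext_ewedge N theta a : deriv_ext N (ewedge theta a) =
  ewedge (theta *m N^T) a + ewedge theta (deriv_ext N a).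
Proof.
rewrite /deriv_ext (linear_sum (ewedge theta)) /=.
transitivity (\sum_i ewedge ((theta *m (row i N)^T) 0 0 *: delta i) a +
  \sum_i ewedge theta (ewedge (delta i) (iprod (row i N) a))); last first.
  congr (_ + _); rewrite -ewedge_suml; congr (ewedge _ a).
  rewrite [RHS]row_sum_delta; apply: eq_bigr => i _; congr (_ *: _).
  by rewrite !mxE; apply: eq_bigr => j _; rewrite !mxE.
rewrite -big_split /=; apply: eq_bigr => i _.
by rewrite iprod_ewedge linearB linearZ /= ewedgeZl ewedgeC opprK.
Qed.

Lemma covec_deriv_ext N theta : deriv_ext N (covec theta) = covec (theta *m N^T).
Proof.
by rewrite -!ewedge_ext1 deriv_ext_ewedge deriv_ext1 linear0 addr0.
Qed.

End Pullback.

(** * Clifford representations at a point *)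

Lemma covecZ (R : realType) (n : nat) c (v : 'rV[R]_n) :
  covec (c *: v) = c *: covec v.
Proof. exact: linearZ. Qed.

Lemma ewedgeZr (R : realType) (n : nat) c (v : 'rV[R]_n) a :
  ewedge v (c *: a) = c *: ewedge v a.
Proof. exact: linearZ. Qed.

Lemma iprodZr (R : realType) (n : nat) c (v : 'rV[R]_n) a :
  iprod v (c *: a) = c *: iprod v a.
Proof. exact: linearZ. Qed.

(** The conditions at one point of a bundle of Clifford modules. *)
Record clifford_rep (R : realType) (n : nat) (V : vectType R) (g : 'M[R]_n)
    (gam : ext R n -> 'End(V)) : Prop := CliffordRep {
  rep_sym : g^T = g;
  rep_unit : g \in unitmx;
  rep_linear : forall c x y, gam (c *: x + y) = c *: gam x + gam y;
  rep_one : gam (ext1 R n) = \1%VF;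
  rep_mul : forall x y, gam (gprod (invmx g) x y) = (gam x \o gam y)%VF }.

(** The inverse metric on covectors. *)
Definition coprod (R : realType) (n : nat) (g : 'M[R]_n) (theta phi : 'rV[R]_n) : R :=
  (theta *m invmx g *m phi^T) 0 0.

Section CliffordRepresentation.
Context (R : realType) (n : nat) (V : vectType R) (g : 'M[R]_n).
Context (gam : ext R n -> 'End(V)) (rep : clifford_rep g gam).
Implicit Types (a b x y : ext R n) (v w theta phi : 'rV[R]_n).

Local Notation gi := (invmx g).
Local Notation c theta := (gam (covec theta)).
Lemma gam_is_linear : linear gam. Proof. exact: (rep_linear rep). Qed.
HB.instance Definition _ := GRing.isLinear.Build R (ext R n) 'End(V) *:%R
  gam gam_is_linear.

Lemma gam_lin s k x y : gam (k *: x + y) s = k *: gam x s + gam y s.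
Proof. by rewrite (rep_linear rep) add_lfunE scale_lfunE. Qed.

Lemma gamD s x y : gam (x + y) s = gam x s + gam y s.
Proof. by rewrite linearD add_lfunE. Qed.
Lemma gamB s x y : gam (x - y) s = gam x s - gam y s.
Proof. by rewrite linearB add_lfunE opp_lfunE. Qed.
Lemma gamN s x : gam (- x) s = - gam x s.
Proof. by rewrite linearN opp_lfunE. Qed.
Lemma gamZ s k x : gam (k *: x) s = k *: gam x s.
Proof. by rewrite linearZ scale_lfunE. Qed.
Lemma gam_sum s (T : Type) (r : seq T) (P : pred T) (F : T -> ext R n) :
  gam (\sum_(i <- r | P i) F i) s = \sum_(i <- r | P i) gam (F i) s.
Proof. by rewrite linear_sum sum_lfunE. Qed.
Lemma gam_one s : gam (ext1 R n) s = s.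
Proof. by rewrite (rep_one rep) id_lfunE. Qed.

Lemma gam_covec theta a s :
  gam (ewedge theta a + iprod (theta *m gi) a) s = c theta (gam a s).
Proof. by rewrite -gprod_covec (rep_mul rep) comp_lfunE. Qed.

Lemma gisym : gi^T = gi.
Proof. by rewrite trmx_inv (rep_sym rep). Qed.

Lemma coprodC theta phi : coprod g theta phi = coprod g phi theta.
Proof.
have E : theta *m gi *m phi^T = (phi *m gi *m theta^T)^T.
  by rewrite !trmx_mul trmxK gisym mulmxA.
by rewrite /coprod E mxE.
Qed.

Lemma gam_covec2 theta phi s :
  c theta (c phi s) = gam (wedge (covec theta) (covec phi)) s + coprod g theta phi *: s.
Proof.
rewrite -gam_covec iprod_covec gamD gamZ gam_one; congr (_ + _ *: _).
by rewrite trmx_mul gisym mulmxA [RHS]coprodC.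
Qed.

Lemma gam_anticomm theta phi s :
  c theta (c phi s) = (2 * coprod g theta phi) *: s - c phi (c theta s).
Proof.
rewrite !gam_covec2 (coprodC phi).
have -> : wedge (covec theta) (covec phi) = - wedge (covec phi) (covec theta).
  by rewrite -[in LHS](ewedge_ext1 phi) -[in RHS](ewedge_ext1 theta) -!/(ewedge _ _) ewedgeC.
by rewrite gamN mulr_natl mulr2n scalerDl opprD [- _ - _]addrC addrA addrK addrC.
Qed.

Lemma iprod_skew N theta : N *m g = - (g *m N^T) ->
  theta *m gi *m N = - (theta *m N^T *m gi).
Proof.
move=> skew; rewrite -!mulmxA -mulmxN; congr (theta *m _).
rewrite -[LHS](mulmxK (rep_unit rep)) -(mulmxA gi) skew !(mulmxN, mulNmx).
by rewrite !mulmxA (mulVmx (rep_unit rep)) mul1mx.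
Qed.

(** A commutator and [deriv_ext N], for [N] skew, are both derivations of the
    Clifford algebra, so it suffices to compare them on covectors. *)
Lemma commutator_deriv N (W : 'End(V)) : N *m g = - (g *m N^T) ->
  (forall theta s, W (c theta s) = c theta (W s) - c (theta *m N^T) s) ->
  forall a s, W (gam a s) = gam a (W s) - gam (deriv_ext N a) s.
Proof.
move=> skew Wc; elim/(clifford_ind (gi := gi)) => [k a b IHa IHb||theta a IH] s.
- rewrite !gam_lin (linearP W) /= IHa IHb (linearP (deriv_ext N)) /= gam_lin.
  by rewrite scalerBr opprD addrACA.
- by rewrite !gam_one deriv_ext1 (linear0 gam) zero_lfunE subr0.
rewrite !gam_covec Wc IH linearB /= -addrA -opprD -!gam_covec; congr (_ - _).
rewrite -gamD; congr (gam _ s); rewrite linearD /= deriv_ext_ewedge.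
rewrite [in RHS](_ : deriv_ext N (iprod _ a) = iprod (theta *m gi) (deriv_ext N a)
  + iprod (theta *m N^T *m gi) a); last first.
  by rewrite iprod_deriv_ext iprod_skew // iprodNl subrK.
by rewrite addrC addrACA [ewedge _ _ + ewedge _ _]addrC; congr (_ + _); rewrite addrC.
Qed.

(** Multiplication on the right is reduced to multiplication on the left: the operators
    a |-> phi /\ a + i_phi a and a |-> theta /\ a - i_theta a anticommute, which is
    what the induction step needs. *)
Lemma gam_covecr a theta s :
  gam a (c theta s) =
  gam (ewedge theta (grading a) - iprod (theta *m gi) (grading a)) s.
Proof.
elim/(clifford_ind (gi := gi)): a s => [k a b IHa IHb||phi a IH] s.
- rewrite gam_lin IHa IHb -gam_lin; congr (gam _ s).
  rewrite (linearP (@grading R n)) /= (linearP (ewedge theta)) (linearP (iprod _)) /=.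
  by rewrite scalerBr opprD addrACA.
- have -> : grading (ext1 R n) = ext1 R n.
    apply: extP => I; rewrite gradingE ffunE; case: eqP => [->|]; last by rewrite mulr0.
    by rewrite cards0 mul1r.
  by rewrite gam_one iprod_ext1 subr0 ewedge_ext1.
rewrite gam_covec IH -gam_covec; congr (gam _ s).
rewrite (linearD (@grading R n)) /= grading_ewedge grading_iprod -opprD.
move: (grading a) => {IH}a.
rewrite !linearB !linearN !linearD /= !iprod_ewedge (ewedgeC phi) (iprodC (phi *m gi)).
have -> : (phi *m (theta *m gi)^T) 0 0 = (theta *m (phi *m gi)^T) 0 0.
  by rewrite !trmx_mul gisym !mulmxA; apply: coprodC.
set x := _ *: a.
rewrite !opprD !opprK.
have AC5 (A B C D E : ext R n) : A + B + (C + D + E) = A + D + (C + B + E).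
  rewrite -[LHS]addrA -[RHS]addrA; congr (A + _).
  by rewrite !addrA [B + C]addrC [D + C]addrC; congr (_ + E); apply: addrAC.
exact: AC5.
Qed.

Section TwoForm.
Context (I : finType) (w : I -> I -> R) (th : I -> 'rV[R]_n).
Hypothesis w_skew : forall i j, w i j = - w j i.
Let omega : ext R n :=
  2^-1 *: \sum_i \sum_j w i j *: wedge (covec (th i)) (covec (th j)).

Lemma skew_sum (U : lmodType R) (F : I -> I -> U) : (forall i j, F i j = F j i) ->
  \sum_i \sum_j w i j *: F i j = 0.
Proof.
move=> FC; apply/eqP; set x := \sum_i _; suff : x = - x.
  by move/eqP; rewrite -addr_eq0 -mulr2n -scaler_nat scaler_eq0 pnatr_eq0.
rewrite {1}/x exchange_big -sumrN; apply: eq_bigr => i _.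
by rewrite -sumrN; apply: eq_bigr => j _; rewrite w_skew FC scaleNr.
Qed.

(** A wedge product of two covectors differs from their Clifford product by the inverse
    metric, which is symmetric and disappears against the skew coefficients. *)
Lemma gam_two_form s :
  gam omega s = 2^-1 *: \sum_i \sum_j w i j *: c (th i) (c (th j) s).
Proof.
rewrite /omega gamZ gam_sum; congr (_ *: _).
transitivity (\sum_i \sum_j w i j *: c (th i) (c (th j) s) -
   \sum_i \sum_j w i j *: (coprod g (th i) (th j) *: s)); last first.
  by rewrite [X in _ - X]skew_sum ?subr0 // => i j; rewrite coprodC.
rewrite -sumrB; apply: eq_bigr => i _; rewrite gam_sum -sumrB.
by apply: eq_bigr => j _; rewrite gamZ gam_covec2 -scalerBr addrK.
Qed.

(** This is the isomorphism of spin(p,p) with so(p,p): half a two-form acts on covectors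
    by its commutator. *)
Lemma two_form_comm phi s :
  2^-1 *: gam omega (c phi s) = c phi (2^-1 *: gam omega s) +
   c (\sum_i \sum_j (w i j * coprod g (th j) phi) *: th i) s.
Proof.
pose T := \sum_i \sum_j (w i j * coprod g (th j) phi) *: c (th i) s.
have ET : c (\sum_i \sum_j (w i j * coprod g (th j) phi) *: th i) s = T.
  rewrite (linear_sum (@covec R n)) /= gam_sum; apply: eq_bigr => i _.
  rewrite (linear_sum (@covec R n)) /= gam_sum; apply: eq_bigr => j _.
  by rewrite covecZ gamZ.
have ET' : \sum_i \sum_j (w i j * coprod g (th i) phi) *: c (th j) s = - T.
  rewrite exchange_big -sumrN; apply: eq_bigr => i _; rewrite -sumrN.
  by apply: eq_bigr => j _; rewrite w_skew mulNr scaleNr.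
rewrite ET !gam_two_form.
have -> : \sum_i \sum_j w i j *: c (th i) (c (th j) (c phi s)) =
    c phi (\sum_i \sum_j w i j *: c (th i) (c (th j) s)) + 4 *: T.
  transitivity (c phi (\sum_i \sum_j w i j *: c (th i) (c (th j) s)) +
     2 *: T - 2 *: \sum_i \sum_j (w i j * coprod g (th i) phi) *: c (th j) s).
    rewrite /T (linear_sum (c phi)) /= !scaler_sumr -big_split -sumrB /=.
    apply: eq_bigr => i _; rewrite (linear_sum (c phi)) /= !scaler_sumr -big_split -sumrB /=.
    apply: eq_bigr => j _; rewrite linearZ /= !scalerA.
    rewrite [c (th j) _]gam_anticomm linearB linearZ /= [c (th i) (c phi _)]gam_anticomm.
    rewrite opprB addrCA [LHS]scalerDr !scalerBr !scalerA -addrA; congr (_ + _).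
    by congr (_ *: _ - _ *: _); ring.
  by rewrite ET' scalerN opprK -addrA -scalerDl -natrD.
rewrite !linearZ /= linearD /= scalerDr !scalerA; congr (_ + _).
by rewrite -[RHS]scale1r; congr (_ *: _); field.
Qed.

End TwoForm.

Lemma two_form_mx (w : 'M[R]_n) (TH : 'M[R]_n) phi :
  \sum_i \sum_j (w i j * coprod g (row j TH) phi) *: row i TH =
  phi *m gi *m TH^T *m w^T *m TH.
Proof.
rewrite mulmx_sum_row; apply: eq_bigr => i _; rewrite -scaler_suml; congr (_ *: _).
rewrite mxE; apply: eq_bigr => j _; rewrite mulrC [w^T _ _]mxE; congr (_ * _).
rewrite coprodC /coprod [LHS]mxE [RHS]mxE.
by apply: eq_bigr => k _; rewrite !mxE.
Qed.

End CliffordRepresentation.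

(** * Simplicity of the Clifford algebra in even dimension *)

Section CliffordKernel.
Context (R : realType) (n : nat).
Implicit Types (a b : ext R n) (I J : {set 'I_n}).
Local Notation delta := (delta_mx (0 : 'I_1)).

Let chi (i : 'I_n) I : R := (-1) ^+ (#|I| + (i \in I)).

(** [chi i I] is the sign with which the i-th generator commutes with the product of
    the generators in [I].  In even dimension these signs determine [I]; in odd
    dimension they are the same for [I] and its complement, as the volume element
    is then central. *)
Lemma chi_sep I J : ~~ odd n -> I != J -> exists i, chi i I = - chi i J.
Proof.
move=> n_even IJ; rewrite /chi.
have [i Hi] : exists i, odd (#|I| + (i \in I)) != odd (#|J| + (i \in J)).
  apply/existsP; apply: contraNT IJ; rewrite negb_exists => /forallP H.
  have {}H i : (odd #|I| (+) (i \in I)) = (odd #|J| (+) (i \in J)).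
    by have := H i; rewrite negbK !oddD !oddb => /eqP.
  have [E|E] := eqVneq (odd #|I|) (odd #|J|).
    by apply/eqP/setP => i; have := H i; rewrite E => /addbI.
  have EJ : J = (~: I)%SET.
    apply/setP => i; rewrite inE; have := H i; move: E.
    by case: (odd _); case: (odd _); case: (i \in I); case: (i \in J).
  have := congr1 odd (cardsC I); rewrite -EJ card_ord oddD (negbTE n_even) => nE.
  by move: nE E; case: (odd _); case: (odd _).
exists i; rewrite -(signr_odd _ (#|I| + _)%N) -(signr_odd _ (#|J| + _)%N).
by move: Hi; case: (odd _); case: (odd _); rewrite ?expr0 ?expr1 ?opprK.
Qed.

Lemma ewedge_ewedge (theta : 'rV[R]_n) a : ewedge theta (ewedge theta a) = 0.
Proof.
have /eqP := ewedgeC theta theta a; rewrite -addr_eq0 -mulr2n -scaler_nat.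
by rewrite scaler_eq0 pnatr_eq0 => /eqP.
Qed.

(** Simplicity of the Clifford algebra.  Multiplying on both sides by the i-th generator
    acts on blades by the signs [chi i], so a nonzero element of the ideal with
    two blades can be combined with its image so as to lose one of them.
    An element of the ideal with a single blade is multiplied down to 1. *)
Lemma clifford_ideal_one (et : 'I_n -> R) (K : ext R n -> Prop) b :
  ~~ odd n -> (forall i, et i * et i = 1) ->
  (forall c a a', K a -> K a' -> K (c *: a + a')) ->
  (forall i a, K a -> K (ewedge (delta i) a + et i *: iprod (delta i) a)) ->
  (forall i a, K a -> K (ewedge (delta i) (grading a) -
                         et i *: iprod (delta i) (grading a))) ->
  K b -> b != 0 -> K (ext1 R n).
Proof.
move=> n_even et2 Klin KL KR Kb b0.
have KZ c a : K a -> K (c *: a).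
  move=> Ka; have := Klin (c - 1) _ _ Ka Ka.
  by rewrite scalerBl scale1r subrK.
pose Q i a : ext R n := [ffun I : {set 'I_n} => chi i I * a I].
have QE i a I : Q i a I = chi i I * a I by rewrite ffunE.
have KQ i a : K a -> K (Q i a).
  move=> /(KR i)/(KL i)/(KZ (et i)); congr K.
  move: (et2 i); set e := et i => ee.
  transitivity (iprod (delta i) (ewedge (delta i) (grading a)) -
                ewedge (delta i) (iprod (delta i) (grading a))).
    rewrite (linearB (ewedge _)) /= ewedgeZr ewedge_ewedge sub0r.
    rewrite (linearB (iprod _)) /= iprodZr iprod_iprod scaler0 subr0.
    by rewrite scalerDr scalerN !scalerA ee !scale1r addrC.
  apply: extP => I; rewrite QE !extE iprod_deltaE ewedge_deltaE.
  rewrite ewedge_deltaE iprod_deltaE /chi exprD.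
  case: (boolP (i \in I)) => iI.
    rewrite !inE eqxx /= finset.setD1K // mulrA isignK mul1r gradingE expr1.
    by ring.
  by rewrite setU11 finset.setU1K // mulrA isignK mul1r gradingE expr0; ring.
have [m] := ubnP #|[set I | b I != 0]%SET|.
elim: m b Kb b0 => // m IHm b Kb b0 bm.
have [I bI] : exists I, b I != 0.
  apply/existsP; apply: contraNT b0; rewrite negb_exists => /forallP H.
  by apply/eqP/extP => I; rewrite extE; apply/eqP; have := H I; rewrite negbK.
have [/existsP[J /andP[JI bJ]]|] := boolP [exists J, (J != I) && (b J != 0)].
  have [i chiIJ] := chi_sep n_even JI.
  pose b' := chi i I *: b + Q i b.
  have b'E K0 : b' K0 = (chi i I + chi i K0) * b K0.
    by rewrite !extE QE mulrDl.
  apply: (IHm b').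
  - by apply: Klin => //; apply: KQ.
  - apply: contraNneq bI => b'0; have := b'E I; rewrite b'0 extE => /eqP.
    by rewrite eq_sym mulf_eq0 -mulr2n -mulr_natl mulf_eq0 signr_eq0 pnatr_eq0.
  - rewrite -ltnS; apply: leq_trans bm; rewrite ltnS; apply: proper_card.
    apply/properP; split.
      apply/fintype.subsetP => K0; rewrite !inE b'E mulf_eq0 negb_or => /andP[_] //.
    by exists J; rewrite !inE ?bJ // b'E chiIJ addrN mul0r eqxx.
rewrite negb_exists => /forallP only.
have bE : b = b I *: blade R I.
  apply: extP => J; rewrite extE bladeE; have [->|JI] := eqVneq J I.
    by rewrite mulr1.
  by rewrite mulr0; have := only J; rewrite JI negbK => /eqP.
have {bm}Kblade : K (blade R I).
  have -> : blade R I = (b I)^-1 *: b by rewrite [X in _ *: X]bE scalerA mulVf ?scale1r.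
  exact: KZ.
elim: {I bI only bE}#|I| {-2}I (erefl #|I|) Kblade => [|k IHk] I.
  move/eqP; rewrite cards_eq0 => /eqP->.
  by rewrite (_ : blade R _ = ext1 R n).
have [->|/set0Pn[i iI] Ik KI] := eqVneq I finset.set0; first by rewrite cards0.
have iI' : i \notin (I :\ i)%SET by rewrite !inE eqxx.
apply: (IHk (I :\ i)%SET).
  by move: Ik; rewrite (cardsD1 i) iI => -[].
have -> : blade R (I :\ i)%SET = (et i * isign R i (I :\ i)%SET) *:
    (ewedge (delta i) (blade R I) + et i *: iprod (delta i) (blade R I)).
  apply: extP => J; rewrite !extE ewedge_deltaE iprod_deltaE !bladeE.
  have -> : (J :\ i == I)%SET = false.
    by apply/eqP => E; rewrite -E !inE eqxx in iI.
  case: (boolP (i \in J)) => iJ.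
    have -> : (J == I :\ i)%SET = false.
      by apply/eqP => E; rewrite E (negbTE iI') in iJ.
    by rewrite !(mulr0, addr0).
  have -> : (i |: J == I)%SET = (J == I :\ i)%SET.
    by apply/eqP/eqP => [<-|->]; [rewrite finset.setU1K|rewrite finset.setD1K].
  case: eqP => [->|_]; last by rewrite !(mulr0, addr0).
  by rewrite mulr1 add0r mulrACA et2 isignK mulr1.
by apply/KZ/KL.
Qed.

End CliffordKernel.

(** * Two-forms, faithfulness, and signed squares *)

Section Homogeneous.
Context (R : realType) (n : nat).
Implicit Types (a : ext R n) (v theta : 'rV[R]_n).

Lemma homogeneous_ewedge k theta a :
  homogeneous k a -> homogeneous k.+1 (ewedge theta a).
Proof.
move=> ha I Ik; rewrite ewedgeE big1 // => i iI; rewrite ha ?mulr0 //.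
by apply: contraNneq Ik => <-; rewrite (cardsD1 i) iI.
Qed.

Lemma homogeneous_iprod k v a (I : {set 'I_n}) :
  homogeneous k a -> #|I|.+1 != k -> iprod v a I = 0.
Proof.
move=> ha Ik; rewrite iprodE big1 // => i iI; rewrite ha ?mulr0 //.
by rewrite cardsU1 iI.
Qed.

(** The two terms have different degrees. *)
Lemma ewedge_iprod_eq0 k theta v a :
  homogeneous k a -> ewedge theta a + iprod v a = 0 -> ewedge theta a = 0.
Proof.
move=> ha E; apply: extP => I; rewrite [RHS]ffunE.
have [kI|kI] := eqVneq #|I| k.+1; last exact: homogeneous_ewedge kI.
have := congr1 (fun x : ext R n => x I) E; rewrite !extE.
rewrite (@homogeneous_iprod k) ?addr0 ?[RHS]ffunE //.
by rewrite kI; elim: k {ha kI}.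
Qed.

Lemma ewedge_top theta a : homogeneous n a -> ewedge theta a = 0.
Proof.
move=> /(homogeneous_ewedge theta) h; apply: extP => I; rewrite [RHS]ffunE; apply: h.
apply: contraTneq (max_card (mem I)) => ->.
by rewrite card_ord ltnn.
Qed.

End Homogeneous.

Section TwoForms.
Context (R : realType) (n : nat).
Implicit Types (a : ext R n) (v theta : 'rV[R]_n).
Local Notation delta := (delta_mx (0 : 'I_1)).

Lemma iprod_wedge2 v theta phi : iprod v (wedge (covec theta) (covec phi)) =
  (theta *m v^T) 0 0 *: covec phi - (phi *m v^T) 0 0 *: covec theta.
Proof.
by rewrite -/(ewedge _ _) iprod_ewedge iprod_covec ewedgeZr ewedge_ext1.
Qed.

Lemma iprod_twoform v (w : 'M[R]_n) : w^T = - w ->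
  iprod v (twoform w) = covec (v *m w).
Proof.
move=> w_skew; have wN i j : w j i = - w i j.
  by have := congr1 (fun m : 'M[R]_n => m i j) w_skew; rewrite !mxE.
rewrite /twoform iprodZr.
have -> : iprod v (\sum_i \sum_j w i j *: wedge (covec (delta i)) (covec (delta j)))
  = 2 *: covec (v *m w).
  have -> : v *m w = \sum_i \sum_j (v 0 i * w i j) *: delta j.
    rewrite exchange_big [LHS]row_sum_delta; apply: eq_bigr => j _.
    by rewrite mxE scaler_suml.
  rewrite scaler_nat mulr2n (linear_sum (iprod v)) /= (linear_sum (@covec R n)) /=.
  transitivity (\sum_i \sum_j ((v 0 i * w i j) *: covec (delta j) -
     (v 0 j * w i j) *: covec (delta i))).
    apply: eq_bigr => i _; rewrite (linear_sum (iprod v)) /=; apply: eq_bigr => j _.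
    rewrite iprodZr iprod_wedge2 !mulmx_delta scalerBr !scalerA.
    by congr (_ *: _ - _ *: _); rewrite mulrC.
  transitivity (\sum_i \sum_j (v 0 i * w i j) *: covec (delta j) -
     \sum_i \sum_j (v 0 j * w i j) *: covec (delta i)).
    by rewrite -sumrB; apply: eq_bigr => i _; rewrite sumrB.
  congr (_ + _).
    apply: eq_bigr => i _; rewrite (linear_sum (@covec R n)) /=.
    by apply: eq_bigr => j _; rewrite covecZ.
  rewrite exchange_big -sumrN; apply: eq_bigr => i _.
  rewrite (linear_sum (@covec R n)) /= -sumrN; apply: eq_bigr => j _.
  by rewrite covecZ wN mulrN scaleNr opprK.
by rewrite scalerA mulVf ?scale1r // pnatr_eq0.
Qed.

(** The two-form of an endomorphism [N], contracted with a vector and raised by the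
    metric, is the endomorphism again; so both sides are sums of the operators
    e^i /\ i_{e_j} with coefficients N_ij. *)
Lemma triangle1_twoform (g N w : 'M[R]_n) a : g^T = g -> g \in unitmx ->
  N *m g = - (g *m N^T) -> w = g *m N^T ->
  triangle1 (invmx g) (twoform w) a = deriv_ext N a.
Proof.
move=> gsym gunit skew ->.
have w_skew : (g *m N^T)^T = - (g *m N^T) by rewrite trmx_mul trmxK gsym skew.
rewrite /triangle1 exchange_big /=.
transitivity (\sum_j ewedge (row j N^T) (iprod (delta j) a)).
  apply: eq_bigr => j _.
  transitivity (ewedge (\sum_i invmx g i j *: (delta i *m (g *m N^T)))
                       (iprod (delta j) a)).
    rewrite ewedge_suml; apply: eq_bigr => i _.
    by rewrite iprod_twoform // ewedgeZl.
  congr (ewedge _ _); under eq_bigr do rewrite scalemxAl; rewrite -mulmx_suml.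
  have -> : \sum_i invmx g i j *: delta i = row j (invmx g).
    rewrite [RHS]row_sum_delta; apply: eq_bigr => i _; congr (_ *: _).
    by rewrite mxE -[in RHS]gsym -trmx_inv mxE.
  by rewrite -row_mul mulmxA mulVmx // mul1mx.
transitivity (\sum_j \sum_i N i j *: ewedge (delta i) (iprod (delta j) a)).
  apply: eq_bigr => j _; rewrite [row j _]row_sum_delta ewedge_suml.
  by apply: eq_bigr => i _; rewrite ewedgeZl !mxE.
rewrite exchange_big; apply: eq_bigr => i _.
rewrite [row i N]row_sum_delta iprod_suml linear_sum /=; apply: eq_bigr => j _.
by rewrite iprodZl ewedgeZr mxE.
Qed.

End TwoForms.

Lemma pullback_grading (R : realType) (n : nat) (T : 'M[R]_n) a :
  pullback T (grading a) = grading (pullback T a).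
Proof.
apply: extP => I; rewrite gradingE !pullbackE cardE.
elim: (enum I) a => [|i s IH] a.
  by rewrite /ext_eval /= gradingE cards0.
rewrite /= !ext_eval_cons exprS -mulrA -IH grading_iprod -[- iprod _ _]scaleN1r.
by rewrite ext_evalZ mulrA mulrNN !mul1r.
Qed.

Section FaithfulRepresentation.
Context (R : realType) (n : nat) (V : vectType R) (g : 'M[R]_n).
Context (gam : ext R n -> 'End(V)) (rep : clifford_rep g gam).
Context (E : 'M[R]_n) (et : 'rV[R]_n).
Hypothesis E_orthonormal : E *m g *m E^T = diag_mx et.
Hypothesis et2 : forall i, et 0 i * et 0 i = 1.
Implicit Types (a b : ext R n) (v theta phi : 'rV[R]_n).
Local Notation delta := (delta_mx (0 : 'I_1)).
Local Notation gi := (invmx g).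
Local Notation c theta := (gam (covec theta)).

Lemma diag2 : diag_mx et *m diag_mx et = 1%:M.
Proof.
apply/matrixP => i j; rewrite mul_diag_mx !mxE.
by case: eqP => [->|_]; rewrite ?mulr1n ?mulr0n ?mulr0.
Qed.

Lemma orthonormal_unit : E \in unitmx.
Proof.
have := diag2; rewrite -{1}E_orthonormal -!mulmxA => /mulmx1_unit[] //.
Qed.

Lemma orthonormal_inv : gi = E^T *m diag_mx et *m E.
Proof.
have Eu := orthonormal_unit.
have gE : g *m E^T = invmx E *m diag_mx et by rewrite -E_orthonormal -mulmxA mulKmx.
have H : g *m (E^T *m diag_mx et *m E) = 1%:M.
  by rewrite !mulmxA gE -[_ *m diag_mx et *m diag_mx et]mulmxA diag2 mulmx1 mulVmx.
by rewrite -[LHS]mulmx1 -H mulKmx // (rep_unit rep).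
Qed.

Lemma frame_dual : diag_mx et *m E *m g = (invmx E)^T.
Proof.
have H : diag_mx et *m E *m g *m E^T = 1%:M.
  by rewrite -!mulmxA [E *m _]mulmxA E_orthonormal diag2.
have Etu : E^T \in unitmx by rewrite unitmx_tr orthonormal_unit.
by rewrite -[LHS](mulmxK Etu) H mul1mx trmx_inv.
Qed.

(** The vector dual, by the metric, to a covector given by its components in the frame. *)
Lemma coframe_sharp (u : 'rV[R]_n) :
  u *m (invmx E)^T *m gi = u *m diag_mx et *m E.
Proof.
have Eu := orthonormal_unit.
rewrite orthonormal_inv !mulmxA; congr (_ *m _ *m _).
by rewrite -mulmxA -trmx_mul mulmxV // trmx1 mulmx1.
Qed.

Lemma pullback_inv_iprod v b :
  pullback (invmx E) (iprod v b) = iprod (v *m E) (pullback (invmx E) b).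
Proof. by rewrite iprod_pullback mulmxK // orthonormal_unit. Qed.

Lemma pullback_clifford u b :
  pullback (invmx E) (ewedge u b + iprod (u *m diag_mx et) b) =
  ewedge (u *m (invmx E)^T) (pullback (invmx E) b) +
  iprod (u *m (invmx E)^T *m gi) (pullback (invmx E) b).
Proof. by rewrite linearD /= pullback_ewedge pullback_inv_iprod coframe_sharp. Qed.

(** The kernel is a two-sided ideal of the Clifford algebra.  It is transported to an
    orthonormal basis by [pullback], where the generators act by
    the operators of [clifford_ideal_one]. *)
Lemma gam_inj a : ~~ odd n -> (exists s : V, s != 0) ->
  (forall s, gam a s = 0) -> a = 0.
Proof.
move=> n_even [s0 s00] a0; apply/eqP; apply/negP => /negP an0.
have Eu := orthonormal_unit.
have delta_diag i : delta i *m diag_mx et = et 0 i *: delta i.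
  by rewrite -rowE row_diag_mx.
pose K b := forall s, gam (pullback (invmx E) b) s = 0.
suff : K (ext1 R n).
  by move/(_ s0); rewrite pullback_ext1 (gam_one rep) => /eqP; rewrite (negbTE s00).
apply: (@clifford_ideal_one _ _ (fun i => et 0 i) K (pullback E a)) => //.
- by move=> k x y Kx Ky s; rewrite linearP /= (gam_lin rep) Kx Ky scaler0 addr0.
- move=> i b Kb s.
  by rewrite -iprodZl -delta_diag pullback_clifford (gam_covec rep) Kb linear0.
- move=> i b Kb s; rewrite -iprodZl -delta_diag linearB /= pullback_ewedge.
  by rewrite pullback_inv_iprod -coframe_sharp pullback_grading -(gam_covecr rep) Kb.
- by rewrite /K pullback_comp mulVmx // pullback1.
apply: contraNneq an0 => E0; rewrite -[a]pullback1 -(mulVmx Eu) -pullback_comp E0.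
by rewrite linear0.
Qed.

End FaithfulRepresentation.

Section PureSpinor.
Context (R : realType) (n : nat) (V : vectType R) (g : 'M[R]_n).
Context (gam : ext R n -> 'End(V)) (rep : clifford_rep g gam).
Hypothesis gam_faithful : forall a, (forall s, gam a s = 0) -> a = 0.
Context (B : V -> V -> R).
Hypothesis BDl : forall k s t u, B (k *: s + t) u = k * B s u + B t u.
Hypothesis BDr : forall k s t u, B u (k *: s + t) = k * B u s + B u t.
Hypothesis B_nondeg : forall s, s != 0 -> exists t, B t s != 0.
Hypothesis B_adj : forall theta s t,
  B (gam (covec theta) s) t = B s (gam (covec theta) t).
Implicit Types (a b : ext R n) (v theta phi : 'rV[R]_n).
Local Notation gi := (invmx g).
Local Notation c theta := (gam (covec theta)).

Lemma pair0l t : B 0 t = 0.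
Proof. by have := BDl (-1) 0 0 t; rewrite scaler0 addr0 mulN1r addNr. Qed.
Lemma pair0r t : B t 0 = 0.
Proof. by have := BDr (-1) 0 0 t; rewrite scaler0 addr0 mulN1r addNr. Qed.
Lemma pairZl k s t : B (k *: s) t = k * B s t.
Proof. by have := BDl k s 0 t; rewrite !addr0 pair0l addr0. Qed.
Lemma pairZr k s t : B t (k *: s) = k * B t s.
Proof. by have := BDr k s 0 t; rewrite !addr0 pair0r addr0. Qed.
Lemma pairDl s t u : B (s + t) u = B s u + B t u.
Proof. by have := BDl 1 s t u; rewrite scale1r mul1r. Qed.
Lemma pairDr s t u : B u (s + t) = B u s + B u t.
Proof. by have := BDr 1 s t u; rewrite scale1r mul1r. Qed.
Lemma pair_suml (T : Type) (r : seq T) (P : pred T) (F : T -> V) u :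
  B (\sum_(i <- r | P i) F i) u = \sum_(i <- r | P i) B (F i) u.
Proof.
apply: (big_rec2 (fun x y => B x u = y)) => [|i x y _ <-]; first exact: pair0l.
exact: pairDl.
Qed.
Lemma pair_sumr (T : Type) (r : seq T) (P : pred T) (F : T -> V) u :
  B u (\sum_(i <- r | P i) F i) = \sum_(i <- r | P i) B u (F i).
Proof.
apply: (big_rec2 (fun x y => B u x = y)) => [|i x y _ <-]; first exact: pair0r.
exact: pairDr.
Qed.

(** Reversion changes the sign of a product of two distinct orthogonal covectors. *)
Lemma two_form_skew_adjoint (I : finType) (w : I -> I -> R) (th : I -> 'rV[R]_n) s t :
  (forall i j, w i j = - w j i) ->
  let omega := 2^-1 *: \sum_i \sum_j w i j *: wedge (covec (th i)) (covec (th j)) in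
  B (gam omega s) t = - B s (gam omega t).
Proof.
move=> w_skew; rewrite /= !(gam_two_form rep) // pairZl pairZr -mulrN; congr (_ * _).
have L (F : I -> I -> V) : B (\sum_i \sum_j F i j) t = \sum_i \sum_j B (F i j) t.
  by rewrite pair_suml; apply: eq_bigr => i _; rewrite pair_suml.
have L' (F : I -> I -> V) : B s (\sum_i \sum_j F i j) = \sum_i \sum_j B s (F i j).
  by rewrite pair_sumr; apply: eq_bigr => i _; rewrite pair_sumr.
rewrite L L' exchange_big -sumrN; apply: eq_bigr => i _.
rewrite -sumrN; apply: eq_bigr => j _.
by rewrite pairZl pairZr !B_adj w_skew mulNr.
Qed.

(** Taking [s] not orthogonal to [xi] shows that [eta] is a multiple l [xi], and then that
    2 l = 0. *)
Lemma rank_two_eq0 (xi eta : V) : xi != 0 ->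
  (forall s, B s eta *: xi + B s xi *: eta = 0) -> eta = 0.
Proof.
move=> xi0 H; have [t tn0] := B_nondeg xi0.
have eE : eta = - (B t eta / B t xi) *: xi.
  apply: (scalerI tn0); rewrite scalerA mulrN mulrC divfK // scaleNr.
  by apply/eqP; rewrite -addr_eq0 addrC H.
move: (H t); rewrite [in X in X + _]eE pairZr [in X in _ + X]eE scalerA.
move=> /eqP; rewrite -scalerDl scaler_eq0 (negbTE xi0) orbF.
rewrite [_ * B t xi]mulrC -mulrDl mulf_eq0 -mulr2n -mulr_natl mulf_eq0 pnatr_eq0.
by rewrite (negbTE tn0) /= => /eqP c0; rewrite eE c0 scale0r.
Qed.

(** If theta . xi = 0 then theta . alpha, which is the sum of the wedge product and of a
    contraction of different degrees, acts by 0.  Conversely, if theta /\ alpha = 0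
    then theta . alpha and alpha . theta agree up to sign; comparing them on a
    spinor gives theta . xi = l xi.  As the volume form anticommutes with theta
    in even dimension, theta . xi has chirality opposite to xi, so l = 0. *)
Lemma signed_square_annihilator k kappa nu mu xi alpha theta :
  ~~ odd n -> homogeneous n nu -> gam nu xi = mu *: xi -> mu != 0 -> kappa != 0 ->
  homogeneous k alpha -> xi != 0 ->
  (forall s, gam alpha s = (kappa * B s xi) *: xi) ->
  ewedge theta alpha = 0 <-> c theta xi = 0.
Proof.
move=> n_even nu_top nu_xi mu0 kappa0 alpha_k xi0 alphaE.
split=> [E|E]; last first.
  apply: (@ewedge_iprod_eq0 _ _ k _ (theta *m gi)) => //.
  by apply: gam_faithful => s; rewrite (gam_covec rep) alphaE linearZ /= E scaler0.
have [t tn0] := B_nondeg xi0.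
have := gam_covecr rep alpha theta t.
rewrite (grading_homogeneous alpha_k) ewedgeZr iprodZr E scaler0 sub0r -scalerN.
rewrite (gamZ rep) (gamN rep).
have := gam_covec rep theta alpha t; rewrite E add0r => ->.
rewrite !alphaE linearZ /= => H.
have [l cl] : exists l, c theta xi = l *: xi.
  move: H (mulf_neq0 kappa0 tn0).
  move: (kappa * B (c theta t) xi) (kappa * B t xi) => q K H K0.
  exists (- ((-1) ^+ k * q / K)); apply: (scalerI K0).
  rewrite scalerA mulrN [K * _]mulrC divfK // scaleNr -scalerA H.
  by rewrite !scalerN opprK scalerA -expr2 sqrr_sign scale1r.
have : gam nu (c theta xi) = - c theta (gam nu xi).
  rewrite (gam_covecr rep) -(gam_covec rep) (grading_homogeneous nu_top).
  rewrite -signr_odd (negbTE n_even) scale1r !ewedge_top // sub0r add0r (gamN rep) //.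
rewrite nu_xi cl !linearZ /= nu_xi cl.
have -> : l *: (mu *: xi) = mu *: (l *: xi) by rewrite !scalerA mulrC.
move/(scalerI mu0)/eqP; rewrite -addr_eq0 -mulr2n -scaler_nat.
by rewrite scaler_eq0 pnatr_eq0 => /eqP.
Qed.

End PureSpinor.

(** * Smooth functions on open sets of a vector space *)

Section SmoothNear.
Context (R : realType) (n : nat).
Implicit Types (U : set 'rV[R]_n) (f g : 'rV[R]_n -> R).

(** The two functions have the same first-order expansion. *)
Lemma near_eq_differentiable (V W : normedModType R) (f g : V -> W) (x : V) :
  (\near x, f x = g x) -> differentiable f x -> differentiable g x.
Proof.
move=> fg df; have fgx : f x = g x := nbhs_singleton fg.
have Hg : g \o shift x = cst (g x) + 'd f x +o_ (0 : V) id.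
  apply/eqaddoP => e e0.
  have /eqaddoP/(_ _ e0) + := diff_locally df.
  have : \forall y \near (0 : V), f (y + x) = g (y + x).
    have := near_shift 0 x (fun y => f y = g y).
    by rewrite subr0 => H; move: fg; rewrite H; apply: filterS => y.
  apply: filterS2 => y fgy; rewrite /= !fctE /= fgx fgy //.
have [c _] := (diff_locallyP x f).1 df.
have E := diff_unique c Hg.
by apply/diff_locallyP; rewrite E.
Qed.

Lemma is_Ck_eq k U f g : open U -> (forall x, U x -> f x = g x) ->
  is_Ck k U f -> is_Ck k U g.
Proof.
move=> oU; elim: k f g => [|k IH] f g fg /=.
  move=> cf x Ux.
  have nfg : \near x, f x = g x by apply: filterS (oU _ Ux) => y /fg.
  rewrite /prop_for /continuous_at -(fg _ Ux).
  exact: (cvg_trans (@near_eq_cvg _ _ (nbhs x) (nbhs_filter x) f g nfg) (cf x Ux)).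
move=> [df dv]; split=> [x Ux|v].
  apply: near_eq_differentiable (df x Ux).
  by apply: filterS (oU _ Ux) => y /fg.
apply: IH (dv v) => x Ux; apply: near_eq_derive.
by apply: filterS (oU _ Ux) => y /fg.
Qed.

Lemma is_CkW k U f : is_Ck k.+1 U f -> is_Ck k U f.
Proof.
elim: k f => [|k IH] f /=.
  by move=> [df _] x Ux; apply/differentiable_continuous/df.
by move=> [df dv]; split=> [x Ux|v]; [exact: df|exact: (IH _ (dv v))].
Qed.

Lemma is_Ck_cst k U (a : R) : is_Ck k U (fun=> a).
Proof.
elim: k a => [|k IH] a /=; first by move=> x _; apply: cst_continuous.
split=> [x _|v]; first exact: differentiable_cst.
rewrite [X in is_Ck _ _ X](_ : _ = fun=> 0); first exact: IH.
by apply/funext => x; apply: derive_cst.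
Qed.

Lemma is_CkD k U f g : open U -> is_Ck k U f -> is_Ck k U g ->
  is_Ck k U (fun x => f x + g x).
Proof.
move=> oU; elim: k f g => [|k IH] f g /=.
  by move=> cf cg x Ux; apply: (@continuousD _ _ _ f g); [apply: cf|apply: cg].
move=> [df dvf] [dg dvg]; split=> [x Ux|v].
  by apply: (@differentiableD _ _ _ f g); [apply: df|apply: dg].
apply: is_Ck_eq (IH _ _ (dvf v) (dvg v)) => // x Ux.
by rewrite -deriveD //; apply: diff_derivable; [apply: df|apply: dg].
Qed.

Lemma is_CkM k U f g : open U -> is_Ck k U f -> is_Ck k U g ->
  is_Ck k U (fun x => f x * g x).
Proof.
move=> oU; elim: k f g => [|k IH] f g.
  by move=> cf cg x Ux; apply: (@continuousM _ _ f g); [apply: cf|apply: cg].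
move=> Cf Cg; have [df dvf] := Cf; have [dg dvg] := Cg; split=> [x Ux|v].
  by apply: (@differentiableM _ _ f g); [apply: df|apply: dg].
have := is_CkD oU (IH _ _ (is_CkW Cf) (dvg v)) (IH _ _ (is_CkW Cg) (dvf v)).
apply: is_Ck_eq => // x Ux.
rewrite [RHS](_ : _ = f x *: 'D_v g x + g x *: 'D_v f x) //.
by apply: deriveM; apply: diff_derivable; [apply: df|apply: dg].
Qed.

Lemma smooth_near_cst (a : R) x : smooth_near (fun _ : 'rV[R]_n => a) x.
Proof. by exists setT; split=> // [|k]; [apply: openT|apply: is_Ck_cst]. Qed.

Lemma is_Ck_sub k U U' f : U `<=` U' -> is_Ck k U' f -> is_Ck k U f.
Proof.
move=> UU'; elim: k f => [|k IH] f /=; first by move=> cf x /UU'/cf.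
by move=> [df dv]; split=> [x /UU'/df//|v]; exact: (IH _ (dv v)).
Qed.

Lemma smooth_nearD f g x : smooth_near f x -> smooth_near g x ->
  smooth_near (fun y => f y + g y) x.
Proof.
move=> [U [oU Ux CU]] [U' [oU' Ux' CU']]; exists (U `&` U'); split=> //.
  exact: openI.
move=> k; apply: is_CkD; first exact: openI.
  by apply: is_Ck_sub (CU k) => y [].
by apply: is_Ck_sub (CU' k) => y [].
Qed.

Lemma smooth_nearM f g x : smooth_near f x -> smooth_near g x ->
  smooth_near (fun y => f y * g y) x.
Proof.
move=> [U [oU Ux CU]] [U' [oU' Ux' CU']]; exists (U `&` U'); split=> //.
  exact: openI.
move=> k; apply: is_CkM; first exact: openI.
  by apply: is_Ck_sub (CU k) => y [].
by apply: is_Ck_sub (CU' k) => y [].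
Qed.

Lemma smooth_near_eq f g x : (\near x, f x = g x) -> smooth_near f x -> smooth_near g x.
Proof.
move=> fg; have : nbhs x [set y | f y = g y] by [].
rewrite nbhsE => -[W [oW Wx] WE] [U [oU Ux CU]]; exists (U `&` W); split=> //.
  exact: openI.
move=> k; apply: (@is_Ck_eq k _ f); first exact: openI.
  by move=> y [_ /WE].
by apply: is_Ck_sub (CU k) => y [].
Qed.

Lemma smooth_near_differentiable f x : smooth_near f x -> differentiable f x.
Proof. by move=> [U [oU Ux /(_ 1%N)[+ _]]]; apply. Qed.

End SmoothNear.

(** * Smooth functions and coordinate fields on a manifold *)

Section SmoothFunctions.
Context (R : realType) (n : nat) (M : manifold R n).
Implicit Types (f g : M -> R) (m : M) (v w : 'rV[R]_n).

Lemma near_cinv (P : M -> Prop) m (c := chart_at m) :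
  (\near m, P m) -> \forall x \near cmap c m, P (cinv c x).
Proof.
move=> Pm; have := cinv_continuous (chart_at_dom m).
by rewrite /prop_for /continuous_at (cmapK (chart_at_dom m)) => /(_ _ Pm).
Qed.

Lemma smooth_fun_near f g m : (\near m, f m = g m) -> smooth_fun f m -> smooth_fun g m.
Proof. by move=> fg; apply: smooth_near_eq; exact: (near_cinv fg). Qed.

Lemma smooth_fun_cst (a : R) m : smooth_fun (fun _ : M => a) m.
Proof. exact: smooth_near_cst. Qed.

Lemma smooth_funD f g m : smooth_fun f m -> smooth_fun g m ->
  smooth_fun (fun m' => f m' + g m') m.
Proof. exact: smooth_nearD. Qed.

Lemma smooth_funM f g m : smooth_fun f m -> smooth_fun g m ->
  smooth_fun (fun m' => f m' * g m') m.
Proof. exact: smooth_nearM. Qed.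

Lemma smooth_funZ a f m : smooth_fun f m -> smooth_fun (fun m' => a * f m') m.
Proof. by move=> sf; apply: smooth_funM => //; apply: smooth_fun_cst. Qed.

Lemma smooth_fun_sum (I : Type) (r : seq I) (P : pred I) (F : I -> M -> R) m :
  (forall i, P i -> smooth_fun (F i) m) ->
  smooth_fun (fun m' => \sum_(i <- r | P i) F i m') m.
Proof.
move=> sF; elim: r => [|i r IH].
  rewrite (_ : (fun _ => _) = fun=> 0); first exact: smooth_fun_cst.
  by apply/funext => x; rewrite big_nil.
case Pi: (P i); last first.
  rewrite (_ : (fun _ => _) = fun m' => \sum_(i <- r | P i) F i m') //.
  by apply/funext => x; rewrite big_cons Pi.
rewrite (_ : (fun _ => _) = fun m' => F i m' + \sum_(i <- r | P i) F i m').
  by apply: smooth_funD => //; apply: sF.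
by apply/funext => x; rewrite big_cons Pi.
Qed.

Lemma smooth_fun_prod (I : Type) (r : seq I) (P : pred I) (F : I -> M -> R) m :
  (forall i, P i -> smooth_fun (F i) m) ->
  smooth_fun (fun m' => \prod_(i <- r | P i) F i m') m.
Proof.
move=> sF; elim: r => [|i r IH].
  rewrite (_ : (fun _ => _) = fun=> 1); first exact: smooth_fun_cst.
  by apply/funext => x; rewrite big_nil.
case Pi: (P i); last first.
  rewrite (_ : (fun _ => _) = fun m' => \prod_(i <- r | P i) F i m') //.
  by apply/funext => x; rewrite big_cons Pi.
rewrite (_ : (fun _ => _) = fun m' => F i m' * \prod_(i <- r | P i) F i m').
  by apply: smooth_funM => //; apply: sF.
by apply/funext => x; rewrite big_cons Pi.
Qed.

Lemma smooth_fun_det k (F : M -> 'M[R]_k) m :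
  (forall i j, smooth_fun (fun m' => F m' i j) m) ->
  smooth_fun (fun m' => \det (F m')) m.
Proof.
move=> sF; apply: smooth_fun_sum => s _; apply: smooth_funZ.
by apply: smooth_fun_prod => i _.
Qed.

Lemma smooth_fun_adj k (F : M -> 'M[R]_k) m :
  (forall i j, smooth_fun (fun m' => F m' i j) m) ->
  forall i j, smooth_fun (fun m' => (\adj (F m')) i j) m.
Proof.
move=> sF i j.
rewrite (_ : (fun _ => _) = fun m' => cofactor (F m') j i); last first.
  by apply/funext => x; rewrite mxE.
apply: smooth_funZ; apply: smooth_fun_det => a b.
rewrite (_ : (fun _ => _) = fun m' => F m' (lift j a) (lift i b)) //.
by apply/funext => x; rewrite !mxE.
Qed.

Lemma smooth_fun_diff f m : smooth_fun f m ->
  differentiable (f \o cinv (chart_at m)) (cmap (chart_at m) m).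
Proof. exact: smooth_near_differentiable. Qed.

Lemma smooth_fun_derivable f m v : smooth_fun f m ->
  derivable (f \o cinv (chart_at m)) (cmap (chart_at m) m) v.
Proof. by move=> /smooth_fun_diff/diff_derivable; apply. Qed.

Lemma dird_near f g m v : (\near m, f m = g m) -> dird m v f = dird m v g.
Proof. by move=> fg; apply: near_eq_derive; exact: (near_cinv fg). Qed.

Lemma dird_cst (a : R) m v : dird m v (fun _ : M => a) = 0.
Proof. exact: derive_cst. Qed.

Lemma dirdD f g m v : smooth_fun f m -> smooth_fun g m ->
  dird m v (fun m' => f m' + g m') = dird m v f + dird m v g.
Proof. by move=> sf sg; apply: deriveD; apply: smooth_fun_derivable. Qed.

Lemma dirdM f g m v : smooth_fun f m -> smooth_fun g m ->
  dird m v (fun m' => f m' * g m') = dird m v f * g m + f m * dird m v g.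
Proof.
move=> sf sg; rewrite /dird.
have := @deriveM _ _ (f \o cinv (chart_at m)) (g \o cinv (chart_at m))
  (cmap (chart_at m) m) v (@smooth_fun_derivable f m v sf) (@smooth_fun_derivable g m v sg).
rewrite /= (cmapK (chart_at_dom m)) => H.
by rewrite addrC [dird m v f * _]mulrC.
Qed.

Lemma dirdZ a f m v : smooth_fun f m -> dird m v (fun m' => a * f m') = a * dird m v f.
Proof.
move=> sf; rewrite dirdM //; last exact: smooth_fun_cst.
by rewrite dird_cst mul0r add0r.
Qed.

Lemma dird_sum (I : Type) (r : seq I) (P : pred I) (F : I -> M -> R) m v :
  (forall i, P i -> smooth_fun (F i) m) ->
  dird m v (fun m' => \sum_(i <- r | P i) F i m') = \sum_(i <- r | P i) dird m v (F i).
Proof.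
move=> sF; elim: r => [|i r IH].
  rewrite big_nil (_ : (fun _ => _) = fun=> 0) ?dird_cst //.
  by apply/funext => x; rewrite big_nil.
rewrite big_cons; case: ifPn => Pi.
  rewrite (_ : (fun _ => _) = fun m' => F i m' + \sum_(i <- r | P i) F i m').
    by rewrite dirdD ?IH //; [apply: sF|apply: smooth_fun_sum].
  by apply/funext => x; rewrite big_cons Pi.
rewrite (_ : (fun _ => _) = fun m' => \sum_(i <- r | P i) F i m') //.
by apply/funext => x; rewrite big_cons (negbTE Pi).
Qed.

End SmoothFunctions.

Section CoordinateFields.
Context (R : realType) (n : nat) (M : manifold R n).
Implicit Types (m : M) (v w : 'rV[R]_n) (c : chart R n M).
Local Notation delta := (delta_mx (0 : 'I_1)).

Lemma differentiable_row (f : 'rV[R]_n -> 'rV[R]_n) x :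
  (forall i, differentiable (fun y => f y 0 i) x) -> differentiable f x.
Proof.
move=> df; rewrite (_ : f = \sum_i (fun y => f y 0 i *: delta i)).
  by apply: differentiable_sum => i; apply: differentiableZl.
by apply/funext => y; rewrite fct_sumE [LHS]row_sum_delta.
Qed.

Lemma near_cdom c m : cdom c m -> \near m, cdom c m.
Proof. by move=> cm; apply: open_nbhs_nbhs; split=> //; apply: cdom_open. Qed.

Lemma near_cmapK c m : cdom c m -> \forall x \near cmap c m, cmap c (cinv c x) = x.
Proof.
move=> cm; have : nbhs (cmap c m) (cmap c @` cdom c).
  by apply: open_nbhs_nbhs; split; [apply: cimg_open|exists m].
by apply: filterS => x [m' cm' <-]; rewrite cmapK.
Qed.

Definition transition c c' : 'rV[R]_n -> 'rV[R]_n := cmap c' \o cinv c.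

Lemma transition_diff c c' m : atlas c -> atlas c' -> cdom c m -> cdom c' m ->
  differentiable (transition c c') (cmap c m).
Proof.
move=> ac ac' cm c'm; apply: differentiable_row => i.
exact: (smooth_near_differentiable (atlas_compat ac ac' cm c'm i)).
Qed.

Lemma transition_near c c' m : cdom c m -> cdom c' m ->
  \forall x \near cmap c m, transition c' c (transition c c' x) = x.
Proof.
move=> cm c'm.
have near_c' : \forall x \near cmap c m, cdom c' (cinv c x).
  have := @cinv_continuous _ _ _ c m cm.
  by rewrite /prop_for /continuous_at cmapK // => /(_ _ (near_cdom c'm)).
apply: filterS2 (near_cmapK cm) near_c' => x xK c'x.
by rewrite /transition /= cmapK.
Qed.

(** The chain rule for a change of coordinates and its inverse. *)
Lemma transition_diffK c c' m v : atlas c -> atlas c' -> cdom c m -> cdom c' m ->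
  'D_('D_v (transition c c') (cmap c m)) (transition c' c) (cmap c' m) = v.
Proof.
move=> ac ac' cm c'm.
have d1 := transition_diff ac ac' cm c'm; have d2 := transition_diff ac' ac c'm cm.
have E : transition c c' (cmap c m) = cmap c' m by rewrite /transition /= cmapK.
rewrite !deriveE // -E -[LHS]/(('d (transition c' c) _ \o 'd (transition c c') _) v).
rewrite -diff_comp ?E // -deriveE; last by apply: differentiable_comp; rewrite ?E.
by rewrite (near_eq_derive _ (transition_near cm c'm)) derive_id.
Qed.

Lemma chart_compE c m v : atlas c -> cdom c m ->
  chart_comp c m v = 'D_v (transition (chart_at m) c) (cmap (chart_at m) m).
Proof.
move=> ac cm.
have d := transition_diff (chart_at_atlas m) ac (chart_at_dom m) cm.
rewrite derive_mx; last exact: diff_derivable.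
by apply/rowP => i; rewrite !mxE.
Qed.

Lemma chart_comp_linear c m a v w : atlas c -> cdom c m ->
  chart_comp c m (a *: v + w) = a *: chart_comp c m v + chart_comp c m w.
Proof.
move=> ac cm; have d := transition_diff (chart_at_atlas m) ac (chart_at_dom m) cm.
by rewrite !chart_compE // !deriveE // linearP.
Qed.

Lemma coordfE m i m' :
  coordf m i m' = 'D_(delta i) (transition (chart_at m) (chart_at m')) (cmap (chart_at m) m').
Proof. by []. Qed.

Lemma chart_comp_coordf m i m' : cdom (chart_at m) m' ->
  chart_comp (chart_at m) m' (coordf m i m') = delta i.
Proof.
move=> cm'; rewrite chart_compE ?coordfE ?transition_diffK //.
all: by [exact: chart_at_atlas|exact: chart_at_dom].
Qed.

Lemma chart_comp_id m v : chart_comp (chart_at m) m v = v.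
Proof.
rewrite (chart_compE _ (chart_at_atlas m) (chart_at_dom m)).
by rewrite (near_eq_derive _ (near_cmapK (chart_at_dom m))) derive_id.
Qed.

Lemma coordf_id m i : coordf m i m = delta i.
Proof.
by rewrite -(chart_comp_id m (coordf m i m)) (chart_comp_coordf _ (chart_at_dom m)).
Qed.

(** By the chain rule: [v] is given in the chart chosen at [m'], whereas its
    coefficients and [coordf m] refer to the chart chosen at [m]. *)
Lemma coordf_sum m m' v : cdom (chart_at m) m' ->
  v = \sum_i chart_comp (chart_at m) m' v 0 i *: coordf m i m'.
Proof.
move=> cm'; have [am am'] := (chart_at_atlas m, chart_at_atlas m').
have d := transition_diff am am' cm' (chart_at_dom m').
rewrite -[LHS](transition_diffK v am' am (chart_at_dom m') cm') -chart_compE //.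
rewrite deriveE // [X in 'd _ _ X]row_sum_delta linear_sum /=.
by apply: eq_bigr => i _; rewrite linearZ coordfE deriveE.
Qed.

End CoordinateFields.

(** * Connections and derivatives of forms in moving frames *)

Section Connections.
Context (R : realType) (n : nat) (M : manifold R n).
Context (F : M -> lmodType R) (sm : (forall m, F m) -> M -> Prop).
Context (nab : forall m : M, 'rV[R]_n -> (forall m, F m) -> F m).
Hypothesis nab_conn : connection sm nab.
Implicit Types (s t : forall m, F m).

(** The indicator function of the coincidence set of [s] and [t] is locally constant at
    [m], hence smooth there with zero derivative, and its products with [s] and
    [t] are equal everywhere; the Leibniz rule then compares the derivatives. *)
Lemma conn_near m v s t : sm s m -> sm t m -> (\near m, s m = t m) ->
  nab m v s = nab m v t.
Proof.
move=> ss st st_near.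
pose chi m' : R := if `[< s m' = t m' >] then 1 else 0.
have chi_near : \near m, chi m = 1.
  by apply: filterS st_near => m' E; rewrite /chi asboolT.
have chi_smooth : smooth_fun chi m.
  apply: smooth_fun_near (smooth_fun_cst 1 m).
  by apply: filterS chi_near => m' ->.
have dchi : dird m v chi = 0 by rewrite (dird_near v chi_near) dird_cst.
have chim : chi m = 1 := nbhs_singleton chi_near.
have E : (fun m' => chi m' *: s m') = (fun m' => chi m' *: t m').
  apply: functional_extensionality_dep => m'; rewrite /chi.
  by case: asboolP => [->//|_]; rewrite !scale0r.
have := congr1 (nab m v) E.
by rewrite !(conn_leibniz nab_conn) // dchi chim !scale0r !scale1r !add0r.
Qed.

Hypothesis sm0 : forall m, sm (fun _ => 0) m.
Hypothesis smD : forall s t m, sm s m -> sm t m -> sm (fun m' => s m' + t m') m.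
Hypothesis smZ : forall f s m, smooth_fun f m -> sm s m -> sm (fun m' => f m' *: s m') m.

Lemma sm_sum (I : Type) (r : seq I) (f : I -> M -> R) (s : I -> forall m, F m) m :
  (forall i, smooth_fun (f i) m) -> (forall i, sm (s i) m) ->
  sm (fun m' => \sum_(i <- r) f i m' *: s i m') m.
Proof.
move=> sf ss; elim: r => [|i r IH].
  rewrite (_ : (fun _ => _) = fun=> 0) //.
  by apply: functional_extensionality_dep => x; rewrite big_nil.
rewrite (_ : (fun _ => _) = fun m' => f i m' *: s i m' + \sum_(i <- r) f i m' *: s i m').
  by apply: smD => //; apply: smZ.
by apply: functional_extensionality_dep => x; rewrite big_cons.
Qed.

Lemma conn_sum (I : Type) (r : seq I) (f : I -> M -> R) (s : I -> forall m, F m) m v :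
  (forall i, smooth_fun (f i) m) -> (forall i, sm (s i) m) ->
  nab m v (fun m' => \sum_(i <- r) f i m' *: s i m') =
  \sum_(i <- r) (dird m v (f i) *: s i m + f i m *: nab m v (s i)).
Proof.
move=> sf ss; elim: r => [|i r IH].
  rewrite big_nil (_ : (fun _ => _) = fun m' : M => (0 : R) *: (0 : F m')).
    rewrite (conn_leibniz nab_conn) //; last exact: smooth_fun_cst.
    by rewrite scaler0 scale0r addr0.
  by apply: functional_extensionality_dep => x; rewrite big_nil scaler0.
rewrite big_cons -IH -(conn_leibniz nab_conn) // -(conn_add nab_conn) //.
- by congr (nab m v); apply: functional_extensionality_dep => x; rewrite big_cons.
- exact: smZ.
- exact: sm_sum.
Qed.

End Connections.

Section VectorFields.
Context (R : realType) (n : nat) (M : manifold R n).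
Implicit Types (m : M) (X Y : vfield M).
Local Notation delta := (delta_mx (0 : 'I_1)).


Lemma smooth_vfield0 m : smooth_vfield (fun _ : M => 0) m.
Proof.
move=> i; apply: smooth_fun_near (smooth_fun_cst 0 m).
apply: filterS (near_cdom (chart_at_dom m)) => m' cm'.
have := chart_comp_linear (-1) 0 0 (chart_at_atlas m) cm'.
by rewrite scaler0 addr0 scaleN1r addNr => ->; rewrite mxE.
Qed.

Lemma smooth_vfieldD X Y m : smooth_vfield X m -> smooth_vfield Y m ->
  smooth_vfield (fun m' => X m' + Y m') m.
Proof.
move=> sX sY i; apply: smooth_fun_near (smooth_funD (sX i) (sY i)).
apply: filterS (near_cdom (chart_at_dom m)) => m' cm'.
have := chart_comp_linear 1 (X m') (Y m') (chart_at_atlas m) cm'.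
by rewrite !scale1r => ->; rewrite [RHS]mxE.
Qed.

Lemma smooth_vfieldZ (f : M -> R) X m : smooth_fun f m -> smooth_vfield X m ->
  smooth_vfield (fun m' => f m' *: X m') m.
Proof.
move=> sf sX i; apply: smooth_fun_near (smooth_funM sf (sX i)).
apply: filterS (near_cdom (chart_at_dom m)) => m' cm'.
have := chart_comp_linear (f m') (X m') 0 (chart_at_atlas m) cm'.
have := chart_comp_linear (-1) 0 0 (chart_at_atlas m) cm'.
by rewrite scaler0 !addr0 scaleN1r addNr => -> ->; rewrite addr0 [RHS]mxE.
Qed.

Lemma smooth_coordf m i : smooth_vfield (coordf m i) m.
Proof.
move=> j; apply: smooth_fun_near (smooth_fun_cst (delta i 0 j) m).
apply: filterS (near_cdom (chart_at_dom m)) => m' cm'.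
by rewrite chart_comp_coordf.
Qed.

End VectorFields.

Section FormCalculus.
Context (R : realType) (n : nat) (M : manifold R n).
Implicit Types (m : M) (X Y : vfield M) (a alpha : M -> ext R n).
Local Notation delta := (delta_mx (0 : 'I_1)).

Definition smooth_ext a m : Prop := forall I, smooth_fun (fun m' => a m' I) m.
(** The componentwise derivative; it has a meaning only for forms written in a given frame. *)
Definition dext m v a : ext R n := [ffun I => dird m v (fun m' => a m' I)].
Definition smooth_row X m : Prop := forall i, smooth_fun (fun m' => X m' 0 i) m.
Definition drow m v X : 'rV[R]_n := \row_i dird m v (fun m' => X m' 0 i).

Lemma dextE m v a I : dext m v a I = dird m v (fun m' => a m' I).
Proof. by rewrite ffunE. Qed.

Lemma smooth_iprod X a m : smooth_row X m -> smooth_ext a m ->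
  smooth_ext (fun m' => iprod (X m') (a m')) m.
Proof.
move=> sX sa I.
rewrite (_ : (fun _ => _) = fun m' => \sum_(i | i \notin I)
    isign R i I * (X m' 0 i * a m' (i |: I)%SET)); last first.
  by apply/funext => x; rewrite iprodE.
by apply: smooth_fun_sum => i _; apply: smooth_funZ; apply: smooth_funM.
Qed.

Lemma dext_iprod X a m v : smooth_row X m -> smooth_ext a m ->
  dext m v (fun m' => iprod (X m') (a m')) =
  iprod (drow m v X) (a m) + iprod (X m) (dext m v a).
Proof.
move=> sX sa; apply: extP => I; rewrite dextE extE !iprodE -big_split /=.
rewrite (_ : (fun _ => _) = fun m' => \sum_(i | i \notin I)
    isign R i I * (X m' 0 i * a m' (i |: I)%SET)); last first.
  by apply/funext => x; rewrite iprodE.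
rewrite dird_sum => [|i _]; last by apply: smooth_funZ; apply: smooth_funM.
apply: eq_bigr => i _; rewrite dirdZ ?dirdM //; last exact: smooth_funM.
by rewrite dextE mxE mulrDr.
Qed.

Lemma smooth_ext_eval (k : eqType) (T : k -> vfield M) a m (s : seq k) :
  (forall i, smooth_row (T i) m) -> smooth_ext a m ->
  smooth_fun (fun m' => ext_eval (a m') [seq T i m' | i <- s]) m.
Proof.
move=> sT; elim: s a => [|i s IH] a sa /=; first exact: sa.
exact: (IH (fun m' => iprod (T i m') (a m')) (smooth_iprod (sT i) sa)).
Qed.

Lemma dird_ext_eval (k : eqType) (T : k -> vfield M) a m v (s : seq k) :
  (forall i, smooth_row (T i) m) -> smooth_ext a m -> uniq s ->
  dird m v (fun m' => ext_eval (a m') [seq T i m' | i <- s]) =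
  ext_eval (dext m v a) [seq T i m | i <- s] +
  \sum_(l <- s) ext_eval (a m)
     [seq (if i == l then drow m v (T i) else T i m) | i <- s].
Proof.
move=> sT; elim: s a => [|i s IH] a sa /=.
  by move=> _; rewrite big_nil addr0 /ext_eval /= dextE.
move=> /andP[iNs us].
have := IH (fun m' => iprod (T i m') (a m')) (smooth_iprod (sT i) sa) us.
rewrite [LHS](_ : _ =
  dird m v (fun m' => ext_eval (a m') (T i m' :: [seq T i m' | i <- s]))) // => ->.
rewrite dext_iprod // ext_evalD big_cons eqxx -!ext_eval_cons.
rewrite [X in X + _ = _]addrC -addrA; congr (_ + (_ + _)).
  congr ext_eval; congr (_ :: _); apply/eq_in_map => j js.
  by case: eqP => // E; rewrite -E js in iNs.
apply: eq_big_seq => l ls; rewrite -ext_eval_cons.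
by case: eqP => // E; rewrite E ls in iNs.
Qed.

Definition coordf_mx m m' : 'M[R]_n := \matrix_i coordf m i m'.

Lemma coordf_mx_id m : coordf_mx m m = 1%:M.
Proof. by apply/row_matrixP => i; rewrite rowK coordf_id row1. Qed.

Lemma pullback_coordfE alpha m m' I :
  pullback (coordf_mx m m') (alpha m') I =
  ext_eval (alpha m') [seq coordf m i m' | i <- enum I].
Proof. by rewrite pullbackE; congr ext_eval; apply: eq_map => i; rewrite rowK. Qed.

Lemma smooth_pullback_coordf alpha m : smooth_form alpha m ->
  smooth_ext (fun m' => pullback (coordf_mx m m') (alpha m')) m.
Proof.
move=> sa I; rewrite (_ : (fun _ => _) = fun m' =>
  ext_eval (alpha m') [seq coordf m i m' | i <- enum I]); first exact: sa.
by apply/funext => x; rewrite pullback_coordfE.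
Qed.

Context (nab : tconn M) (nab_conn : tangent_connection nab).

(** The derivative of a form is that of its components in the coordinate frame, corrected
    by the Christoffel symbols, which act as a derivation. *)
Lemma nabla_formE alpha m v :
  nabla_form nab alpha m v =
  dext m v (fun m' => pullback (coordf_mx m m') (alpha m')) -
  deriv_ext (\matrix_i nab m v (coordf m i)) (alpha m).
Proof.
apply: extP => I; rewrite ffunE extDE extNE dextE; congr (_ - _).
  by congr (dird m v); apply/funext => m'; rewrite pullback_coordfE.
rewrite -[RHS]ext_eval_delta.
rewrite (ext_eval_deriv_ext (X := fun i => nab m v (coordf m i))) ?enum_uniq //.
  apply: eq_bigr => l _; congr ext_eval; apply: eq_map => i.
  by case: eqP => [->//|_]; rewrite coordf_id.
by move=> i; rewrite -rowE rowK.
Qed.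

Context (e : 'I_n -> vfield M).
Definition frame_mx m : 'M[R]_n := \matrix_b e b m.
Definition dframe_mx m v : 'M[R]_n := \matrix_b nab m v (e b).
Let T m m' : 'M[R]_n := \matrix_b chart_comp (chart_at m) m' (e b m').

Lemma frame_mxE m m' : cdom (chart_at m) m' -> frame_mx m' = T m m' *m coordf_mx m m'.
Proof.
move=> cm'; apply/row_matrixP => b; rewrite row_mul !rowK [LHS](coordf_sum _ cm').
by rewrite mulmx_sum_row; apply: eq_bigr => i _; rewrite rowK.
Qed.

(** The Leibniz rule applied to the expansion of the frame in the coordinate fields. *)
Lemma dframe_mxE m v : (forall b, smooth_vfield (e b) m) ->
  dframe_mx m v = (\matrix_b drow m v (fun m' => chart_comp (chart_at m) m' (e b m'))) +
    frame_mx m *m \matrix_i nab m v (coordf m i).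
Proof.
move=> se; apply/row_matrixP => b; rewrite linearD /= row_mul !rowK.
pose f i m' := chart_comp (chart_at m) m' (e b m') 0 i.
have sf i : smooth_fun (f i) m := se b i.
have sc i := smooth_coordf m i.
have sums := @sm_sum _ _ _ _ _ (@smooth_vfield0 _ _ M) (@smooth_vfieldD _ _ M)
  (@smooth_vfieldZ _ _ M) _ (index_enum 'I_n) f (fun i => coordf m i) m sf sc.
have -> : nab m v (e b) = nab m v (fun m' => \sum_i f i m' *: coordf m i m').
  apply: (conn_near nab_conn v (se b) sums).
  by apply: filterS (near_cdom (chart_at_dom m)) => m' cm'; apply: coordf_sum.
have -> := @conn_sum _ _ _ _ _ _ nab_conn (@smooth_vfield0 _ _ M)
  (@smooth_vfieldD _ _ M) (@smooth_vfieldZ _ _ M) _ (index_enum 'I_n) f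
  (fun i => coordf m i) m v sf sc.
rewrite big_split /=; congr (_ + _).
  by rewrite [RHS]row_sum_delta; apply: eq_bigr => i _; rewrite coordf_id mxE.
rewrite mulmx_sum_row; apply: eq_bigr => i _.
by rewrite rowK /f chart_comp_id.
Qed.


Lemma smooth_pullback_frame alpha m : (forall b, smooth_vfield (e b) m) ->
  smooth_form alpha m -> smooth_ext (fun m' => pullback (frame_mx m') (alpha m')) m.
Proof.
move=> se sa I.
pose aC m' := pullback (coordf_mx m m') (alpha m').
pose Tr b m' := chart_comp (chart_at m) m' (e b m').
apply: (@smooth_fun_near _ _ _ (fun m' => ext_eval (aC m') [seq Tr b m' | b <- enum I])).
  apply: filterS (near_cdom (chart_at_dom m)) => m' cm'.
  rewrite (frame_mxE cm') -pullback_comp pullbackE; congr ext_eval.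
  by apply: eq_map => b; rewrite rowK.
apply: smooth_ext_eval; last exact: smooth_pullback_coordf.
by move=> b i; apply: se.
Qed.

(** Let [N] be the endomorphism sending each [e b] to its derivative.  The components of
    alpha in the moving frame are its components in the coordinate frame,
    evaluated on the coordinate expressions of the [e b].  Differentiating the
    latter replaces [e b] by its derivative minus its image under the Christoffel
    symbols: the second part is absorbed in the covariant derivative of alpha,
    the first one is the derivation by [N]. *)
Lemma dext_pullback_frame alpha m v N : (forall b, smooth_vfield (e b) m) ->
  smooth_form alpha m -> frame_mx m *m N = dframe_mx m v ->
  dext m v (fun m' => pullback (frame_mx m') (alpha m')) =
  pullback (frame_mx m) (nabla_form nab alpha m v + deriv_ext N (alpha m)).
Proof.
move=> se sa EN; apply: extP => I.
pose aC m' := pullback (coordf_mx m m') (alpha m').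
pose Tr b m' := chart_comp (chart_at m) m' (e b m').
have aCm : aC m = alpha m by rewrite /aC coordf_mx_id pullback1.
rewrite dextE (@dird_near _ _ _ _
  (fun m' => ext_eval (aC m') [seq Tr b m' | b <- enum I])); last first.
  apply: filterS (near_cdom (chart_at_dom m)) => m' cm'.
  rewrite (frame_mxE cm') -pullback_comp pullbackE; congr ext_eval.
  by apply: eq_map => b; rewrite rowK.
have sT b : smooth_row (Tr b) m by move=> i; apply: se.
have saC : smooth_ext aC m := smooth_pullback_coordf sa.
rewrite (dird_ext_eval v sT saC) ?enum_uniq // nabla_formE -/aC aCm -addrA pullbackE ext_evalD.
have -> : [seq Tr i m | i <- enum I] = [seq row i (frame_mx m) | i <- enum I].
  by apply: eq_map => i; rewrite /Tr chart_comp_id rowK.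
congr (_ + _); set N0 := \matrix_i _.
have -> : - deriv_ext N0 (alpha m) + deriv_ext N (alpha m) =
    deriv_ext (N - N0) (alpha m).
  rewrite deriv_extDl addrC; congr (_ + _).
  apply/eqP; rewrite eq_sym -subr_eq0 opprK -deriv_extDl addNr.
  by rewrite /deriv_ext big1 // => i _; rewrite row0 iprod0l linear0.
rewrite (ext_eval_deriv_ext (X := fun i => drow m v (Tr i))) ?enum_uniq //.
  apply: eq_bigr => l _; congr ext_eval; apply: eq_map => i.
  by case: eqP => // _; rewrite /Tr chart_comp_id rowK.
move=> i; rewrite -row_mul mulmxBr EN dframe_mxE // addrK.
by rewrite rowK.
Qed.

End FormCalculus.

(** * The Clifford action in an orthonormal frame *)

Section SpinGeometry.
Context (R : realType) (p : nat) (M : manifold R (p + p)).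
Context (g : split_metric M) (nu : M -> ext R (p + p)).
Context (nab : tconn M) (nab_lc : levi_civita g nab).
Context (G : clifford_model R p) (Q : strong_spin_structure G g nu).
Context (S : vbundle M (2 ^ p)) (gam : forall m, ext R (p + p) -> 'End(S m)).
Context (gam_module : clifford_module g gam).
Context (B : forall m, S m -> S m -> R) (B_pairing : pairing gam B).
Context (f : sp_index Q -> 'I_(2 ^ p) -> section S).
Arguments B : clear implicits.
Context (S_associated : associated gam B f).
Context (nabS : forall m, 'rV[R]_(p + p) -> section S -> S m).
Context (nabS_lift : spin_lift gam f nab nabS).
Local Notation n := (p + p)%N.
Local Notation N := (2 ^ p)%N.
Local Notation delta := (delta_mx (0 : 'I_1)).
Local Notation etav := (\row_a Defs.eta R a : 'rV[R]_n).
Implicit Types (m : M) (v : 'rV[R]_n).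

Lemma eta2 (a : 'I_n) : Defs.eta R a * Defs.eta R a = 1.
Proof. by rewrite /Defs.eta; case: ifP => _; rewrite ?mulrNN mulr1. Qed.

Lemma etav2 (a : 'I_n) : etav 0 a * etav 0 a = 1.
Proof. by rewrite mxE eta2. Qed.

Lemma dot_mx (h A C : 'M[R]_n) i j : dot h (row i A) (row j C) = (A *m h *m C^T) i j.
Proof.
rewrite /dot -row_mul [LHS]mxE [RHS]mxE.
by apply: eq_bigr => k _; rewrite !mxE.
Qed.

Lemma orthonormal_mx (h : 'M[R]_n) (e : 'I_n -> 'rV[R]_n) : Defs.orthonormal h e ->
  (\matrix_a e a) *m h *m (\matrix_a e a)^T = diag_mx etav.
Proof.
move=> oe; apply/matrixP => a b; rewrite -dot_mx !rowK oe !mxE.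
by case: eqP => [->|_]; rewrite ?mulr1n ?mulr0n.
Qed.

Lemma gmx_unit m : g m \in unitmx.
Proof.
have [e /orthonormal_mx oe] := gmx_signature g m.
have := diag2 etav2; rewrite -{1}oe -!mulmxA => /mulmx1_unit[_].
rewrite !mulmxA !unitmx_mul => /andP[/andP[//]].
Qed.

Lemma gam_rep m : clifford_rep (g m) (gam m).
Proof.
split; [exact: gmx_sym|exact: gmx_unit| | |].
- by move=> c x y; apply: gam_linear gam_module _ _ _ _.
- exact: gam_unit gam_module _.
- by move=> x y; apply: gam_mul gam_module _ _ _.
Qed.

Variable i : sp_index Q.
Local Notation e := (sp_e i).
Local Notation dom := (sp_dom i).
Let E m : 'M[R]_n := frame_mx e m.

Lemma frame_orthonormal m : dom m -> E m *m g m *m (E m)^T = diag_mx etav.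
Proof. by move=> im; apply: orthonormal_mx; apply: sp_e_orthonormal. Qed.

Lemma frame_unit m : dom m -> E m \in unitmx.
Proof. by move=> /frame_orthonormal oE; apply: orthonormal_unit oE etav2. Qed.

Lemma near_dom m : dom m -> \near m, dom m.
Proof. by move=> im; apply: open_nbhs_nbhs; split=> //; apply: sp_open. Qed.

Lemma f_expand m (s : S m) : dom m -> exists x : 'I_N -> R, s = \sum_k x k *: f i k m.
Proof.
move=> im; have bf := as_basis S_associated im.
have sf : s \in <<[tuple f i k m | k < N]>>%VS by rewrite (span_basis bf) memvf.
exists (fun k => coord [tuple f i k m | k < N] k s).
rewrite [LHS](coord_span sf); apply: eq_bigr => k _.
by rewrite -tnth_nth tnth_mktuple.
Qed.

Lemma f_free m (x : 'I_N -> R) : dom m -> \sum_k x k *: f i k m = 0 -> forall k, x k = 0.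
Proof.
move=> im; have /basis_free/freeP fr := as_basis S_associated im.
move=> H; apply: fr; rewrite -[RHS]H; apply: eq_bigr => k _.
by rewrite -tnth_nth tnth_mktuple.
Qed.

(** [u] lists the components in the coframe dual to the orthonormal frame. *)
Lemma gam_flat m (u : 'rV[R]_n) l : dom m ->
  gam m (covec (u *m (invmx (E m))^T)) (f i l m) =
  \sum_k (\sum_a (u 0 a * Defs.eta R a) *: G a) k l *: f i k m.
Proof.
move=> im.
have -> : u *m (invmx (E m))^T = \sum_a (u 0 a * Defs.eta R a) *: flat g m (e a m).
  rewrite -(frame_dual (frame_orthonormal im) etav2) -!mulmxA mulmxA mulmx_sum_row.
  apply: eq_bigr => a _; rewrite row_mul rowK; congr (_ *: _).
  by rewrite mul_mx_diag !mxE.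
rewrite linear_sum /= (gam_sum (gam_rep m)).
transitivity (\sum_a \sum_k (u 0 a * Defs.eta R a * G a k l) *: f i k m).
  apply: eq_bigr => a _; rewrite covecZ (gamZ (gam_rep m)) (as_gam S_associated) //.
  by rewrite scaler_sumr; apply: eq_bigr => k _; rewrite scalerA.
rewrite exchange_big; apply: eq_bigr => k _; rewrite -scaler_suml; congr (_ *: _).
by rewrite summxE; apply: eq_bigr => a _; rewrite mxE.
Qed.

(** The matrix [C] does not depend on [m].  Both the Clifford product in orthonormal
    components and the action of covectors on the spinor frame are the same at
    all points, so this propagates along Clifford products. *)
Lemma gam_matrix (b : ext R n) : exists C : 'M[R]_N, forall m l, dom m ->
  gam m (pullback (invmx (E m)) b) (f i l m) = \sum_k C k l *: f i k m.
Proof.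
elim/(clifford_ind (gi := diag_mx etav)): b => [c a b [C HC] [C' HC']||u b [C HC]].
- exists (c *: C + C') => m l im; rewrite linearP /= (gam_lin (gam_rep m)) HC // HC' //.
  rewrite scaler_sumr -big_split /=; apply: eq_bigr => k _.
  by rewrite !mxE scalerDl scalerA.
- exists 1%:M => m l im; rewrite pullback_ext1 (gam_one (gam_rep m)).
  rewrite (bigD1 l) //= big1 ?addr0 => [|k kl]; first by rewrite mxE eqxx scale1r.
  by rewrite mxE (negbTE kl) scale0r.
exists ((\sum_a (u 0 a * Defs.eta R a) *: G a) *m C) => m l im.
rewrite (pullback_clifford (gam_rep m) (frame_orthonormal im) etav2).
rewrite (gam_covec (gam_rep m)) HC // linear_sum /=.
transitivity (\sum_j \sum_k (C j l * (\sum_a (u 0 a * Defs.eta R a) *: G a) k j) *: f i k m).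
  apply: eq_bigr => j _; rewrite linearZ /= gam_flat // scaler_sumr.
  by apply: eq_bigr => k _; rewrite scalerA.
rewrite exchange_big; apply: eq_bigr => k _; rewrite -scaler_suml; congr (_ *: _).
by rewrite mxE; apply: eq_bigr => j _; rewrite mulrC.
Qed.

Lemma gam_components : exists C : {set 'I_n} -> 'M[R]_N, forall m a l, dom m ->
  gam m a (f i l m) =
  \sum_k (\sum_I pullback (E m) a I * C I k l) *: f i k m.
Proof.
pose C I := sval (cid (gam_matrix (blade R I))).
exists C => m a l im.
have Eu := frame_unit im.
rewrite -[in LHS](pullback1 a) -(mulVmx Eu) -pullback_comp.
rewrite [in LHS](blade_sum (pullback (E m) a)) linear_sum /= (gam_sum (gam_rep m)).
transitivity (\sum_I \sum_k (pullback (E m) a I * C I k l) *: f i k m).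
  apply: eq_bigr => I _; rewrite linearZ /= (gamZ (gam_rep m)).
  rewrite (svalP (cid (gam_matrix (blade R I))) m l im) scaler_sumr.
  by apply: eq_bigr => k _; rewrite scalerA.
by rewrite exchange_big; apply: eq_bigr => k _; rewrite -scaler_suml.
Qed.

(** * The lifted connection and the Clifford action *)

(** The endomorphism that sends each vector of the frame to its covariant derivative. *)
Definition spin_endo m v : 'M[R]_n := invmx (E m) *m dframe_mx nab e m v.

Definition spin_form m v : ext R n :=
  2^-1 *: \sum_a \sum_b
     dot (g m) (e a m) (nab m v (e b)) *:
       wedge (covec (Defs.eta R a *: flat g m (e a m)))
             (covec (Defs.eta R b *: flat g m (e b m))).

Definition spin_op m v : 'End(S m) := 2^-1 *: gam m (spin_form m v).

Lemma nabS_frame m v k : dom m -> nabS m v (f i k) = spin_op m v (f i k m).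
Proof.
by move=> im; rewrite (lift_frame nabS_lift) // /spin_op scale_lfunE.
Qed.

Lemma dotC m (x y : 'rV[R]_n) : dot (g m) x y = dot (g m) y x.
Proof.
rewrite /dot.
have -> : x *m g m *m y^T = (y *m g m *m x^T)^T.
  by rewrite !trmx_mul trmxK gmx_sym mulmxA.
by rewrite mxE.
Qed.

(** The scalar products of the frame are constant and the connection is metric. *)
Lemma spin_form_skew m v a b : dom m ->
  dot (g m) (e a m) (nab m v (e b)) = - dot (g m) (e b m) (nab m v (e a)).
Proof.
move=> im; have sa c := sp_e_smooth c im.
have := lc_metric nab_lc v (sa a) (sa b).
rewrite (@dird_near _ _ _ _ (fun=> if a == b then Defs.eta R a else 0)).
  by rewrite dird_cst dotC => /esym/eqP; rewrite addr_eq0 => /eqP ->; rewrite opprK.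
by apply: filterS (near_dom im) => m' im'; apply: (sp_e_orthonormal im').
Qed.

Lemma spin_endo_frame m v : dom m -> E m *m spin_endo m v = dframe_mx nab e m v.
Proof. by move=> im; rewrite mulKVmx // frame_unit. Qed.

Lemma spin_endo_skew m v : dom m ->
  spin_endo m v *m g m = - (g m *m (spin_endo m v)^T).
Proof.
move=> im; have Eu := frame_unit im; set X := spin_endo m v.
have H : E m *m X *m g m *m (E m)^T = - (E m *m g m *m X^T *m (E m)^T).
  rewrite -[_ *m X^T *m _]mulmxA -trmx_mul spin_endo_frame //.
  apply/matrixP => a b; rewrite [RHS]mxE -!dot_mx !rowK dotC.
  exact: spin_form_skew.
have Etu : (E m)^T \in unitmx by rewrite unitmx_tr.
apply: (can_inj (mulKmx Eu)); apply: (can_inj (mulmxK Etu)).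
by clearbody X; rewrite mulmxN mulNmx !mulmxA.
Qed.

(** Both sides are derivations, and on covectors the spin connection form acts by minus
    the transpose of the endomorphism that it represents. *)
Lemma spin_op_comm m v a s : dom m ->
  spin_op m v (gam m a s) =
  gam m a (spin_op m v s) - gam m (deriv_ext (spin_endo m v) a) s.
Proof.
move=> im; have Eu := frame_unit im.
apply: (commutator_deriv (gam_rep m)); first exact: spin_endo_skew.
move=> phi t; rewrite /spin_op !scale_lfunE.
rewrite (@two_form_comm _ _ _ _ _ (gam_rep m) _
  (fun a b => dot (g m) (e a m) (nab m v (e b)))
  (fun a => Defs.eta R a *: flat g m (e a m))
  (fun a b => spin_form_skew v a b im)).
congr (_ + _); rewrite -(gamN (gam_rep m)) -linearN /=; congr (gam m (covec _) t).
pose TH := diag_mx etav *m E m *m g m.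
have thE a' : row a' TH = Defs.eta R a' *: flat g m (e a' m).
  by rewrite /TH -mulmxA row_mul row_diag_mx -scalemxAl -rowE row_mul rowK mxE.
pose w := E m *m g m *m (dframe_mx nab e m v)^T.
have wE a' b' : w a' b' = dot (g m) (e a' m) (nab m v (e b')).
  by rewrite /w -dot_mx !rowK.
transitivity (\sum_a' \sum_b' (w a' b' * coprod (g m) (row b' TH) phi) *: row a' TH).
  by apply: eq_bigr => a' _; apply: eq_bigr => b' _; rewrite !thE wE.
rewrite (two_form_mx (gam_rep m)) /w -(spin_endo_frame v im).
have oE := frame_orthonormal im.
have skew := spin_endo_skew v im; move: skew; move: (spin_endo m v) => X skew.
have -> : TH^T = invmx (E m) by rewrite /TH (frame_dual oE etav2) trmxK.
rewrite !trmx_mul !trmxK gmx_sym /TH.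
transitivity (phi *m invmx (g m) *m (X *m g m) *m
    ((E m)^T *m diag_mx etav *m E m) *m g m).
  by rewrite !mulmxA mulmxKV.
rewrite -(orthonormal_inv (gam_rep m) oE etav2) mulmxKV ?gmx_unit // skew.
by rewrite mulmxN mulmxA mulmxKV ?gmx_unit.
Qed.

Lemma smooth_section_sum (I : Type) (r : seq I) (x : I -> M -> R)
    (s : I -> section S) m : (forall k, smooth_fun (x k) m) ->
  (forall k, smooth_section (s k) m) ->
  smooth_section (fun m' => \sum_(k <- r) x k m' *: s k m') m.
Proof.
move=> sx ss j.
rewrite (_ : (fun _ => _) = fun m' => \sum_(k <- r)
    x k m' * coord [tuple vframe S m l m' | l < N] j (s k m')).
  by apply: smooth_fun_sum => k _; apply: smooth_funM => //; apply: ss.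
by apply/funext => m'; rewrite linear_sum; apply: eq_bigr => k _; rewrite linearZ.
Qed.

Lemma nabS_sum (I : Type) (r : seq I) (x : I -> M -> R) (s : I -> section S) m v :
  (forall k, smooth_fun (x k) m) -> (forall k, smooth_section (s k) m) ->
  nabS m v (fun m' => \sum_(k <- r) x k m' *: s k m') =
  \sum_(k <- r) (dird m v (x k) *: s k m + x k m *: nabS m v (s k)).
Proof.
move=> sx ss.
apply: (@conn_sum R n M (fun m => S m) _ _ (lift_connection nabS_lift)) => //.
- move=> m' j; rewrite (_ : (fun _ => _) = fun=> 0); first exact: smooth_fun_cst.
  by apply/funext => x'; rewrite linear0.
- move=> s1 s2 m' ss1 ss2 j.
  rewrite (_ : (fun _ => _) = fun x => coord [tuple vframe S m' l x | l < N] j (s1 x)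
     + coord [tuple vframe S m' l x | l < N] j (s2 x)).
    by apply: smooth_funD; [apply: ss1|apply: ss2].
  by apply/funext => x'; rewrite linearD.
move=> h s1 m' sh ss1 j.
rewrite (_ : (fun _ => _) = fun x => h x * coord [tuple vframe S m' l x | l < N] j (s1 x)).
  by apply: smooth_funM => //; apply: ss1.
by apply/funext => x'; rewrite linearZ.
Qed.

Lemma nabS_near m v (s t : section S) : smooth_section s m -> smooth_section t m ->
  (\near m, s m = t m) -> nabS m v s = nabS m v t.
Proof. exact: (conn_near (lift_connection nabS_lift)). Qed.

(** The coefficients of alpha . f_l in the spinor frame are constant linear functions of
    the components of alpha in the orthonormal frame.  Their derivative is the
    action of nabla alpha plus that of a derivation of alpha
    ([dext_pullback_frame]), and the commutator of alpha with the spin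
    connection cancels the latter. *)
Lemma nabS_gam_frame (alpha : M -> ext R n) m v l : dom m -> smooth_form alpha m ->
  nabS m v (fun m' => gam m' (alpha m') (f i l m') : S m') =
  gam m (nabla_form nab alpha m v) (f i l m) + gam m (alpha m) (nabS m v (f i l)).
Proof.
move=> im sa; have [C HC] := gam_components.
have se c := sp_e_smooth c im; have sf k := as_smooth S_associated k im.
pose aE m' := pullback (E m') (alpha m').
pose x k m' := \sum_I aE m' I * C I k l.
have saE : smooth_ext aE m by apply: smooth_pullback_frame.
have sx k : smooth_fun (x k) m.
  by apply: smooth_fun_sum => I _; apply: smooth_funM => //; apply: smooth_fun_cst.
have dx k : dird m v (x k) = \sum_I dext m v aE I * C I k l.
  rewrite dird_sum => [|I _]; last by apply: smooth_funM => //; apply: smooth_fun_cst.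
  apply: eq_bigr => I _; rewrite dirdM //; last exact: smooth_fun_cst.
  by rewrite dird_cst mulr0 addr0 dextE.
rewrite (@nabS_near _ _ _ (fun m' => \sum_k x k m' *: f i k m')); first last.
- by apply: filterS (near_dom im) => m' im'; rewrite HC.
- exact: smooth_section_sum.
- exact: (gam_smooth gam_module).
rewrite nabS_sum // big_split /= nabS_frame //.
have -> : \sum_k x k m *: nabS m v (f i k) = spin_op m v (gam m (alpha m) (f i l m)).
  rewrite HC // linear_sum; apply: eq_bigr => k _.
  by rewrite linearZ nabS_frame.
have DE := dext_pullback_frame (proj1 (conj (lc_connection nab_lc) I)) se sa
  (spin_endo_frame v im).
under eq_bigr => k _ do rewrite dx DE.
rewrite -HC // spin_op_comm // (gamD (gam_rep m)) -addrA; congr (_ + _).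
by rewrite addrC subrK.
Qed.

(** * The pairing and the derivative of the signed square *)

Let BDl m k (s t u : S m) : B m (k *: s + t) u = k * B m s u + B m t u.
Proof. exact: (pair_linearl B_pairing). Qed.
Let BDr m k (s t u : S m) : B m u (k *: s + t) = k * B m u s + B m u t.
Proof. exact: (pair_linearr B_pairing). Qed.

Lemma pairing_nondeg m (s : S m) : s != 0 -> exists t, B m t s != 0.
Proof.
move=> s0; apply: contrapT => H; case/eqP: s0.
apply: (pair_nondegenerate B_pairing) => t; apply: contrapT => st; apply: H.
exists t; apply/eqP => ts; apply: st.
by have [->|->] := pair_symmetry B_pairing; rewrite ts ?oppr0.
Qed.

Lemma reversion_covec (theta : 'rV[R]_n) : reversion (covec theta) = covec theta.
Proof.
apply: extP => I; rewrite ffunE; have [I1|I1] := eqVneq #|I| 1%N.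
  by rewrite I1 mul1r.
suff -> : covec theta I = 0 by rewrite mulr0.
rewrite /covec ext_sumE big1 // => j _; rewrite extZE ffunE.
by case: eqP => [E0|_]; rewrite ?mulr0 //; rewrite E0 cards1 in I1.
Qed.

Lemma pairing_adj m theta s t :
  B m (gam m (covec theta) s) t = B m s (gam m (covec theta) t).
Proof. by rewrite (pair_adjoint B_pairing) reversion_covec. Qed.

Lemma spin_op_adj m v s t : dom m -> B m (spin_op m v s) t = - B m s (spin_op m v t).
Proof.
move=> im; rewrite /spin_op !scale_lfunE (pairZl (@BDl m)) (pairZr (@BDr m)).
rewrite -mulrN; congr (_ * _).
apply: (two_form_skew_adjoint (gam_rep m) (@BDl m) (@BDr m)); first exact: pairing_adj.
by move=> a b; apply: spin_form_skew.
Qed.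

Lemma pairing_matrix m0 : dom m0 -> exists B0 : 'M[R]_N, B0 \in unitmx /\
  forall m, dom m -> forall k l, B m (f i k m) (f i l m) = B0 k l.
Proof.
move=> im0; have [B0 HB0] := as_pairing S_associated; exists B0; split; last first.
  by move=> m im k l; apply: HB0.
rewrite -row_free_unit; apply: inj_row_free => r r0.
have s0 : \sum_k r 0 k *: f i k m0 = 0.
  apply: (pair_nondegenerate B_pairing) => t; have [x ->] := f_expand t im0.
  rewrite (pair_sumr (@BDr m0)) big1 // => l _; rewrite (pairZr (@BDr m0)).
  rewrite (pair_suml (@BDl m0)).
  have := congr1 (fun y : 'rV[R]_N => y 0 l) r0; rewrite !mxE => rl.
  rewrite (_ : \sum_k _ = 0) ?mulr0 // -[RHS]rl; apply: eq_bigr => k _.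
  by rewrite (pairZl (@BDl m0)) HB0.
by apply/rowP => k; rewrite mxE; apply: (f_free im0 s0).
Qed.

(** The components are found by pairing with the frame, whose Gram matrix for [B] is
    constant and invertible; they are smooth because [B] is. *)
Lemma section_expand (xi : section S) m0 : dom m0 -> (forall m, smooth_section xi m) ->
  exists x : 'I_N -> M -> R, forall m, dom m ->
    (forall k, smooth_fun (x k) m) /\ xi m = \sum_k x k m *: f i k m.
Proof.
move=> im0 sxi; have [B0 [B0u HB0]] := pairing_matrix im0.
exists (fun k m => \sum_l invmx B0 k l * B m (f i l m) (xi m)) => m im; split.
  move=> k; apply: smooth_fun_sum => l _; apply: smooth_funZ.
  by apply: (pair_smooth B_pairing) => //; apply: (as_smooth S_associated).
have [y yE] := f_expand (xi m) im; rewrite {1}yE; apply: eq_bigr => k _; congr (_ *: _).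
have H l : B m (f i l m) (xi m) = (B0 *m \col_j y j) l 0.
  rewrite yE (pair_sumr (@BDr m)) mxE; apply: eq_bigr => j _.
  by rewrite (pairZr (@BDr m)) HB0 // mxE mulrC.
transitivity ((invmx B0 *m (B0 *m \col_j y j)) k 0); first by rewrite mulKmx // mxE.
by rewrite mxE; apply: eq_bigr => l _; rewrite H.
Qed.

Context (xi : section S) (xi_smooth : forall m, smooth_section xi m).

Lemma nabS_gam (alpha : M -> ext R n) m v : dom m -> (forall m, smooth_form alpha m) ->
  nabS m v (fun m' => gam m' (alpha m') (xi m') : S m') =
  gam m (nabla_form nab alpha m v) (xi m) + gam m (alpha m) (nabS m v xi).
Proof.
move=> im sa; have [x Hx] := section_expand im xi_smooth.
have [sx xiE] := Hx m im; have sf k := as_smooth S_associated k im.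
have near_xi : \near m, xi m = \sum_k x k m *: f i k m.
  by apply: filterS (near_dom im) => m' /Hx[].
have sg k : smooth_section (fun m' => gam m' (alpha m') (f i k m') : S m') m.
  exact: (gam_smooth gam_module).
rewrite (@nabS_near _ _ _ (fun m' => \sum_k x k m' *: (gam m' (alpha m') (f i k m') : S m'))).
- rewrite (@nabS_sum _ _ x (fun k m' => gam m' (alpha m') (f i k m'))) //.
  rewrite (nabS_near v (xi_smooth m) (smooth_section_sum _ sx sf) near_xi).
  rewrite nabS_sum // xiE !linear_sum -big_split; apply: eq_bigr => k _ /=.
  rewrite nabS_gam_frame // scalerDr linearD !linearZ /=.
  by rewrite addrCA.
- exact: (gam_smooth gam_module).
- exact: smooth_section_sum.
by apply: filterS near_xi => m' ->; rewrite linear_sum; apply: eq_bigr => k _; rewrite linearZ.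
Qed.

(** The pairing is constant in the spinor frame and the spin connection is skew for it. *)
Lemma dird_pairing m v l : dom m ->
  dird m v (fun m' => B m' (f i l m') (xi m')) =
  B m (nabS m v (f i l)) (xi m) + B m (f i l m) (nabS m v xi).
Proof.
move=> im; have [x Hx] := section_expand im xi_smooth.
have [B0 [B0u HB0]] := pairing_matrix im.
have [sx xiE] := Hx m im; have sf k := as_smooth S_associated k im.
have near_xi : \near m, xi m = \sum_k x k m *: f i k m.
  by apply: filterS (near_dom im) => m' /Hx[].
rewrite (nabS_near v (xi_smooth m) (smooth_section_sum _ sx sf) near_xi) nabS_sum //.
rewrite (@dird_near _ _ _ _ (fun m' => \sum_k x k m' * B0 l k)); last first.
  apply: filterS (near_dom im) => m' im'; have [_ ->] := Hx m' im'.
  by rewrite (pair_sumr (@BDr m')); apply: eq_bigr => k _; rewrite (pairZr (@BDr m')) HB0.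
rewrite dird_sum => [|k _]; last by apply: smooth_funM => //; apply: smooth_fun_cst.
rewrite (pair_sumr (@BDr m)) nabS_frame // spin_op_adj // xiE linear_sum.
rewrite (pair_sumr (@BDr m)) -sumrN -big_split; apply: eq_bigr => k _ /=.
rewrite dirdM //; last exact: smooth_fun_cst.
rewrite dird_cst mulr0 addr0 (pairDr (@BDr m)) !(pairZr (@BDr m)) HB0 //.
by rewrite linearZ (pairZr (@BDr m)) nabS_frame // addrCA addNr addr0.
Qed.

Context (alpha : M -> ext R n) (alpha_smooth : forall m, smooth_form alpha m).
Context (kappa : R) (alphaE : forall m s, gam m (alpha m) s = (kappa * B m s (xi m)) *: xi m).

Lemma gam_nabla_square m v s : dom m ->
  gam m (nabla_form nab alpha m v) s =
  kappa *: (B m s (nabS m v xi) *: xi m + B m s (xi m) *: nabS m v xi).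
Proof.
move=> im; have sf k := as_smooth S_associated k im.
have H l : gam m (nabla_form nab alpha m v) (f i l m) =
  kappa *: (B m (f i l m) (nabS m v xi) *: xi m + B m (f i l m) (xi m) *: nabS m v xi).
  have sB : smooth_fun (fun m' => B m' (f i l m') (xi m')) m.
    exact: (pair_smooth B_pairing).
  have := nabS_gam_frame v l im (alpha_smooth m).
  rewrite (_ : (fun m' => _) =
    fun m' => (kappa * B m' (f i l m') (xi m')) *: xi m'); last first.
    by apply: functional_extensionality_dep => m'; rewrite alphaE.
  rewrite (conn_leibniz (lift_connection nabS_lift)) //; last exact: smooth_funZ.
  rewrite dirdZ // dird_pairing // alphaE => /esym/(canRL (addrK _)) ->.
  by rewrite mulrDr scalerDl -[X in X - _]addrA [LHS]addrC addKr scalerDr !scalerA.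
have [x ->] := f_expand s im.
rewrite linear_sum (pair_suml (@BDl m)) (pair_suml (@BDl m)) !scaler_suml -big_split /=.
rewrite scaler_sumr; apply: eq_bigr => k _; rewrite linearZ /= H !(pairZl (@BDl m)).
by rewrite -!scalerA -scalerDr !scalerA mulrC.
Qed.

(** * Contorsion *)

Context (A : M -> 'rV[R]_n -> 'rV[R]_n -> 'rV[R]_n) (A_cont : contorsion g A).

Definition cont_mx m v : 'M[R]_n := \matrix_j A m v (delta j).

Lemma cont_mxE m v y : A m v y = y *m cont_mx m v.
Proof.
have A0 : A m v 0 = 0.
  have := cont_linearr A_cont m v (-1) 0 0.
  by rewrite scaler0 addr0 scaleN1r addNr.
have AD x z : A m v (x + z) = A m v x + A m v z.
  by have := cont_linearr A_cont m v 1 x z; rewrite !scale1r.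
have AZ c x : A m v (c *: x) = c *: A m v x.
  by have := cont_linearr A_cont m v c x 0; rewrite A0 !addr0.
rewrite mulmx_sum_row {1}[y]row_sum_delta.
transitivity (\sum_j A m v (y 0 j *: delta j)).
  by apply: (big_rec2 (fun x z => A m v x = z)) => // j x z _ <-.
by apply: eq_bigr => j _; rewrite AZ rowK.
Qed.

Lemma cont_mx_skew m v : cont_mx m v *m g m = - (g m *m (cont_mx m v)^T).
Proof.
apply/matrixP => a b.
have dl (X Y : 'M[R]_n) : dot (g m) (delta a *m X) (delta b *m Y) = (X *m g m *m Y^T) a b.
  by rewrite -!rowE dot_mx.
have := cont_skew A_cont m v (delta a) (delta b); rewrite !cont_mxE.
rewrite -[delta b in LHS]mulmx1 -[delta a in RHS]mulmx1 !dl trmx1 mulmx1 mul1mx => ->.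
by rewrite [RHS]mxE.
Qed.

Lemma cont_formE m v :
  cont_form g A m v = twoform (fun a b => (g m *m (cont_mx m v)^T) a b).
Proof.
rewrite /cont_form; congr twoform; apply/funext => a; apply/funext => b.
by rewrite cont_mxE -[delta a]mulmx1 -!rowE dot_mx mul1mx.
Qed.

Lemma cont_triangle1 m v a :
  triangle1 (ginv g m) (cont_form g A m v) a = deriv_ext (cont_mx m v) a.
Proof.
rewrite cont_formE; apply: triangle1_twoform => //; first exact: gmx_sym.
- exact: gmx_unit.
- exact: cont_mx_skew.
Qed.

Definition cont_op m v : 'End(S m) := 2^-1 *: gam m (cont_form g A m v).

Lemma cont_w_skew m v a b : (g m *m (cont_mx m v)^T) a b = - (g m *m (cont_mx m v)^T) b a.
Proof.
have wT : (g m *m (cont_mx m v)^T)^T = - (g m *m (cont_mx m v)^T).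
  by rewrite trmx_mul trmxK gmx_sym cont_mx_skew.
by have := congr1 (fun X : 'M[R]_n => X b a) wT; rewrite [LHS]mxE [RHS]mxE.
Qed.

Lemma cont_op_comm m v a s :
  cont_op m v (gam m a s) =
  gam m a (cont_op m v s) - gam m (deriv_ext (cont_mx m v) a) s.
Proof.
apply: (commutator_deriv (gam_rep m)); first exact: cont_mx_skew.
move=> phi t; rewrite /cont_op !scale_lfunE cont_formE.
rewrite (@two_form_comm _ _ _ _ _ (gam_rep m) _ _ _ (cont_w_skew m v)).
congr (_ + _); rewrite -(gamN (gam_rep m)) -linearN /=; congr (gam m (covec _) t).
transitivity (\sum_a \sum_b ((g m *m (cont_mx m v)^T) a b *
    coprod (g m) (row b 1%:M) phi) *: row a (1%:M : 'M[R]_n)).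
  by apply: eq_bigr => b _; apply: eq_bigr => c _; rewrite !row1.
rewrite (two_form_mx (gam_rep m)) trmx1 !mulmx1 trmx_mul trmxK gmx_sym cont_mx_skew.
by rewrite mulmxN mulmxA mulmxKV ?gmx_unit.
Qed.

Lemma cont_op_adj m v s t : B m (cont_op m v s) t = - B m s (cont_op m v t).
Proof.
rewrite /cont_op !scale_lfunE cont_formE (pairZl (@BDl m)) (pairZr (@BDr m)).
rewrite -mulrN; congr (_ * _).
apply: (two_form_skew_adjoint (gam_rep m) (@BDl m) (@BDr m)); first exact: pairing_adj.
exact: cont_w_skew.
Qed.

Lemma lift_contorsionE m v :
  lift_contorsion g gam nabS A m v xi = nabS m v xi + cont_op m v (xi m).
Proof. by rewrite /cont_op scale_lfunE. Qed.

(** The contorsion part satisfies the same identity as [gam_nabla_square], because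
    [cont_op] is skew for the pairing and its commutator with alpha is a
    derivation of alpha. *)
Lemma gam_nabla_contorsion m v s : dom m ->
  let eta := lift_contorsion g gam nabS A m v xi in
  gam m (nabla_form nab alpha m v -
         triangle1 (ginv g m) (cont_form g A m v) (alpha m)) s =
  kappa *: (B m s eta *: xi m + B m s (xi m) *: eta).
Proof.
move=> im /=; rewrite lift_contorsionE cont_triangle1 (gamB (gam_rep m)).
rewrite gam_nabla_square //.
have -> : gam m (deriv_ext (cont_mx m v) (alpha m)) s =
   - (kappa *: (B m s (cont_op m v (xi m)) *: xi m + B m s (xi m) *: cont_op m v (xi m))).
  have -> : gam m (deriv_ext (cont_mx m v) (alpha m)) s =
      gam m (alpha m) (cont_op m v s) - cont_op m v (gam m (alpha m) s).
    by rewrite cont_op_comm opprB addrC subrK.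
  rewrite !alphaE linearZ /= cont_op_adj scalerDr !scalerA opprD mulrN scaleNr //.
rewrite opprK -scalerDr; congr (_ *: _).
by rewrite (pairDr (@BDr m)) scalerDl scalerDr addrACA.
Qed.

Context (nu_vol : volume_form g nu) (mu : R) (mu_neq0 : mu != 0).
Hypothesis nu_xi : forall m, gam m (nu m) (xi m) = mu *: xi m.
Hypothesis xi_neq0 : forall m, xi m != 0.
Hypothesis kappa_neq0 : kappa != 0.
Hypothesis alpha_hom : forall m, homogeneous p (alpha m).

Lemma gam_faithful m a : dom m -> (forall s, gam m a s = 0) -> a = 0.
Proof.
move=> im; apply: (gam_inj (gam_rep m) (frame_orthonormal im) etav2).
  by rewrite addnn odd_double.
by exists (xi m); apply: xi_neq0.
Qed.

Lemma parallel_spinor_square m v : dom m ->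
  lift_contorsion g gam nabS A m v xi = 0 <->
  nabla_form nab alpha m v =
    triangle1 (ginv g m) (cont_form g A m v) (alpha m).
Proof.
move=> im; have key s := gam_nabla_contorsion v s im; rewrite /= in key.
split=> [eta0|E0].
  apply/eqP; rewrite -subr_eq0; apply/eqP/(gam_faithful im) => s.
  by rewrite key eta0 (pair0r (@BDr m)) scale0r scaler0 addr0 scaler0.
apply: (rank_two_eq0 (@BDr m) (@pairing_nondeg m) (xi_neq0 m)) => s.
have := key s; rewrite E0 subrr -[0 in X in X -> _](scale0r 0) (gamZ (gam_rep m)) scale0r.
by move/esym/eqP; rewrite scaler_eq0 (negbTE kappa_neq0) => /eqP.
Qed.

Lemma annihilatorE m theta : dom m ->
  annihilator alpha m theta <-> gam m (covec theta) (xi m) = 0.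
Proof.
move=> im; apply: (@signed_square_annihilator _ _ _ _ _ (gam_rep m) _ (B m)
  (@pairing_nondeg m) p kappa (nu m) mu) => //.
- by move=> a; apply: gam_faithful.
- by rewrite addnn odd_double.
- exact: (proj1 (vol_form nu_vol m)).
- exact: xi_neq0.
Qed.

(** Both are the derivative of components in the coordinate frame, corrected by the
    Christoffel symbols. *)
Lemma covec_form theta m v : nabla_form nab (fun m' => covec (theta m')) m v =
  covec (nabla_covector nab theta m v).
Proof.
rewrite nabla_formE covec_deriv_ext.
have -> : (fun m' => pullback (coordf_mx m m') (covec (theta m'))) =
    (fun m' => covec (theta m' *m (coordf_mx m m')^T)).
  by apply/funext => m'; rewrite -!ewedge_ext1 pullback_ewedge pullback_ext1.
pose X m' := theta m' *m (coordf_mx m m')^T.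
have -> : dext m v (fun m' => covec (X m')) = covec (drow m v X).
  have covecE (y : 'rV[R]_n) I : covec y I = \sum_j y 0 j * (I == [set j]%SET)%:R.
    by rewrite /covec ext_sumE; apply: eq_bigr => j _; rewrite extZE ffunE.
  apply: extP => I; rewrite dextE covecE.
  have [[j ->]|nI] := pselect (exists j, I = [set j]%SET); last first.
    have nj j : (I == [set j]%SET) = false by apply/eqP => Ij; apply: nI; exists j.
    rewrite big1 => [|j _]; last by rewrite nj mulr0.
    rewrite (_ : (fun _ => _) = fun=> 0) ?dird_cst //; apply/funext => m'.
    by rewrite covecE big1 // => j _; rewrite nj mulr0.
  have cE (y : 'rV[R]_n) : \sum_k y 0 k * ([set j]%SET == [set k]%SET)%:R = y 0 j.
    rewrite (bigD1 j) //= eqxx mulr1 big1 ?addr0 // => k kj.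
    by rewrite (inj_eq finset.set1_inj) eq_sym (negbTE kj) mulr0.
  rewrite cE mxE; congr (dird m v); apply/funext => m'.
  by rewrite covecE cE.
rewrite -linearB /=; congr covec; apply/rowP => j; rewrite !mxE; congr (_ - _).
  by congr (dird m v); apply/funext => m'; rewrite /X mxE; apply: eq_bigr => k _; rewrite !mxE.
by apply: eq_bigr => k _; rewrite !mxE.
Qed.

Lemma nabla_covector_contorsion theta m v :
  nabla_covector (add_contorsion nab A) theta m v =
  nabla_covector nab theta m v - theta m *m (cont_mx m v)^T.
Proof.
apply/rowP => j; rewrite !mxE -addrA -opprD; congr (_ - _).
rewrite -big_split; apply: eq_bigr => k _ /=.
by rewrite /add_contorsion coordf_id !mxE mulrDr.
Qed.

(** Differentiate theta . xi = 0.  The derivative of xi is minus half the action of A,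
    and commuting this past theta turns the Levi-Civita derivative of theta into
    the derivative with contorsion. *)
Lemma parallel_preserved theta m v : dom m ->
  (forall m, smooth_covector theta m) -> (forall m, gam m (covec (theta m)) (xi m) = 0) ->
  lift_contorsion g gam nabS A m v xi = 0 ->
  gam m (covec (nabla_covector (add_contorsion nab A) theta m v)) (xi m) = 0.
Proof.
move=> im st theta_xi; rewrite lift_contorsionE => eta0.
have nabxi : nabS m v xi = - cont_op m v (xi m) by apply/eqP; rewrite -addr_eq0 eta0.
have := nabS_gam v im st; rewrite covec_form.
rewrite (_ : (fun m' => _) = fun m' => (0 : R) *: xi m'); last first.
  by apply: functional_extensionality_dep => m'; rewrite theta_xi scale0r.
rewrite (conn_leibniz (lift_connection nabS_lift)) //; last exact: smooth_fun_cst.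
rewrite dird_cst !scale0r addr0 nabxi linearN /= => H1.
have H2 := cont_op_comm v (covec (theta m)) (xi m).
rewrite theta_xi linear0 covec_deriv_ext in H2.
rewrite nabla_covector_contorsion linearB /= (gamB (gam_rep m)).
by move/esym/eqP: H1; rewrite subr_eq0 => /eqP->; rewrite -H2.
Qed.

(** * A local frame of the annihilator bundle *)

Lemma smooth_frame_covector (x : 'I_n -> M -> R) m : dom m ->
  (forall a, smooth_fun (x a) m) ->
  smooth_covector (fun m' => \sum_a x a m' *: flat g m' (e a m')) m.
Proof.
move=> im sx I.
have [[j ->]|nI] := pselect (exists j, I = [set j]%SET); last first.
  rewrite (_ : (fun _ => _) = fun=> 0); first exact: smooth_fun_cst.
  apply/funext => m'.
  rewrite -(pullback_coordfE (fun m' => covec (\sum_a x a m' *: flat g m' (e a m')))).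
  rewrite -ewedge_ext1 pullback_ewedge.
  rewrite pullback_ext1 ewedge_ext1 /covec ext_sumE big1 // => j _.
  by rewrite extZE ffunE; case: eqP => [Ij|_]; [case: nI; exists j|rewrite mulr0].
rewrite (_ : (fun _ => _) = fun m' =>
   \sum_a x a m' * dot (g m') (e a m') (coordf m j m')).
  apply: smooth_fun_sum => a _; apply: smooth_funM => //.
  by apply: gmx_smooth; [apply: sp_e_smooth|apply: smooth_coordf].
apply/funext => m'; rewrite enum_set1 /= /ext_eval /= iprod_covec extZE ffunE eqxx.
rewrite mulr1 mulmx_suml summxE; apply: eq_bigr => a _.
by rewrite -scalemxAl mxE.
Qed.

Lemma flat_sum m (u : 'rV[R]_n) : \sum_a u 0 a *: flat g m (e a m) = u *m E m *m g m.
Proof.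
rewrite -mulmxA mulmx_sum_row; apply: eq_bigr => a _.
by rewrite row_mul rowK.
Qed.

(** A covector annihilating a nonzero spinor is isotropic, since its square acts by its
    norm, and the metric is positive definite on the first half of the frame. *)
Lemma positive_annihilator m (r : 'rV[R]_p) s : dom m -> s != 0 ->
  gam m (covec ((row_mx r 0 : 'rV[R]_n) *m E m *m g m)) s = 0 -> r = 0.
Proof.
move=> im s0; set u : 'rV[R]_n := row_mx r 0; set th := u *m _ *m _ => H.
have := gam_anticomm (gam_rep m) th th s; rewrite H linear0 subr0 => /esym/eqP.
rewrite scaler_eq0 (negbTE s0) orbF mulf_eq0 pnatr_eq0 /= => /eqP.
have -> : coprod (g m) th th = (u *m diag_mx etav *m u^T) 0 0.
  rewrite -(frame_orthonormal im) /coprod /th mulmxK ?gmx_unit //.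
  by rewrite !trmx_mul gmx_sym !mulmxA.
have -> : (u *m diag_mx etav *m u^T) 0 0 = \sum_k r 0 k ^+ 2.
  rewrite mxE big_split_ord /= [X in _ + X]big1 ?addr0 => [|k _]; last first.
    by rewrite [u^T _ _]mxE /u row_mxEr [X in _ * X]mxE mulr0.
  apply: eq_bigr => k _; rewrite [u^T _ _]mxE mul_mx_diag [X in X * _]mxE.
  rewrite /u row_mxEl [X in _ * X * _]mxE.
  by rewrite /Defs.eta /= ltn_ord mulr1 expr2.
move=> r2; apply/rowP => k; rewrite mxE; apply/eqP; rewrite -sqrf_eq0.
move/psumr_eq0P: r2 => /(_ (fun k _ => sqr_ge0 (r 0 k))) r2.
by rewrite r2.
Qed.

Context (x : 'I_N -> M -> R).
Hypothesis x_coord : forall m, dom m ->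
  (forall k, smooth_fun (x k) m) /\ xi m = \sum_k x k m *: f i k m.

(** Row [k] lists the components of the Clifford product of xi with the k-th positive
    covector of the coframe; [neg_mx] does the same for the negative ones. *)
Definition pos_mx m : 'M[R]_(p, N) :=
  \matrix_(k, j) \sum_l G (lshift p k) j l * x l m.
Definition neg_mx m : 'M[R]_(p, N) :=
  \matrix_(k, j) \sum_l G (rshift p k) j l * x l m.
Definition gram_mx m : 'M[R]_p := pos_mx m *m (pos_mx m)^T.

(** Components, in the coframe, of covectors annihilating xi.  If the l-th negative
    covector acts on xi as the combination of the positive ones with coefficients
    c, then pairing with the latter gives gram c = (pos neg^T)_l, and Cramer's rule
    solves for det(gram) c.  Multiplying by the determinant instead of dividing by it
    keeps the entries polynomial, hence smooth. *)
Definition kernel_mx m : 'M[R]_(p, n) :=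
  row_mx (- (\adj (gram_mx m) *m (pos_mx m *m (neg_mx m)^T))^T) (\det (gram_mx m))%:M.

Definition kernel_covector (l : 'I_p) m : 'rV[R]_n :=
  \sum_a kernel_mx m l a *: flat g m (e a m).

Lemma kernel_covector_smooth l m : dom m -> smooth_covector (kernel_covector l) m.
Proof.
move=> im; apply: smooth_frame_covector => // a.
have sx k := (x_coord im).1 k.
have sY k j : smooth_fun (fun m' => pos_mx m' k j) m.
  rewrite (_ : (fun _ => _) = fun m' => \sum_l G (lshift p k) j l * x l m').
    by apply: smooth_fun_sum => l' _; apply: smooth_funZ.
  by apply/funext => m'; rewrite mxE.
have sZ k j : smooth_fun (fun m' => neg_mx m' k j) m.
  rewrite (_ : (fun _ => _) = fun m' => \sum_l G (rshift p k) j l * x l m').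
    by apply: smooth_fun_sum => l' _; apply: smooth_funZ.
  by apply/funext => m'; rewrite mxE.
have sGr k j : smooth_fun (fun m' => gram_mx m' k j) m.
  rewrite (_ : (fun _ => _) = fun m' => \sum_l pos_mx m' k l * pos_mx m' j l).
    by apply: smooth_fun_sum => l' _; apply: smooth_funM.
  by apply/funext => m'; rewrite mxE; apply: eq_bigr => l' _; rewrite [_^T _ _]mxE.
case: (split_ordP a) => k ->.
  rewrite (_ : (fun _ => _) = fun m' => -1 * \sum_j \adj (gram_mx m') k j *
      \sum_l' pos_mx m' j l' * neg_mx m' l l').
    apply: smooth_funZ; apply: smooth_fun_sum => j _; apply: smooth_funM.
      exact: smooth_fun_adj.
    by apply: smooth_fun_sum => l' _; apply: smooth_funM.
  apply/funext => m'; rewrite /kernel_mx row_mxEl mxE [X in - X]mxE mulN1r.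
  congr (- _); rewrite mxE; apply: eq_bigr => j _; congr (_ * _).
  by rewrite mxE; apply: eq_bigr => l' _; rewrite [_^T _ _]mxE.
rewrite (_ : (fun _ => _) = fun m' => (l == k)%:R * \det (gram_mx m')).
  by apply: smooth_funZ; apply: smooth_fun_det.
by apply/funext => m'; rewrite /kernel_mx row_mxEr mxE mulr_natl.
Qed.

Section Kernel.
Context (m : M) (im : dom m) (W : {vspace 'rV[R]_n}).
Hypothesis W_ker : forall theta, theta \in W <-> gam m (covec theta) (xi m) = 0.
Hypothesis W_dim : \dim W = p.

Let th a : 'rV[R]_n := flat g m (e a m).

Lemma split_sum (r s : 'rV[R]_p) : (row_mx r s : 'rV[R]_n) *m E m *m g m =
  \sum_k r 0 k *: th (lshift p k) + \sum_k s 0 k *: th (rshift p k).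
Proof.
rewrite -flat_sum big_split_ord /=.
by congr (_ + _); apply: eq_bigr => k _; rewrite ?row_mxEl ?row_mxEr.
Qed.

Lemma gam_split (r s : 'rV[R]_p) :
  gam m (covec ((row_mx r s : 'rV[R]_n) *m E m *m g m)) (xi m) =
  \sum_j (r *m pos_mx m + s *m neg_mx m) 0 j *: f i j m.
Proof.
have thxi a : gam m (covec (th a)) (xi m) =
    \sum_j (\sum_l G a j l * x l m) *: f i j m.
  have [_ ->] := x_coord im; rewrite linear_sum /=.
  transitivity (\sum_l \sum_j (G a j l * x l m) *: f i j m).
    apply: eq_bigr => l _; rewrite linearZ /= (as_gam S_associated) // scaler_sumr.
    by apply: eq_bigr => j _; rewrite scalerA mulrC.
  by rewrite exchange_big; apply: eq_bigr => j _; rewrite scaler_suml.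
rewrite split_sum linearD /= (gamD (gam_rep m)) !linear_sum !(gam_sum (gam_rep m)).
under [RHS]eq_bigr do rewrite mxE scalerDl.
rewrite big_split /=; congr (_ + _).
  transitivity (\sum_k \sum_j (r 0 k * pos_mx m k j) *: f i j m).
    apply: eq_bigr => k _; rewrite /= covecZ (gamZ (gam_rep m)) thxi scaler_sumr.
    by apply: eq_bigr => j _; rewrite scalerA mxE.
  by rewrite exchange_big; apply: eq_bigr => j _; rewrite mxE scaler_suml.
transitivity (\sum_k \sum_j (s 0 k * neg_mx m k j) *: f i j m).
  apply: eq_bigr => k _; rewrite /= covecZ (gamZ (gam_rep m)) thxi scaler_sumr.
  by apply: eq_bigr => j _; rewrite scalerA mxE.
by rewrite exchange_big; apply: eq_bigr => j _; rewrite mxE scaler_suml.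
Qed.

Lemma split_kernel (r s : 'rV[R]_p) :
  (row_mx r s : 'rV[R]_n) *m E m *m g m \in W <->
  r *m pos_mx m + s *m neg_mx m = 0.
Proof.
rewrite W_ker gam_split; split=> [H|->]; last first.
  by rewrite big1 // => j _; rewrite mxE scale0r.
by apply/rowP => j; rewrite [RHS]mxE; apply: (f_free im H).
Qed.

Lemma pos_mx_inj (r : 'rV[R]_p) : r *m pos_mx m = 0 -> r = 0.
Proof.
move=> r0; apply: (positive_annihilator im (xi_neq0 m)).
by apply/W_ker/split_kernel; rewrite r0 mul0mx addr0.
Qed.

Lemma gram_unit : gram_mx m \in unitmx.
Proof.
rewrite -row_free_unit; apply: inj_row_free => r r0; apply: pos_mx_inj.
have : (r *m pos_mx m *m (r *m pos_mx m)^T) 0 0 = 0.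
  by rewrite trmx_mul mulmxA -(mulmxA r) r0 mul0mx mxE.
rewrite mxE => sq0; apply/rowP => j; rewrite [RHS]mxE; apply/eqP; rewrite -sqrf_eq0.
have sq_ge0 k : 0 <= (r *m pos_mx m) 0 k * (r *m pos_mx m)^T k 0.
  by rewrite [X in _ * X]mxE -expr2 sqr_ge0.
have : (r *m pos_mx m) 0 j * (r *m pos_mx m)^T j 0 = 0.
  by apply: (psumr_eq0P _ sq0) => // k _; apply: sq_ge0.
by rewrite [X in _ * X]mxE -expr2 => ->.
Qed.

(** The space [W] of covectors annihilating xi has dimension p and meets the span of the
    positive covectors only in 0, so the two spaces span all covectors. *)
Lemma kernel_graph (s : 'rV[R]_p) : exists r : 'rV[R]_p,
  r *m pos_mx m + s *m neg_mx m = 0.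
Proof.
pose X := [tuple th (lshift p k) | k < p].
have XE (c : 'I_p -> R) : \sum_(k < p) c k *: X`_k =
    (row_mx (\row_k c k) 0 : 'rV[R]_n) *m E m *m g m.
  rewrite split_sum [X in _ + X]big1 ?addr0 => [|k _]; last by rewrite mxE scale0r.
  by apply: eq_bigr => k _; rewrite mxE -tnth_nth tnth_mktuple.
have Xfree : free X.
  apply/freeP => c; rewrite XE => c0 k.
  have : \row_k c k = 0.
    apply: pos_mx_inj; have := (split_kernel (\row_k c k) 0).1.
    by rewrite mul0mx addr0; apply; rewrite c0 mem0v.
  by move/rowP/(_ k); rewrite !mxE.
have WX0 : (W :&: <<X>>)%VS = 0%VS.
  apply/eqP; rewrite -subv0; apply/subvP => y; rewrite memv_cap => /andP[yW yX].
  move: yW; rewrite (coord_span yX) XE => /split_kernel.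
  rewrite mul0mx addr0 => /pos_mx_inj ->.
  by rewrite row_mx0 !mul0mx mem0v.
have full : (W + <<X>>)%VS = fullv.
  apply/eqP; rewrite eqEdim subvf /= dimvf dimv_disjoint_sum // W_dim.
  by rewrite (eqP Xfree) size_tuple /dim /= mul1n.
have : (row_mx 0 s : 'rV[R]_n) *m E m *m g m \in (W + <<X>>)%VS by rewrite full memvf.
case/memv_addP => y yW [z zX E0].
exists (- \row_k coord X k z); apply/split_kernel.
have -> : (row_mx (- \row_k coord X k z) s : 'rV[R]_n) =
    row_mx 0 s - row_mx (\row_k coord X k z) 0.
  by rewrite opp_row_mx oppr0 add_row_mx add0r addr0.
by rewrite !mulmxBl E0 -XE -(coord_span zX) addrK.
Qed.

Lemma kernel_covectorE l :
  kernel_covector l m = row l (kernel_mx m) *m E m *m g m.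
Proof.
by rewrite -flat_sum; apply: eq_bigr => a _; rewrite [in RHS]mxE.
Qed.

Lemma kernel_covector_mem l : kernel_covector l m \in W.
Proof.
rewrite kernel_covectorE /kernel_mx row_row_mx; apply/split_kernel.
have [r rE] := kernel_graph (delta l).
have rr : r *m pos_mx m = - (delta l *m neg_mx m) by apply/eqP; rewrite -addr_eq0 rE.
have gramT : (gram_mx m)^T = gram_mx m by rewrite trmx_mul trmxK.
have -> : row l (- (\adj (gram_mx m) *m (pos_mx m *m (neg_mx m)^T))^T) =
    \det (gram_mx m) *: r.
  rewrite linearN /= !trmx_mul trmxK rowE !mulmxA -2!mulNmx -rr.
  by rewrite -(mulmxA r) -/(gram_mx m) trmx_adj gramT -mulmxA mul_mx_adj mul_mx_scalar.
rewrite rowE mul_mx_scalar -!scalemxAl -scalerDr rr addNr scaler0 //.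
Qed.

Lemma kernel_covector_free : free [tuple kernel_covector l m | l < p].
Proof.
apply/freeP => c c0 l.
have : (\row_l c l) *m kernel_mx m *m (E m *m g m) = 0.
  rewrite -[RHS]c0 -mulmxA mulmx_sum_row; apply: eq_bigr => j _.
  by rewrite mxE -tnth_nth tnth_mktuple kernel_covectorE !row_mul mulmxA.
move/(congr1 (mulmx^~ (invmx (E m *m g m)))); rewrite mul0mx mulmxK; last first.
  by rewrite unitmx_mul frame_unit // gmx_unit.
rewrite mul_mx_row -[0]row_mx0 => /eq_row_mx[_].
rewrite mul_mx_scalar => /rowP/(_ l); rewrite !mxE => /eqP.
rewrite mulf_eq0; have := gram_unit; rewrite unitmxE unitfE => /negbTE -> /=.
by move/eqP.
Qed.

Lemma kernel_covector_span : <<[tuple kernel_covector l m | l < p]>>%VS = W.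
Proof.
apply/eqP; rewrite eqEdim (eqP kernel_covector_free) size_tuple W_dim leqnn andbT.
by apply/span_subvP => y /mapP[l _ ->]; apply: kernel_covector_mem.
Qed.

End Kernel.

End SpinGeometry.

Theorem theorem4p11 (R : realType) (p : nat) (M : manifold R (p + p))
  (M_connected : connected [set: M])
  (g : split_metric M)
  (nu : M -> ext R (p + p)) (nu_vol : volume_form g nu)
  (nab : tconn M) (nab_lc : levi_civita g nab)
  (G : clifford_model R p) (Q : strong_spin_structure G g nu)
  (S : vbundle M (2 ^ p)) (gam : forall m, ext R (p + p) -> 'End(S m))
  (gam_module : clifford_module g gam)
  (B : forall m, S m -> S m -> R) (B_pairing : pairing gam B)
  (f : sp_index Q -> 'I_(2 ^ p) -> section S)
  (S_associated : associated gam B f)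
  (nabS : forall m, 'rV[R]_(p + p) -> section S -> S m)
  (nabS_lift : spin_lift gam f nab nabS)
  (mu : R) (mu_sign : mu = 1 \/ mu = -1)
  (xi : section S) (xi_chiral : chiral nu gam mu xi)
  (xi_neq0 : forall m, xi m != 0) (xi_pure : pure gam xi)
  (alpha : M -> ext R (p + p)) (alpha_form : is_form p alpha)
  (alpha_square : signed_square gam B xi alpha)
  (A : M -> 'rV[R]_(p + p) -> 'rV[R]_(p + p) -> 'rV[R]_(p + p))
  (A_contorsion : contorsion g A) :
  ((forall m v, lift_contorsion g gam nabS A m v xi = 0) <->
   (forall m v, nabla_form nab alpha m v =
      triangle1 (ginv g m) (cont_form g A m v) (alpha m)))
  /\
  ((forall m v, lift_contorsion g gam nabS A m v xi = 0) ->
   is_subbundle p (annihilator alpha) /\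
   preserved (add_contorsion nab A) (annihilator alpha)).
Proof.
have [kappa kappa_sign alphaE] := alpha_square.
have sign_neq0 (c : R) : c = 1 \/ c = -1 -> c != 0.
  by case=> ->; rewrite ?oppr_eq0 oner_eq0.
have [kappa0 mu0] := (sign_neq0 _ kappa_sign, sign_neq0 _ mu_sign).
have [xi_smooth nu_xi] := xi_chiral.
have alpha_hom m := (alpha_form m).1; have alpha_smooth m := (alpha_form m).2.
have square m v : lift_contorsion g gam nabS A m v xi = 0 <->
    nabla_form nab alpha m v = triangle1 (ginv g m) (cont_form g A m v) (alpha m).
  have [i im] := sp_cover Q m.
  exact: (parallel_spinor_square nab_lc gam_module B_pairing S_associated nabS_lift
    xi_smooth alpha_smooth alphaE A_contorsion xi_neq0 kappa0 v im).
have annE m theta : annihilator alpha m theta <-> gam m (covec theta) (xi m) = 0.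
  have [i im] := sp_cover Q m.
  exact: (annihilatorE gam_module B_pairing alphaE nu_vol mu0 nu_xi xi_neq0
    kappa0 alpha_hom theta im).
split; first by split=> H m v; apply/square/H.
move=> parallel; split; last first.
  move=> theta theta_smooth theta_ann m v; apply/annE.
  have [i im] := sp_cover Q m.
  apply: (parallel_preserved nab_lc gam_module B_pairing S_associated nabS_lift
    xi_smooth A_contorsion im theta_smooth) => // m'.
  by apply/annE/theta_ann.
move=> m0; have [i im0] := sp_cover Q m0.
have [x x_coord] := section_expand B_pairing S_associated im0 xi_smooth.
exists (sp_dom i), (kernel_covector i x); split=> //; first exact: sp_open.
move=> m im; have [W W_ker W_dim] := xi_pure m.
have -> : [seq kernel_covector i x l m | l <- enum 'I_p] =
    [tuple kernel_covector i x l m | l < p] by [].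
split=> [l||omega].
- exact: (kernel_covector_smooth x_coord l im).
- exact: (kernel_covector_free gam_module S_associated xi_neq0 x_coord im W_ker).
rewrite (kernel_covector_span gam_module S_associated xi_neq0 x_coord im W_ker W_dim).
by rewrite annE W_ker.
Qed.
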